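(* Let $k$ be a field of characteristic $\neq 2$, let $C$ be a Hurwitz superalgebra over $k$, let $S=\bar C$ be the associated para-Hurwitz superalgebra and let $J=H_3(C)$ be the Jordan superalgebra of hermitian $3\times 3$ matrices over $C$. Let $\Phi:\mathfrak{g}(S_1,S)\to\mathfrak{der}\,J$ be the isomorphism of Lie superalgebras with $\Phi((d_0,d_1,d_2))=D_{(d_0,d_1,d_2)}$ and $\Phi(\iota_i(1\otimes a))=D_i(a)$. Then $\Phi$ extends to an isomorphism of Lie superalgebras $$\Phi_2:\mathfrak{g}(S_2,S)\longrightarrow \mathfrak{pstr}\,J=\mathfrak{str}\,J/kI$$ given as follows: (1) for any $(d_0,d_1,d_2)\in\mathfrak{tri}(S)$, $\Phi_2((d_0,d_1,d_2))=D_{(d_0,d_1,d_2)}+kI$; (2) for any $\alpha_0,\alpha_1,\alpha_2\in k$ with $\alpha_0+\alpha_1+\alpha_2=0$, the image under $\Phi_2$ of the element $(\alpha_0\sigma,\alpha_1\sigma,\alpha_2\sigma)\in\mathfrak{tri}(S_2)$ is $L_{\alpha_2e_1-\alpha_1e_2}+kI$ $(=L_{\alpha_1e_0-\alpha_0e_1}+kI=L_{\alpha_0e_2-\alpha_2e_0}+kI)$; (3) for any $i=0,1,2$, $a\in S$ and $\alpha,\beta\in k$, $\Phi_2\bigl(\iota_i((\alpha 1+\beta u)\otimes a)\bigr)=\bigl(\alpha D_i(a)+\beta L_{\iota_i(a)}\bigr)+kI$.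
   Context: All vector spaces and superspaces are finite dimensional over $k$, $\mathrm{char}\,k\ne 2$. In signs, $(-1)^{xy}$ is $-1$ if the homogeneous elements $x,y$ are both odd and $1$ otherwise. Indices $i=0,1,2$ are taken modulo $3$. Composition superalgebras. A quadratic superform on $U=U_{\bar 0}\oplus U_{\bar 1}$ is a pair $q=(q_{\bar 0},\mathrm{b})$, with $q_{\bar 0}$ a quadratic form on $U_{\bar 0}$ and $\mathrm{b}$ a supersymmetric even bilinear form on $U$ whose restriction to $U_{\bar 0}$ is the polar form $q_{\bar 0}(x+y)-q_{\bar 0}(x)-q_{\bar 0}(y)$; it is regular if $\mathrm{b}$ is nondegenerate. A composition superalgebra is a superalgebra $C$ with a regular quadratic superform $q$ (the norm) such that $q_{\bar 0}(x_{\bar 0}y_{\bar 0})=q_{\bar 0}(x_{\bar 0})q_{\bar 0}(y_{\bar 0})$, $\mathrm{b}(x_{\bar 0}y,x_{\bar 0}z)=q_{\bar 0}(x_{\bar 0})\mathrm{b}(y,z)=\mathrm{b}(yx_{\bar 0},zx_{\bar 0})$, and $\mathrm{b}(xy,zt)+(-1)^{xy+xz+yz}\mathrm{b}(zy,xt)=(-1)^{yz}\mathrm{b}(x,z)\mathrm{b}(y,t)$ for $x_{\bar 0},y_{\bar 0}\in C_{\bar 0}$ and homogeneous $x,y,z,t$. A Hurwitz superalgebra is a unital composition superalgebra; its standard involution is $\bar x=\mathrm{b}(x,1)1-x$; the attached para-Hurwitz superalgebra $\bar C$ is $C$ with the same norm and new product $x\bullet y=\bar x\bar y$. It is a symmetric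 composition superalgebra, i.e. $\mathrm{b}(x\bullet y,z)=\mathrm{b}(x,y\bullet z)$. Triality. For a symmetric composition superalgebra $S$, $\mathfrak{tri}(S)=\mathfrak{tri}(S)_{\bar 0}\oplus\mathfrak{tri}(S)_{\bar 1}$ where $\mathfrak{tri}(S)_{\bar i}=\{(d_0,d_1,d_2)\in\mathfrak{osp}(S,q)_{\bar i}^3: d_0(x\bullet y)=d_1(x)\bullet y+(-1)^{ix}x\bullet d_2(y)\ \forall\text{ homogeneous }x,y\in S\}$, with componentwise bracket; $\mathfrak{osp}(S,q)$ is the orthosymplectic Lie superalgebra of $\mathrm{b}$. Put $\theta(d_0,d_1,d_2)=(d_2,d_0,d_1)$, $l_x(y)=x\bullet y$, $r_x(y)=(-1)^{xy}y\bullet x$, $\sigma_{x,y}(z)=(-1)^{yz}\mathrm{b}(x,z)y-(-1)^{x(y+z)}\mathrm{b}(y,z)x$ and $t_{x,y}=(\sigma_{x,y},\frac12\mathrm{b}(x,y)1-r_xl_y,\frac12\mathrm{b}(x,y)1-l_xr_y)\in\mathfrak{tri}(S)$. The Lie superalgebra $\mathfrak{g}(S,S')$. For symmetric composition superalgebras $S,S'$, $\mathfrak{g}(S,S')=\mathfrak{tri}(S)\oplus\mathfrak{tri}(S')\oplus\bigl(\oplus_{i=0}^2\iota_i(S\otimes S')\bigr)$, where $\iota_i(S\otimes S')$ is a copy of $S\otimes S'$; $\mathfrak{tri}(S)\oplus\mathfrak{tri}(S')$ is a subsuperalgebra with its direct sum bracket, and for homogeneous elements: $[(d_0,d_1,d_2),\iota_i(x\otimes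 x')]=\iota_i(d_i(x)\otimes x')$; $[(d_0',d_1',d_2'),\iota_i(x\otimes x')]=(-1)^{d_i'x}\iota_i(x\otimes d_i'(x'))$; $[\iota_i(x\otimes x'),\iota_{i+1}(y\otimes y')]=(-1)^{x'y}\iota_{i+2}((x\bullet y)\otimes(x'\bullet y'))$; $[\iota_i(x\otimes x'),\iota_i(y\otimes y')]=(-1)^{xx'+xy'+yy'}\mathrm{b}'(x',y')\theta^i(t_{x,y})+(-1)^{yx'}\mathrm{b}(x,y)\theta'^i(t'_{x',y'})$ (primes denote the analogous objects for $S'$). $S_1=k1$ is the para-Hurwitz algebra of $k$ ($1\bullet1=1$, $\mathrm{b}(1,1)=2$, $\mathfrak{tri}(S_1)=0$). $S_2$ is the para-Hurwitz algebra of $k\times k$ (standard involution $(\alpha,\beta)\mapsto(\beta,\alpha)$), with basis $1=(1,1)$, $u=(1,-1)$: $1\bullet1=1$, $1\bullet u=u\bullet1=-u$, $u\bullet u=1$, $q(1)=1$, $q(u)=-1$, $\mathrm{b}(1,u)=0$. Let $\sigma=\frac12\sigma_{1,u}$, so $\sigma(1)=u$, $\sigma(u)=1$; one has $\mathfrak{tri}(S_2)=\{(\alpha_0\sigma,\alpha_1\sigma,\alpha_2\sigma):\alpha_i\in k,\ \alpha_0+\alpha_1+\alpha_2=0\}$. Via $S_1=k1\subset S_2$, $\mathfrak{g}(S_1,S)=\mathfrak{tri}(S)\oplus(\oplus_i\iota_i(1\otimes S))$ is a subsuperalgebra of $\mathfrak{g}(S_2,S)$. The Jordan superalgebra $J=H_3(C)$: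 the hermitian $3\times3$ matrices over $C$ (relative to $(a_{ij})^*=(\bar a_{ji})$) with product $x\circ y=\frac12(xy+(-1)^{xy}yx)$. Write $J=(\oplus_{i=0}^2ke_i)\oplus(\oplus_{i=0}^2\iota_i(S))$, where $e_0,e_1,e_2$ are the diagonal matrix units and $$\iota_0(a)=2\begin{pmatrix}0&0&0\\ 0&0&\bar a\\ 0&a&0\end{pmatrix},\quad \iota_1(a)=2\begin{pmatrix}0&0&a\\ 0&0&0\\ \bar a&0&0\end{pmatrix},\quad \iota_2(a)=2\begin{pmatrix}0&\bar a&0\\ a&0&0\\ 0&0&0\end{pmatrix}.$$ $L_x$ is left multiplication by $x$ in $J$, $I$ is the identity map ($=L_1$), $\mathfrak{der}\,J$ is the Lie superalgebra of derivations of $J$. For $(d_0,d_1,d_2)\in\mathfrak{tri}(S)$, $D_{(d_0,d_1,d_2)}\in\mathfrak{der}\,J$ is given by $e_i\mapsto0$, $\iota_i(a)\mapsto\iota_i(d_i(a))$; and $D_i(a)=2[L_{\iota_i(a)},L_{e_{i+1}}]\in\mathfrak{der}\,J$. (It is known that $\Phi$ is an isomorphism of Lie superalgebras.) The structure Lie superalgebra is $\mathfrak{str}\,J=\mathfrak{der}\,J\oplus L_J\subseteq\mathfrak{gl}(J)$, and the projective structure Lie superalgebra is $\mathfrak{pstr}\,J=\mathfrak{str}\,J/kI$. ''Extends'' means that $\Phi_2$ restricted to $\mathfrak{g}(S_1,S)$ is $\Phi$ followed by the natural injective map $\mathfrak{der}\,J\to\mathfrak{pstr}\,J$.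
   Formalization: In (2) the image is 2L_{α2e1−α1e2}+kI (likewise a factor 2 in the two other expressions): as printed (2) contradicts (3), since [L_{α2e1−α1e2},D_0(a)]=(α0/2)L_{ι_0(a)}, but α0L_{ι_0(a)} is required. C is taken nonzero. *)

(* Defs.v *)
From HB Require Import structures.
From mathcomp Require Import all_boot all_order all_algebra.

Set Implicit Arguments.
Unset Strict Implicit.
Unset Printing Implicit Defensive.

Import GRing.Theory VectorInternalTheory.
Local Open Scope ring_scope.
Local Open Scope quotient_scope.

(* Throughout, a parity is a boolean (true is odd), so that the parity of a   *)
(* product is p (+) q and the sign (-1)^{xy} is (-1) ^+ (p && q).             *)

Record superspace (k : fieldType) := Superspace {
  scar :> vectType k;
  spart : bool -> {vspace scar}
}.

Arguments spart {k} s p.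

Section Superspaces.
Variable k : fieldType.
Implicit Type V : superspace k.

Definition graded V :=
  (spart V false + spart V true = fullv)%VS /\
  (spart V false :&: spart V true = 0)%VS.

Definition sproj V (p : bool) : 'End(V) := daddv_pi (spart V p) (spart V (~~ p)).

Definition end_part V (p : bool) (d : 'End(V)) : Prop :=
  forall r x, x \in spart V r -> d x \in spart V (r (+) p).

Definition end_proj V (p : bool) (d : 'End(V)) : 'End(V) :=
  \sum_(r : bool) (sproj V (r (+) p) \o d \o sproj V r)%VF.

(* The bracket of gl(V): d e - (-1)^{de} e d for homogeneous d and e.         *)
Definition scomm V (d e : 'End(V)) : 'End(V) :=
  \sum_(p : bool) \sum_(q : bool)
    ((end_proj p d \o end_proj q e)%VF
     - (-1) ^+ (p && q) *: (end_proj q e \o end_proj p d)%VF).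

End Superspaces.

(* Only the values of snorm on the even part are meaningful.                  *)
Record qsuperalg (k : fieldType) := QSuperalg {
  qspace :> superspace k;
  smul : qspace -> qspace -> qspace;
  snorm : qspace -> k;
  sform : qspace -> qspace -> k
}.

Arguments smul {k q0} x y : rename.
Arguments snorm {k q0} x : rename.
Arguments sform {k q0} x y : rename.

Section Composition.
Variable k : fieldType.
Implicit Type C : qsuperalg k.

Definition superalgebra C :=
  [/\ graded C,
      forall y : C, linear (smul^~ y),
      forall x : C, linear (smul x)
    & forall p q (x y : C), x \in spart C p -> y \in spart C q ->
        smul x y \in spart C (p (+) q)].

Definition quadratic_superform C :=
  [/\ forall y : C, scalar (sform^~ y),
      forall x : C, scalar (sform x),
      forall p q (x y : C), x \in spart C p -> y \in spart C q ->
        p != q -> sform x y = 0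
    & forall p q (x y : C), x \in spart C p -> y \in spart C q ->
        sform x y = (-1) ^+ (p && q) * sform y x] /\
  [/\ forall (a : k) (x : C), x \in spart C false ->
        snorm (a *: x) = a ^+ 2 * snorm x
    & forall x y : C, x \in spart C false -> y \in spart C false ->
        sform x y = snorm (x + y) - snorm x - snorm y].

Definition regular C := forall x : C, (forall y, sform x y = 0) -> x = 0.

Definition composition C :=
  [/\ superalgebra C, quadratic_superform C & regular C] /\
  [/\ forall x y : C, x \in spart C false -> y \in spart C false ->
        snorm (smul x y) = snorm x * snorm y,
      forall q r (x y z : C), x \in spart C false ->
        y \in spart C q -> z \in spart C r ->
        sform (smul x y) (smul x z) = snorm x * sform y z /\
        sform (smul y x) (smul z x) = snorm x * sform y z
    & forall p q r s (x y z t : C),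
        x \in spart C p -> y \in spart C q ->
        z \in spart C r -> t \in spart C s ->
        sform (smul x y) (smul z t)
          + (-1) ^+ ((p && q) (+) (p && r) (+) (q && r))
            * sform (smul z y) (smul x t)
        = (-1) ^+ (q && r) * (sform x z * sform y t)].

(* The zero superalgebra is excluded, since H_3(C) needs the diagonal ke_i. *)
Definition hurwitz C (one : C) :=
  [/\ composition C, one != 0,
      forall x : C, smul one x = x & forall x : C, smul x one = x].

Definition sconj C (one : C) (x : C) : C := sform x one *: one - x.

Definition para C (one : C) : qsuperalg k :=
  @QSuperalg k C (fun x y => smul (sconj one x) (sconj one y)) snorm sform.

End Composition.

Section SmallHurwitz.
Variable k : fieldType.

Definition evenspace (V : vectType k) : superspace k :=
  @Superspace k V (fun p => if p then 0%VS else fullv).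

Definition hurwitz1 : qsuperalg k :=
  @QSuperalg k (evenspace k^o) (fun x y : k => x * y) (fun x : k => x ^+ 2)
    (fun x y : k => 2 * (x * y)).

Definition hurwitz2 : qsuperalg k :=
  @QSuperalg k (evenspace (k^o * k^o)%type)
    (fun x y : k * k => (x.1 * y.1, x.2 * y.2)) (fun x : k * k => x.1 * x.2)
    (fun x y : k * k => x.1 * y.2 + x.2 * y.1).

Definition S1 : qsuperalg k := @para k hurwitz1 (1 : k).
Definition S2 : qsuperalg k := @para k hurwitz2 ((1, 1) : k * k).

Definition S1_one : S1 := (1 : k).
Definition S2_one : S2 := ((1, 1) : k * k).
Definition S2_u : S2 := ((1, -1) : k * k).

End SmallHurwitz.

(* Indices live in 'I_3, whose addition is that of the integers modulo 3.     *)
(* Formulas with signs make sense for homogeneous elements; they are extended *)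
(* multilinearly by summing over the homogeneous components.                  *)

Definition triple (k : fieldType) (V : superspace k) : vectType k :=
  {ffun 'I_3 -> 'End(V)}.

Definition mk_triple (k : fieldType) (V : superspace k) (d0 d1 d2 : 'End(V)) :
  triple V := [ffun i : 'I_3 => if i == 0 then d0 else if i == 1 then d1 else d2].

Section Triality.
Variables (k : fieldType) (S : qsuperalg k).
Implicit Types (x y z : S) (d : triple S).
Local Notation proj p := (sproj S p).

Definition osp_part (p : bool) (d : 'End(S)) : Prop :=
  end_part p d /\
  forall q x y, x \in spart S q ->
    sform (d x) y + (-1) ^+ (p && q) * sform x (d y) = 0.

Definition tri_part (p : bool) d : Prop :=
  (forall i, osp_part p (d i)) /\
  forall q r x y, x \in spart S q -> y \in spart S r ->
    d 0 (smul x y) = smul (d 1 x) y + (-1) ^+ (p && q) *: smul x (d 2 y).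

Definition tri d : Prop :=
  exists d0 d1, [/\ tri_part false d0, tri_part true d1 & d = d0 + d1].

(* theta (d0, d1, d2) = (d2, d0, d1), iterated i times.                       *)
Definition theta (i : 'I_3) d : triple S := [ffun j : 'I_3 => d (j - i)].

Definition lmult x : 'End(S) := linfun (smul x).

Definition rmult x : 'End(S) := linfun (fun y =>
  \sum_(p : bool) \sum_(q : bool)
    (-1) ^+ (p && q) *: smul (proj q y) (proj p x)).

Definition sigma x y : 'End(S) := linfun (fun z =>
  \sum_(p : bool) \sum_(q : bool) \sum_(r : bool)
    ((-1) ^+ (q && r) * sform (proj p x) (proj r z) *: proj q y
     - (-1) ^+ (p && (q (+) r)) * sform (proj q y) (proj r z) *: proj p x)).

Definition tt x y : triple S :=
  mk_triple (sigma x y)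
            ((2^-1 * sform x y) *: \1%VF - (rmult x \o lmult y)%VF)
            ((2^-1 * sform x y) *: \1%VF - (lmult x \o rmult y)%VF).

End Triality.

Definition S2_sigma (k : fieldType) : 'End(S2 k) :=
  2^-1 *: sigma (S2_one k) (S2_u k).

(* V (x) W is modelled on matrices, via the coordinates v2r and r2v of the    *)
(* library; tlift f is the linear map on V (x) W induced by a bilinear f.     *)
Definition tensor (k : fieldType) (V W : vectType k) : vectType k :=
  'M[k]_(dim V, dim W).

Section Tensor.
Variables (k : fieldType) (V W : vectType k).

Definition tpure (x : V) (y : W) : tensor V W := (v2r x)^T *m v2r y.

Definition tlift (Z : lmodType k) (f : V -> W -> Z) (t : tensor V W) : Z :=
  \sum_i \sum_j (t : 'M[k]_(_, _)) i j *:
    f (r2v (delta_mx 0 i)) (r2v (delta_mx 0 j)).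

Definition tspan (U : {vspace V}) (U' : {vspace W}) : {vspace tensor V W} :=
  <<[seq tpure x y | x <- vbasis U, y <- vbasis U']>>%VS.

End Tensor.

Definition stensor (k : fieldType) (V W : superspace k) : superspace k :=
  @Superspace k (tensor V W)
    (fun p => \sum_(q : bool) tspan (spart V q) (spart W (p (+) q)))%VS.

(* As groups in MathComp, Lie superalgebras are given inside an ambient space *)
(* lcar: the superalgebra itself is lpart false (+) lpart true, and only the  *)
(* values of the bracket there are meaningful.                                *)
Record lie_data (k : fieldType) := LieData {
  lcar : lmodType k;
  lpart : bool -> lcar -> Prop;
  lbr : lcar -> lcar -> lcar
}.

Section Lie.
Variable k : fieldType.
Implicit Type L : lie_data k.

Definition lmem L (x : lcar L) : Prop :=
  exists x0 x1, [/\ lpart false x0, lpart true x1 & x = x0 + x1].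

(* The last axiom follows from the Jacobi identity unless k has               *)
(* characteristic 3.                                                          *)
Definition lie_superalgebra L : Prop :=
  [/\ forall p, lpart p (0 : lcar L),
      forall p (a : k) (x y : lcar L),
        lpart p x -> lpart p y -> lpart p (a *: x + y)
    & forall x : lcar L, lpart false x -> lpart true x -> x = 0] /\
  [/\ forall p q (x y : lcar L),
        lpart p x -> lpart q y -> lpart (p (+) q) (lbr x y),
      forall (a : k) (x y z : lcar L), lmem x -> lmem y -> lmem z ->
        lbr (a *: x + y) z = a *: lbr x z + lbr y z
    & forall (a : k) (x y z : lcar L), lmem x -> lmem y -> lmem z ->
        lbr z (a *: x + y) = a *: lbr z x + lbr z y] /\
  [/\ forall p q (x y : lcar L), lpart p x -> lpart q y ->
        lbr x y = - ((-1) ^+ (p && q) *: lbr y x),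
      forall p q r (x y z : lcar L), lpart p x -> lpart q y -> lpart r z ->
        lbr x (lbr y z) = lbr (lbr x y) z + (-1) ^+ (p && q) *: lbr y (lbr x z)
    & forall x : lcar L, lpart true x -> lbr x (lbr x x) = 0].

Definition lie_iso (L M : lie_data k) (f : {linear lcar L -> lcar M}) : Prop :=
  [/\ lie_superalgebra L & lie_superalgebra M] /\
  [/\ forall p x, lpart p x -> lpart p (f x),
      forall x, lmem x -> f x = 0 -> x = 0,
      forall y, lmem y -> exists2 x, lmem x & f x = y
    & forall x y, lmem x -> lmem y -> f (lbr x y) = lbr (f x) (f y)].

End Lie.

Section GSS.
Variables (k : fieldType) (S S' : qsuperalg k).
Local Notation T := (stensor S S').

Definition gcar : lmodType k :=
  (triple S * triple S' * {ffun 'I_3 -> T})%type.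

Definition gtri (d : triple S) : gcar := (d, 0, 0).
Definition gtri' (d : triple S') : gcar := (0, d, 0).
Definition giota (i : 'I_3) (t : T) : gcar :=
  (0, 0, [ffun j : 'I_3 => if j == i then t else 0]).

Definition gpart (p : bool) (x : gcar) : Prop :=
  [/\ tri_part p x.1.1, tri_part p x.1.2 & forall i, x.2 i \in spart T p].

Definition gproj (p : bool) (x : gcar) : gcar :=
  ([ffun i => end_proj p (x.1.1 i)], [ffun i => end_proj p (x.1.2 i)],
   [ffun i => sproj T p (x.2 i)]).

(* The linear extension to tensors of a map F given on pairs of homogeneous   *)
(* pure tensors; F p p' q q' x x' y y' is the value at x (x) x', y (x) y',    *)
(* where p, p', q, q' are the parities of x, x', y, y'.                       *)
Definition tlift2 (Z : lmodType k)
    (F : bool -> bool -> bool -> bool -> S -> S' -> S -> S' -> Z) (t s : T) : Z :=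
  \sum_(p : bool) \sum_(p' : bool) \sum_(q : bool) \sum_(q' : bool)
    tlift (fun x x' => tlift (fun y y' =>
      F p p' q q' (sproj S p x) (sproj S' p' x') (sproj S q y) (sproj S' q' y'))
    s) t.

(* [d, iota_i t] and [d', iota_i t] for d in tri(S), d' in tri(S').           *)
Definition gact (d : 'End(S)) (t : T) : T :=
  tlift (fun x x' => tpure (d x) x' : T) t.

Definition gact' (d' : 'End(S')) (t : T) : T :=
  \sum_(p : bool) \sum_(q : bool)
    tlift (fun x x' => (-1) ^+ (p && q) *:
      tpure (sproj S q x) (end_proj p d' x') : T) t.

(* [iota_i t, iota_{i+1} s] = iota_{i+2} (gnext t s).                         *)
Definition gnext (t s : T) : T :=
  tlift2 (fun p p' q q' x x' y y' => (-1) ^+ (p' && q) *: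
    tpure (smul x y) (smul x' y') : T) t s.

(* [iota_i t, iota_i s] = gsame i t s + gsame' i t s.                         *)
Definition gsame (i : 'I_3) (t s : T) : triple S :=
  tlift2 (fun p p' q q' x x' y y' =>
    (-1) ^+ ((p && p') (+) (p && q') (+) (q && q')) * sform x' y'
      *: theta i (tt x y)) t s.

Definition gsame' (i : 'I_3) (t s : T) : triple S' :=
  tlift2 (fun p p' q q' x x' y y' =>
    (-1) ^+ (q && p') * sform x y *: theta i (tt x' y')) t s.

(* The terms d e, [d, iota_i s], [d', iota_i s] and [iota_i t, iota_{i+1} s]. *)
Definition ghalf (x y : gcar) : gcar :=
  ([ffun i => (x.1.1 i \o y.1.1 i)%VF], [ffun i => (x.1.2 i \o y.1.2 i)%VF],
   [ffun j => gact (x.1.1 j) (y.2 j) + gact' (x.1.2 j) (y.2 j)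
              + gnext (x.2 (j + 1)) (y.2 (j + 2))]).

Definition gbr (x y : gcar) : gcar :=
  \sum_(p : bool) \sum_(q : bool)
    (ghalf (gproj p x) (gproj q y)
     - (-1) ^+ (p && q) *: ghalf (gproj q y) (gproj p x))
  + (\sum_i gsame i (x.2 i) (y.2 i), \sum_i gsame' i (x.2 i) (y.2 i), 0).

Definition gSS : lie_data k := @LieData k gcar gpart gbr.

End GSS.

(* The inclusion of g(S1, S) into g(S2, S) given by S1 = k1; tri(S1) = 0.     *)
Definition gincl (k : fieldType) (S : qsuperalg k) (x : gcar (S1 k) S) :
    gcar (S2 k) S :=
  (0, x.1.2, [ffun i : 'I_3 =>
     tlift (fun (c : S1 k) a => tpure ((c : k) *: S2_one k) a : stensor (S2 k) S)
           (x.2 i)]).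

Definition mat3 (k : fieldType) (V : vectType k) : vectType k :=
  {ffun 'I_3 * 'I_3 -> V}.

Section Jordan.
Variables (k : fieldType) (C : qsuperalg k) (one : C).
Local Notation M := (mat3 C).

Definition mstar (x : M) : M := [ffun ij => sconj one (x (ij.2, ij.1))].

Definition herm : {vspace M} := fixedSpace (linfun mstar).

Definition mmul (x y : M) : M :=
  [ffun ij => \sum_(l : 'I_3) smul (x (ij.1, l)) (y (l, ij.2))].

Definition mproj (p : bool) (x : M) : M := [ffun ij => sproj C p (x ij)].

Definition J : superspace k :=
  @Superspace k (subvs_of herm) (fun p =>
    \bigcap_(ij : 'I_3 * 'I_3)
       (linfun (fun x : subvs_of herm => vsval x ij) @^-1: spart C p))%VS.

(* vsproj makes a hermitian matrix an element of J.                           *)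
Definition jmul (x y : J) : J :=
  vsproj herm (2^-1 *: \sum_(p : bool) \sum_(q : bool)
    (mmul (mproj p (vsval x)) (mproj q (vsval y))
     + (-1) ^+ (p && q) *: mmul (mproj q (vsval y)) (mproj p (vsval x)))).

Definition jE (i : 'I_3) : J :=
  vsproj herm [ffun ij => if ij == (i, i) then one else 0].

Definition jiota (i : 'I_3) (a : C) : J :=
  vsproj herm (2 *: [ffun ij =>
    if ij == (i + 2, i + 1) then a
    else if ij == (i + 1, i + 2) then sconj one a else 0]).

Definition jL (x : J) : 'End(J) := linfun (jmul x).

(* The coordinate of x in iota_i(S) is half its entry at (i + 2, i + 1).      *)
Definition jDtri (d : triple (para one)) : 'End(J) :=
  linfun (fun x : J => \sum_i
    jiota i (d i (2^-1 *: vsval x (i + 2, i + 1)))).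

Definition jD (i : 'I_3) (a : C) : 'End(J) :=
  2 *: scomm (jL (jiota i a)) (jL (jE (i + 1))).

Definition der_part (p : bool) (d : 'End(J)) : Prop :=
  end_part p d /\
  forall q r x y, x \in spart J q -> y \in spart J r ->
    d (jmul x y) = jmul (d x) y + (-1) ^+ (p && q) *: jmul x (d y).

Definition derJ : lie_data k := @LieData k 'End(J) der_part (@scomm k J).

Definition str_part (p : bool) (X : 'End(J)) : Prop :=
  exists D x, [/\ der_part p D, x \in spart J p & X = D + jL x].

End Jordan.

(* The quotient of V by a subspace U, whose elements are the cosets of U.     *)
Definition vquot (k : fieldType) (V : vectType k) (U : {vspace V}) : Type :=
  {ideal_quot (U : {pred V})}.

Section VQuot.
Variables (k : fieldType) (V : vectType k) (U : {vspace V}).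

HB.instance Definition _ := GRing.Zmodule.on (vquot U).

Definition coset (x : V) : vquot U := \pi_{ideal_quot (U : {pred V})} x.

Definition crepr (c : vquot U) : V := repr (c : {ideal_quot (U : {pred V})}).

Lemma creprK c : coset (crepr c) = c. Proof. exact: reprK. Qed.

Lemma cosetP x y : reflect (coset x = coset y) (x - y \in U).
Proof.
by apply: (iffP idP) => [|/eqP]; rewrite Quotient.idealrBE => // /eqP.
Qed.

Lemma crepr_coset x : crepr (coset x) - x \in U.
Proof. by apply/cosetP; rewrite creprK. Qed.

Lemma cosetD x y : coset (x + y) = coset x + coset y.
Proof. exact: Quotient.pi_add. Qed.

Definition cscale (a : k) (c : vquot U) : vquot U := coset (a *: crepr c).

Lemma coset_scale a x : coset (a *: x) = cscale a (coset x).
Proof.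
apply/esym/cosetP; rewrite -scalerBr; exact/memvZ/crepr_coset.
Qed.

Lemma cscaleA a b c : cscale a (cscale b c) = cscale (a * b) c.
Proof. by rewrite -[c]creprK -!coset_scale scalerA. Qed.

Lemma cscale1 : left_id 1 cscale.
Proof. by move=> c; rewrite -[c]creprK -coset_scale scale1r. Qed.

Lemma cscaleDr : right_distributive cscale +%R.
Proof.
move=> a b c; rewrite -[b]creprK -[c]creprK -cosetD -!coset_scale -cosetD.
by rewrite scalerDr.
Qed.

Lemma cscaleDl c : {morph cscale^~ c : a b / a + b}.
Proof. by move=> a b; rewrite -[c]creprK -!coset_scale -cosetD scalerDl. Qed.

HB.instance Definition _ := GRing.Zmodule_isLmodule.Build k (vquot U)
  cscaleA cscale1 cscaleDr cscaleDl.

Lemma coset_is_linear : linear coset.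
Proof. by move=> a x y; rewrite cosetD coset_scale. Qed.

HB.instance Definition _ := GRing.isLinear.Build k V (vquot U) _ coset
  coset_is_linear.

End VQuot.

Section ProjectiveStructure.
Variables (k : fieldType) (C : qsuperalg k) (one : C).
Local Notation J := (J one).

Definition kI : {vspace 'End(J)} := <[\1%VF]>%VS.

Definition pgl : lmodType k := vquot kI.

(* The bracket induced by that of gl(J), in which I is central.               *)
Definition pgl_br (X Y : pgl) : pgl := coset kI (scomm (crepr X) (crepr Y)).

Definition pstr_part (p : bool) (X : pgl) : Prop :=
  exists2 Y, str_part p Y & X = coset kI Y.

Definition pstrJ : lie_data k := @LieData k pgl pstr_part pgl_br.

End ProjectiveStructure.

(* Submission.v *)
Require Import Defs.
From HB Require Import structures.
From mathcomp Require Import all_boot all_order all_algebra.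
From mathcomp Require Import ring.

Set Implicit Arguments.
Unset Strict Implicit.
Unset Printing Implicit Defensive.

Import GRing.Theory VectorInternalTheory.
Local Open Scope ring_scope.

(** The superalgebra g(S2, S) is graded by the integers modulo 2, through
    S2 = k1 + ku: its even part is g(S1, S) and its odd part consists of tri(S2)
    and of the tensors u (x) b. On the other side pstr J is der J plus the
    multiplications L_x modulo the identity. The map sends the even part to
    der J by Phi and the odd part to the L_x, x in J modulo k1, so that it is
    [x |-> Phi (pr x) + jL (wJ x)] followed by the projection, where [pr] and
    [wJ] take the even and the odd components.

    Brackets are preserved on two even elements because they are by Phi. On an
    even and an odd element this is the identity [D, L_x] = L_(D x) for a
    derivation D ([der_jL]), combined with the explicit action of [D_i a] and
    of triality triples on J ([Phi_g1_jel]); the two sides are compared in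
    [wJ_gbr], up to a multiple of the unit of J. On two odd elements one has to
    know the commutator [L_x, L_y]. It is not computed by applying it to J, which
    would involve products of three elements of C, and so the Jordan identity.
    Instead the relations between the D_i(a) in g(S1, S) are known through Phi,
    and D_j(b) is itself twice the commutator of L at iota_j(b) and at
    e_(j+1); the derivation D_i(a) distributes over this commutator, which
    gives

      [L at iota_i a, L at iota_i b] = - [D_i a, D_i b],
      [L at iota_i a, L at iota_(i+1) b] = [D_i a, D_(i+1) b]

    ([scomm_jL_same], [scomm_jL_next]). Hence all commutators [L_x, L_y] are
    values of Phi ([psi_Phi]) and in particular derivations, so that pstr J is
    a Lie superalgebra ([pstr_lie]).

    All this only uses the products of the elements e_i and iota_i(a) of J
    ([jel_mul]), which rest on the fact that the conjugation of C reverses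
    products up to sign ([sconj_mul]). The map is injective because the unit of
    J separates L_x from der J and Phi is injective, and surjective because Phi
    is. The Lie superalgebra axioms for g(S2, S) follow by transport
    ([gSS2_lie]).

    Since S1 and S2 are purely even, the signs and parity projections of the
    bracket are trivial on their side. Elements of J and of g(Si, S) are handled
    through coordinates: [jel], [g1] and [g2]. *)

(** * Linear maps given by a proof of linearity *)

Section BareLinear.
Variables (k : fieldType) (U V : lmodType k) (f : U -> V).
Hypothesis f_lin : linear f.

HB.instance Definition _ := GRing.isLinear.Build k U V _ f f_lin.

Lemma lin0 : f 0 = 0. Proof. exact: linear0. Qed.
Lemma linD : {morph f : x y / x + y}. Proof. exact: linearD. Qed.
Lemma linN : {morph f : x / - x}. Proof. exact: linearN. Qed.
Lemma linB : {morph f : x y / x - y}. Proof. exact: linearB. Qed.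
Lemma linZ a : {morph f : x / a *: x}. Proof. by move=> x; rewrite linearZ. Qed.
Lemma lin_sum I r (P : pred I) F :
  f (\sum_(i <- r | P i) F i) = \sum_(i <- r | P i) f (F i).
Proof. exact: linear_sum. Qed.

End BareLinear.

Section BareScalar.
Variables (k : fieldType) (U : lmodType k) (f : U -> k).
Hypothesis f_lin : scalar f.

HB.instance Definition _ := GRing.isLinear.Build k U k _ f f_lin.

Lemma scal0 : f 0 = 0. Proof. exact: linear0. Qed.
Lemma scalD : {morph f : x y / x + y}. Proof. exact: linearD. Qed.
Lemma scalB : {morph f : x y / x - y}. Proof. exact: linearB. Qed.
Lemma scalZ a x : f (a *: x) = a * f x. Proof. by rewrite linearZ. Qed.
End BareScalar.

Lemma lin_lfunE (k : fieldType) (U V : vectType k) (f : U -> V) :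
  linear f -> linfun f =1 f.
Proof.
move=> f_lin x.
pose g : {linear U -> V} := HB.pack f (GRing.isLinear.Build k U V _ f f_lin).
exact: (lfunE g).
Qed.

Lemma linear_linfun (k : fieldType) (U V : vectType k) (W : lmodType k)
    (F : W -> U -> V) :
  (forall w, linear (F w)) -> (forall x, linear (F^~ x)) ->
  linear (fun w => linfun (F w)).
Proof.
move=> F2 F1 a u v; apply/lfunP=> x.
by rewrite add_lfunE scale_lfunE !lin_lfunE // F1.
Qed.

Lemma linear_idfun (k : fieldType) (U : lmodType k) : linear (fun x : U => x).
Proof. by []. Qed.

Lemma linear_comp (k : fieldType) (U V W : lmodType k) (f : V -> W) (g : U -> V) :
  linear f -> linear g -> linear (fun x => f (g x)).
Proof. by move=> f_lin g_lin a x y; rewrite g_lin f_lin. Qed.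

Lemma linear_addf (k : fieldType) (U V : lmodType k) (f g : U -> V) :
  linear f -> linear g -> linear (fun x => f x + g x).
Proof.
by move=> f_lin g_lin a x y; rewrite f_lin g_lin scalerDr addrACA.
Qed.

Lemma linear_scalef (k : fieldType) (U V : lmodType k) c (f : U -> V) :
  linear f -> linear (fun x => c *: f x).
Proof.
by move=> f_lin a x y; rewrite f_lin scalerDr !scalerA mulrC.
Qed.

Lemma linear_subf (k : fieldType) (U V : lmodType k) (f g : U -> V) :
  linear f -> linear g -> linear (fun x => f x - g x).
Proof.
move=> f_lin g_lin a x y; rewrite f_lin g_lin scalerBr opprD.
by rewrite addrACA.
Qed.

Lemma linear_sumf (k : fieldType) (U V : lmodType k) (I : Type) (r : seq I)
    (F : I -> U -> V) :
  (forall i, linear (F i)) -> linear (fun x => \sum_(i <- r) F i x).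
Proof.
move=> F_lin a x y; rewrite scaler_sumr -big_split /=.
by apply: eq_bigr => i _; rewrite F_lin.
Qed.

Lemma linear_scalev (k : fieldType) (U V : lmodType k) (f : U -> k) (v : V) :
  scalar f -> linear (fun x => f x *: v).
Proof. by move=> f_lin a x y; rewrite f_lin scalerDl scalerA. Qed.

Lemma linear_of_lfun (k : fieldType) (U V : vectType k) (f : 'Hom(U, V)) :
  linear f.
Proof. exact: linearP. Qed.

Lemma sum_bool2 (V : nmodType) p q (F : bool -> bool -> V) :
  (forall r s, (r != p) || (s != q) -> F r s = 0) ->
  \sum_(r : bool) \sum_(s : bool) F r s = F p q.
Proof.
move=> F0; rewrite (bigD1 p) //= (bigD1 q) //= !big1 ?addr0 // => r rp.
  by rewrite big1 // => s _; rewrite F0 // rp.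
by rewrite F0 // rp orbT.
Qed.

(** * Identities in modules *)

(** Formal linear combinations; comparing their coefficients reduces an
    identity between module elements to identities between scalars. *)
Inductive lincomb (R : Type) :=
  | LAtom of nat
  | LZero
  | LAdd of lincomb R & lincomb R
  | LOpp of lincomb R
  | LScale of R & lincomb R.

Section Lincomb.
Variables (R : comNzRingType) (V : lmodType R).

Fixpoint lincomb_eval (env : seq V) (e : lincomb R) : V :=
  match e with
  | LAtom n => env`_n
  | LZero => 0
  | LAdd e1 e2 => lincomb_eval env e1 + lincomb_eval env e2
  | LOpp e1 => - lincomb_eval env e1
  | LScale a e1 => a *: lincomb_eval env e1
  end.

Fixpoint lincomb_coef (i : nat) (e : lincomb R) : R :=
  match e with
  | LAtom n => (n == i)%:R
  | LZero => 0
  | LAdd e1 e2 => lincomb_coef i e1 + lincomb_coef i e2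
  | LOpp e1 => - lincomb_coef i e1
  | LScale a e1 => a * lincomb_coef i e1
  end.

Lemma lincomb_evalE env e :
  lincomb_eval env e = \sum_(i < size env) lincomb_coef i e *: env`_i.
Proof.
elim: e => [n | | e1 IH1 e2 IH2 | e IH | a e IH] /=.
- have [n_lt | n_ge] := ltnP n (size env).
    rewrite (bigD1 (Ordinal n_lt)) //= eqxx scale1r big1 ?addr0 // => i ni.
    suff /negPf->: n != i by rewrite scale0r.
    by apply: contra ni => /eqP ni; apply/eqP/val_inj.
  rewrite nth_default // big1 // => i _.
  suff /negPf->: n != i by rewrite scale0r.
  by rewrite neq_ltn (leq_trans _ n_ge) ?orbT.
- by rewrite big1 // => i _; rewrite scale0r.
- by rewrite IH1 IH2 -big_split; apply: eq_bigr => i _; rewrite scalerDl.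
- by rewrite IH -sumrN; apply: eq_bigr => i _; rewrite scaleNr.
by rewrite IH scaler_sumr; apply: eq_bigr => i _; rewrite scalerA.
Qed.

Lemma lincomb_eq env e1 e2 :
  foldr (fun i P => lincomb_coef i e1 = lincomb_coef i e2 /\ P) True
        (iota 0 (size env)) ->
  lincomb_eval env e1 = lincomb_eval env e2.
Proof.
move=> coef_eq; rewrite !lincomb_evalE; apply: eq_bigr => i _; congr (_ *: _).
have: nat_of_ord i \in iota 0 (size env) by rewrite mem_iota ltn_ord.
elim: (iota _ _) coef_eq => //= n s IHs [n_eq s_eq].
by rewrite inE => /predU1P[-> //|]; apply: IHs.
Qed.

End Lincomb.

Ltac lincomb_index x env :=
  lazymatch env with
  | @cons _ x _ => constr:(0%N)
  | @cons _ _ ?env' => let n := lincomb_index x env' in constr:(S n)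
  end.

Ltac lincomb_reify R env t :=
  lazymatch t with
  | (?a + ?b)%R => let e1 := lincomb_reify R env a in
      let e2 := lincomb_reify R env b in constr:(@LAdd R e1 e2)
  | (- ?a)%R => let e := lincomb_reify R env a in constr:(@LOpp R e)
  | (?c *: ?a)%R => let e := lincomb_reify R env a in constr:(@LScale R c e)
  | 0%R => constr:(@LZero R)
  | _ => let n := lincomb_index t env in constr:(@LAtom R n)
  end.

(** [lincomb R V env] reduces an equality in the [R]-module [V] between linear
    combinations of the entries of [env] to equalities in [R], which it hands
    to [ring]. *)
Ltac lincomb R V env :=
  lazymatch goal with
  | |- ?x = ?y =>
    let e1 := lincomb_reify (GRing.ComNzRing.sort R) env x in
    let e2 := lincomb_reify (GRing.ComNzRing.sort R) env y in
    refine (@lincomb_eq R V env e1 e2 _); cbn -[GRing.add GRing.mul GRing.opp GRing.scale GRing.exp GRing.zero GRing.one GRing.natmul GRing.inv];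
    do ?[split]; rewrite ?mulr0n ?mulr1n; try ring
  end.

(** * Superspaces *)

Section SuperspaceTheory.
Variables (k : fieldType) (V : superspace k).
Implicit Types (p q r : bool) (x y : V) (d e f : 'End(V)).

Lemma sproj_mem p x : sproj V p x \in spart V p.
Proof. exact: memv_pi. Qed.

Lemma end_proj_lin p : linear (@end_proj k V p).
Proof.
move=> a d e; rewrite /end_proj scaler_sumr -big_split /=.
apply: eq_bigr => r _; apply/lfunP=> x.
by rewrite !(add_lfunE, scale_lfunE, comp_lfunE) !linearD !linearZ.
Qed.

Lemma end_part0 p : @end_part k V p 0.
Proof. by move=> r x _; rewrite zero_lfunE mem0v. Qed.

Lemma end_partP p a d e :
  end_part p d -> end_part p e -> end_part p (a *: d + e).
Proof.
move=> hd he r x xr; rewrite add_lfunE scale_lfunE.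
by rewrite memvD ?memvZ ?hd ?he.
Qed.

Lemma end_part_comp p q d e :
  end_part p d -> end_part q e -> end_part (p (+) q) (d \o e)%VF.
Proof.
by move=> hd he r x xr; rewrite comp_lfunE addbCA addbC hd // he.
Qed.

Lemma end_part_id : @end_part k V false \1%VF.
Proof. by move=> r x xr; rewrite id_lfunE addbF. Qed.

Lemma scomm_linl e : linear ((@scomm k V)^~ e).
Proof.
apply: linear_sumf => p; apply: linear_sumf => q; apply: linear_subf.
  move=> a d d'; rewrite end_proj_lin; apply/lfunP=> x.
  by rewrite !(add_lfunE, scale_lfunE, comp_lfunE).
apply: linear_scalef => a d d'; rewrite end_proj_lin; apply/lfunP=> x.
by rewrite !(add_lfunE, scale_lfunE, comp_lfunE) linearD linearZ.
Qed.

Lemma scomm_linr d : linear (@scomm k V d).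
Proof.
apply: linear_sumf => p; apply: linear_sumf => q; apply: linear_subf.
  move=> a e e'; rewrite end_proj_lin; apply/lfunP=> x.
  by rewrite !(add_lfunE, scale_lfunE, comp_lfunE) linearD linearZ.
apply: linear_scalef => a e e'; rewrite end_proj_lin; apply/lfunP=> x.
by rewrite !(add_lfunE, scale_lfunE, comp_lfunE).
Qed.

Section Disjoint.
Hypothesis dV : (spart V false :&: spart V true = 0)%VS.

Lemma spart_disjoint p x : x \in spart V p -> x \in spart V (~~ p) -> x = 0.
Proof.
move=> xp xnp; apply/eqP; rewrite -memv0 -dV memv_cap.
by case: p xp xnp => /= -> ->.
Qed.

Lemma sprojE p q x : x \in spart V q -> sproj V p x = if p == q then x else 0.
Proof.
have dp r : (spart V r :&: spart V (~~ r) = 0)%VS by case: r; rewrite //= capvC.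
case: eqP => [<- | pq] xq; first exact: daddv_pi_id.
have npE : ~~ p = q by case: p q pq {xq} => [] [].
have := @daddv_pi_add _ _ _ _ x (dp p); rewrite npE.
rewrite (@daddv_pi_id _ _ (spart V q)) // ; last by rewrite capvC -npE dp.
move=> /(_ (subvP (addvSr _ _) _ xq)) /(canRL (addrK _)).
by rewrite subrr /sproj npE.
Qed.

End Disjoint.

Section Graded.
Hypothesis gV : graded V.

Let dV : (spart V false :&: spart V true = 0)%VS. Proof. exact: gV.2. Qed.

Lemma sproj_sum x : \sum_(p : bool) sproj V p x = x.
Proof.
have [sV _] := gV; rewrite big_bool /= addrC.
by rewrite daddv_pi_add // sV memvf.
Qed.

Lemma graded_ind (P : V -> Prop) :
  (forall p x, x \in spart V p -> P x) ->
  (forall x y, P x -> P y -> P (x + y)) -> forall x, P x.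
Proof.
move=> P1 PD x; rewrite -[x]sproj_sum big_bool.
by apply: PD; apply: P1; apply: sproj_mem.
Qed.

Lemma lfun_graded_eq d e :
  (forall p x, x \in spart V p -> d x = e x) -> d = e.
Proof.
move=> eq_de; apply/lfunP; apply: graded_ind => // x y dx dy.
by rewrite !linearD /= dx dy.
Qed.

Lemma end_projE p q d : end_part q d -> end_proj p d = if p == q then d else 0.
Proof.
move=> hd; apply: lfun_graded_eq => r x xr; rewrite sum_lfunE.
rewrite (bigD1 r) //= big1 ?addr0 => [|s /negPf sr].
  rewrite !comp_lfunE (sprojE dV _ xr) eqxx (sprojE dV _ (hd _ _ xr)).
  by rewrite (inj_eq (@addbI r)); case: eqP; rewrite ?zero_lfunE.
by rewrite !comp_lfunE (sprojE dV _ xr) sr !linear0.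
Qed.

Lemma end_proj_sum d : \sum_(p : bool) end_proj p d = d.
Proof.
apply: lfun_graded_eq => r x xr; rewrite sum_lfunE.
under eq_bigr => p _.
  rewrite sum_lfunE (bigD1 r) //= big1 ?addr0 => [|s /negPf sr].
    rewrite !comp_lfunE (sprojE dV _ xr) eqxx; over.
  by rewrite !comp_lfunE (sprojE dV _ xr) sr !linear0.
rewrite -[RHS]sproj_sum !big_bool /=; case: r xr => //= _.
exact: addrC.
Qed.

Lemma end_part_disjoint d : end_part false d -> end_part true d -> d = 0.
Proof.
move=> d0 d1; apply: lfun_graded_eq => p x xp; rewrite zero_lfunE.
apply: (spart_disjoint dV (d0 _ _ xp)).
by rewrite addbF -addbT d1.
Qed.

Lemma scommE p q d e : end_part p d -> end_part q e ->
  scomm d e = (d \o e)%VF - (-1) ^+ (p && q) *: (e \o d)%VF.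
Proof.
move=> hd he; rewrite /scomm (@sum_bool2 _ p q) => [|r s /orP rs].
  by rewrite (end_projE _ hd) (end_projE _ he) !eqxx.
rewrite (end_projE _ hd) (end_projE _ he).
by case: rs => /negPf->; rewrite ?comp_lfun0l ?comp_lfun0r scaler0 subr0.
Qed.

Lemma scomm_part p q d e :
  end_part p d -> end_part q e -> end_part (p (+) q) (scomm d e).
Proof.
move=> hd he; rewrite (scommE hd he) addrC -scaleNr.
apply: end_partP; last exact: end_part_comp.
by rewrite addbC; apply: end_part_comp.
Qed.

Lemma scomm_anti p q d e : end_part p d -> end_part q e ->
  scomm d e = - ((-1) ^+ (p && q) *: scomm e d).
Proof.
move=> hd he; rewrite (scommE hd he) (scommE he hd) andbC.
by rewrite scalerBr scalerA -signr_addb addbb scale1r opprB.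
Qed.

Lemma scomm_jacobi p q r d e f :
  end_part p d -> end_part q e -> end_part r f ->
  scomm d (scomm e f)
  = scomm (scomm d e) f + (-1) ^+ (p && q) *: scomm e (scomm d f).
Proof.
move=> hd he hf.
rewrite (scommE hd (scomm_part he hf)) (scommE (scomm_part hd he) hf).
rewrite (scommE he (scomm_part hd hf)).
rewrite (scommE hd he) (scommE hd hf) (scommE he hf).
apply/lfunP=> x; rewrite !(add_lfunE, scale_lfunE, opp_lfunE, comp_lfunE).
have lB (g : 'End(V)) := linB (linear_of_lfun g).
have lZ (g : 'End(V)) := linZ (linear_of_lfun g).
rewrite !(lB, lZ).
set def := d (e (f x)); set dfe := d (f (e x)); set efd := e (f (d x)).
set fed := f (e (d x)); set edf := e (d (f x)); set fde := f (d (e x)).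
case: p hd => _; case: q he => _; case: r hf => _; rewrite /= ?expr0 ?expr1;
  lincomb k (V : lmodType k) [:: def; dfe; efd; fed; edf; fde].
Qed.

Lemma scomm_cube d : end_part true d -> scomm d (scomm d d) = 0.
Proof.
move=> hd; rewrite (scommE hd (scomm_part hd hd)) (scommE hd hd) /=.
rewrite expr1 expr0 scale1r scaleN1r opprK.
by rewrite comp_lfunDl comp_lfunDr comp_lfunA subrr.
Qed.

Lemma scomm_idl d : scomm \1%VF d = 0.
Proof.
rewrite -[d]end_proj_sum (lin_sum (scomm_linr _)) big1 // => p _.
have hd : end_part p (end_proj p d).
  move=> r x xr; rewrite sum_lfunE; apply: memv_suml => s _.
  rewrite !comp_lfunE (sprojE dV _ xr).
  by case: eqP => [-> | _]; [apply: sproj_mem | rewrite !linear0 mem0v].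
by rewrite (scommE end_part_id hd) comp_lfun1l comp_lfun1r scale1r subrr.
Qed.

Lemma scomm_idr d : scomm d \1%VF = 0.
Proof.
rewrite -[d]end_proj_sum (lin_sum (scomm_linl _)) big1 // => p _.
have hd : end_part p (end_proj p d).
  move=> r x xr; rewrite sum_lfunE; apply: memv_suml => s _.
  rewrite !comp_lfunE (sprojE dV _ xr).
  by case: eqP => [-> | _]; [apply: sproj_mem | rewrite !linear0 mem0v].
by rewrite (scommE hd end_part_id) andbF comp_lfun1l comp_lfun1r scale1r subrr.
Qed.

End Graded.
End SuperspaceTheory.

(** * Hurwitz superalgebras *)

Section Hurwitz.
Variables (k : fieldType) (C : qsuperalg k) (one : C).
Hypothesis hC : hurwitz one.
Implicit Types (x y z t : C) (p q r s : bool).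
Local Notation conj := (sconj one).

Lemma hurwitz_graded : graded C. Proof. by case: hC => [[[[]]]]. Qed.
Lemma hurwitz_smul_linl y : linear (@smul k C ^~ y).
Proof. by case: hC => [[[[]]]]. Qed.
Lemma hurwitz_smul_linr x : linear (@smul k C x).
Proof. by case: hC => [[[[]]]]. Qed.
Lemma hurwitz_smul_part p q x y :
  x \in spart C p -> y \in spart C q -> smul x y \in spart C (p (+) q).
Proof. by case: hC => [[[[_ _ _ H] _ _] _] _ _ _]; apply: H. Qed.
Lemma hurwitz_sform_linl y : scalar (@sform k C ^~ y).
Proof. by case: hC => [[[_ [[]]]]]. Qed.
Lemma hurwitz_sform_linr x : scalar (@sform k C x).
Proof. by case: hC => [[[_ [[]]]]]. Qed.
Lemma hurwitz_sform_part p q x y :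
  x \in spart C p -> y \in spart C q -> p != q -> sform x y = 0.
Proof. by case: hC => [[[_ [[_ _ H _] _] _] _] _ _ _]; apply: H. Qed.
Lemma hurwitz_sform_sym p q x y : x \in spart C p -> y \in spart C q ->
  sform x y = (-1) ^+ (p && q) * sform y x.
Proof. by case: hC => [[[_ [[_ _ _ H] _] _] _] _ _ _]; apply: H. Qed.
Lemma hurwitz_regular x : (forall y, sform x y = 0) -> x = 0.
Proof. by case: hC => [[[_ _ H] _] _ _ _]; apply: H. Qed.
Lemma hurwitz_mul1 x : smul one x = x. Proof. by case: hC. Qed.
Lemma hurwitz_mulr1 x : smul x one = x. Proof. by case: hC. Qed.
Lemma hurwitz_neq0 : one != 0. Proof. by case: hC. Qed.

Lemma hurwitz_comp p q r s x y z t :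
  x \in spart C p -> y \in spart C q -> z \in spart C r -> t \in spart C s ->
  sform (smul x y) (smul z t)
    + (-1) ^+ ((p && q) (+) (p && r) (+) (q && r))
      * sform (smul z y) (smul x t)
  = (-1) ^+ (q && r) * (sform x z * sform y t).
Proof. by case: hC => [[_ [_ _ H]] _ _ _]; apply: H. Qed.

Let gC := hurwitz_graded.

(** The even component of a unit is again a unit, hence is the unit. *)
Lemma one_even : one \in spart C false.
Proof.
suff <-: sproj C false one = one by apply: sproj_mem.
suff unitP x : smul (sproj C false one) x = x by rewrite -[LHS]hurwitz_mulr1.
elim/(graded_ind gC): x => [p x xp | x y IHx IHy]; last first.
  by rewrite (linD (hurwitz_smul_linr _)) IHx IHy.
have dC : (spart C false :&: spart C true = 0)%VS by case: gC.
have /(congr1 (sproj C p)) := hurwitz_mul1 x.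
rewrite -{1}[one](sproj_sum gC) big_bool /= (linD (hurwitz_smul_linl _)).
rewrite linearD /= (sprojE dC _ (hurwitz_smul_part (sproj_mem _ _) xp)).
rewrite (sprojE dC _ (hurwitz_smul_part (sproj_mem _ _) xp)).
by rewrite (sprojE dC _ xp) /= eqxx; case: (p) => /=; rewrite add0r.
Qed.

Lemma hurwitz_sform_ext x y :
  (forall p z, z \in spart C p -> sform x z = sform y z) -> x = y.
Proof.
move=> eq_xy; apply/eqP; rewrite -subr_eq0; apply/eqP/hurwitz_regular.
elim/(graded_ind gC) => [p z zp | z t IHz IHt].
  by rewrite (scalB (hurwitz_sform_linl _)) (eq_xy _ _ zp) subrr.
by rewrite (scalD (hurwitz_sform_linr _)) IHz IHt addr0.
Qed.

(** The composition law at x = z = 1 reads 2 b(y, t) = b(1, 1) b(y, t). *)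
Lemma sform_one : sform one one = 2.
Proof.
have [-> // | c_neq2] := eqVneq (sform one one) 2.
suff one0 : one = 0 by have := hurwitz_neq0; rewrite one0 eqxx.
suff form0 p q y t : y \in spart C p -> t \in spart C q -> sform y t = 0.
  apply: hurwitz_sform_ext => p z zp.
  by rewrite (form0 _ _ _ _ one_even zp) (scal0 (hurwitz_sform_linl _)).
move=> yp tq; have := hurwitz_comp one_even yp one_even tq.
rewrite !andbF !andFb /= expr0 !mul1r !hurwitz_mul1 => bE.
apply/eqP; have /eqP : (2 - sform one one) * sform y t = 0.
  by rewrite mulrBl -bE; ring.
by rewrite mulf_eq0 subr_eq0 eq_sym (negPf c_neq2).
Qed.

Lemma sconj_lin : linear conj.
Proof.
move=> a x y; rewrite /sconj hurwitz_sform_linl.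
by lincomb k (C : lmodType k) [:: one; x; y].
Qed.

Lemma sconj_one : conj one = one.
Proof.
rewrite /sconj sform_one.
by lincomb k (C : lmodType k) [:: one].
Qed.

Lemma sform_conj_one x : sform (conj x) one = sform x one.
Proof.
rewrite /sconj (scalB (hurwitz_sform_linl _)) (scalZ (hurwitz_sform_linl _)).
by rewrite sform_one /=; ring.
Qed.

Lemma sconjK : involutive conj.
Proof.
move=> x; rewrite {1}/sconj sform_conj_one /sconj.
by lincomb k (C : lmodType k) [:: one; x].
Qed.

Lemma sform_odd_one x : x \in spart C true -> sform x one = 0.
Proof. by move=> x1; apply: hurwitz_sform_part x1 one_even _. Qed.

Lemma sconj_part p x : x \in spart C p -> conj x \in spart C p.
Proof.
case: p => xp; rewrite /sconj.
  by rewrite (sform_odd_one xp) scale0r add0r rpredN.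
by rewrite rpredB // rpredZ // one_even.
Qed.

Lemma sform_mul_conjl p q r x y t :
    x \in spart C p -> y \in spart C q -> t \in spart C r ->
  sform (smul (conj x) y) t = (-1) ^+ (p && q) * sform y (smul x t).
Proof.
move=> xp yq tr; have := hurwitz_comp xp yq one_even tr.
rewrite !andbF /= !addbF expr0 mul1r !hurwitz_mul1 => bE.
rewrite (linB (hurwitz_smul_linl _)) (linZ (hurwitz_smul_linl _)).
rewrite hurwitz_mul1 (scalB (hurwitz_sform_linl _)).
by rewrite (scalZ (hurwitz_sform_linl _)) /= -bE; ring.
Qed.

Lemma sform_mul_conjr p q r x y z :
    x \in spart C p -> y \in spart C q -> z \in spart C r ->
  sform (smul x (conj y)) z = (-1) ^+ (q && r) * sform x (smul z y).
Proof.
move=> xp yq zr; have := hurwitz_comp xp yq zr one_even.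
rewrite !hurwitz_mulr1 (hurwitz_sform_sym (hurwitz_smul_part zr yq) xp) => bE.
rewrite (linB (hurwitz_smul_linr _)) (linZ (hurwitz_smul_linr _)).
rewrite hurwitz_mulr1 (scalB (hurwitz_sform_linl _)).
rewrite (scalZ (hurwitz_sform_linl _)) /=.
case: q yq bE => yq bE; last first.
  by rewrite /= expr0 mul1r in bE *; rewrite mulrC -bE;
     case: p r {xp zr} bE => [] [] /=; rewrite ?expr0 ?expr1 => _; ring.
rewrite (sform_odd_one yq) ?mulr0 ?mul0r ?mulr0 in bE *.
move/eqP: bE; rewrite addr_eq0 => /eqP->.
by case: p r {xp zr} => [] [] /=; rewrite ?expr0 ?expr1; ring.
Qed.

(** The trace form x |-> b(1, x) is associative, by moving conjugates across
    the norm; regularity then forces conjugation to reverse products. *)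
Lemma sconj_mul p q x y : x \in spart C p -> y \in spart C q ->
  conj (smul x y) = (-1) ^+ (p && q) *: smul (conj y) (conj x).
Proof.
move=> xp yq; apply: hurwitz_sform_ext => s t ts.
have xyP := hurwitz_smul_part xp yq; have ytP := hurwitz_smul_part yq ts.
have [x'p t's] := (sconj_part xp, sconj_part ts).
rewrite (scalZ (hurwitz_sform_linl _)) (sform_mul_conjl yq x'p ts).
have -> : sform (conj (smul x y)) t = sform one (smul (smul x y) t).
  by rewrite -[conj _]hurwitz_mulr1 (sform_mul_conjl xyP one_even ts) andbF mul1r.
have := sform_mul_conjr one_even ts xyP; rewrite hurwitz_mul1 => trE.
have trE2 := sform_mul_conjr x'p ts yq.
have trE3 := sform_mul_conjl xp t's yq.
rewrite trE2 in trE3.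
have sgnK (b : bool) (c d : k) : c = (-1) ^+ b * d -> d = (-1) ^+ b * c.
  by move=> ->; rewrite mulrA -signr_addb addbb mul1r.
rewrite (sgnK _ _ _ trE) (sgnK _ _ _ (esym trE3)).
by case: p q s {xp yq ts x'p t's xyP ytP trE trE2 trE3} => [] [] [] /=;
  rewrite ?expr0 ?expr1; ring.
Qed.

Lemma add_sconj x : x + conj x = sform x one *: one.
Proof. by rewrite /sconj addrC subrK. Qed.

Lemma smul_sconjr_herm p q a b : a \in spart C p -> b \in spart C q ->
  smul a (conj b) + (-1) ^+ (p && q) *: smul b (conj a) = sform a b *: one.
Proof.
move=> ap bq; have b'q := sconj_part bq.
have := sconj_mul ap b'q; rewrite sconjK => <-; rewrite add_sconj.
by rewrite (sform_mul_conjr ap bq one_even) hurwitz_mul1 andbF mul1r.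
Qed.

Lemma smul_sconjl_herm p q a b : a \in spart C p -> b \in spart C q ->
  smul (conj a) b + (-1) ^+ (p && q) *: smul (conj b) a = sform a b *: one.
Proof.
move=> ap bq; have a'p := sconj_part ap.
have := sconj_mul a'p bq; rewrite sconjK => <-; rewrite add_sconj.
rewrite (sform_mul_conjl ap bq one_even) hurwitz_mulr1.
by rewrite -(hurwitz_sform_sym ap bq).
Qed.

Lemma sconj_fixed (two_neq0 : 2 != 0 :> k) x :
  conj x = x -> x = (2^-1 * sform x one) *: one.
Proof.
move=> xE; rewrite -scalerA -add_sconj xE -[RHS]/(2^-1 *: (x *+ 2)).
by rewrite -scaler_nat scalerA mulVf // scale1r.
Qed.

(** * The para-Hurwitz product *)

Local Notation S := (para one).

Lemma para_smulE (x y : S) :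
  @smul k S x y = @smul k C (conj x) (conj y).
Proof. by []. Qed.

Lemma para_smul_linl (y : S) : linear (@smul k S ^~ y).
Proof.
by move=> a x z; rewrite !para_smulE sconj_lin hurwitz_smul_linl.
Qed.

Lemma para_smul_linr (x : S) : linear (@smul k S x).
Proof.
by move=> a y z; rewrite !para_smulE sconj_lin hurwitz_smul_linr.
Qed.

Lemma para_smul_part p q (x y : S) :
  x \in spart S p -> y \in spart S q -> @smul k S x y \in spart S (p (+) q).
Proof.
by move=> xp yq; apply: hurwitz_smul_part; apply: sconj_part.
Qed.

End Hurwitz.

(** * Indices modulo 3 *)

Lemma I3_cases (i j : 'I_3) : [\/ j = i, j = i + 1 | j = i + 2].
Proof.
by case: i j => [[|[|[]]] // ?] [[|[|[]]] // ?];
  first [constructor 1; exact/val_inj | constructor 2; exact/val_inj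
        | constructor 3; exact/val_inj].
Qed.

Lemma I3_add11 (i : 'I_3) : i + 1 + 1 = i + 2.
Proof. by case: i => [[|[|[]]] // ?]; apply/val_inj. Qed.
Lemma I3_add12 (i : 'I_3) : i + 1 + 2 = i.
Proof. by case: i => [[|[|[]]] // ?]; apply/val_inj. Qed.
Lemma I3_add21 (i : 'I_3) : i + 2 + 1 = i.
Proof. by case: i => [[|[|[]]] // ?]; apply/val_inj. Qed.
Lemma I3_add22 (i : 'I_3) : i + 2 + 2 = i + 1.
Proof. by case: i => [[|[|[]]] // ?]; apply/val_inj. Qed.
Lemma I3_eq01 (i : 'I_3) : (i == i + 1) = false.
Proof. by case: i => [[|[|[]]] // ?]. Qed.
Lemma I3_eq02 (i : 'I_3) : (i == i + 2) = false.
Proof. by case: i => [[|[|[]]] // ?]. Qed.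
Lemma I3_eq12 (i : 'I_3) : (i + 1 == i + 2) = false.
Proof. by case: i => [[|[|[]]] // ?]. Qed.
Lemma I3_eq10 (i : 'I_3) : (i + 1 == i) = false.
Proof. by rewrite eq_sym I3_eq01. Qed.
Lemma I3_eq20 (i : 'I_3) : (i + 2 == i) = false.
Proof. by rewrite eq_sym I3_eq02. Qed.
Lemma I3_eq21 (i : 'I_3) : (i + 2 == i + 1) = false.
Proof. by rewrite eq_sym I3_eq12. Qed.

Definition I3E := (I3_add11, I3_add12, I3_add21, I3_add22, I3_eq01, I3_eq02,
  I3_eq12, I3_eq10, I3_eq20, I3_eq21, eqxx).

Lemma I3_1D1 : 1 + 1 = 2 :> 'I_3. Proof. exact: val_inj. Qed.
Lemma I3_1D2 : 1 + 2 = 0 :> 'I_3. Proof. exact: val_inj. Qed.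
Lemma I3_2D1 : 2 + 1 = 0 :> 'I_3. Proof. exact: val_inj. Qed.
Lemma I3_2D2 : 2 + 2 = 1 :> 'I_3. Proof. exact: val_inj. Qed.
Definition I3D := (I3_1D1, I3_1D2, I3_2D1, I3_2D2).

(** Sums over the indices are expanded starting from any [i], since the
    formulas for J and for g(S, S') are stated relative to [i], [i+1], [i+2]. *)
Lemma sum_I3 (V : nmodType) (F : 'I_3 -> V) i :
  \sum_j F j = F i + F (i + 1) + F (i + 2).
Proof.
rewrite (bigD1 i) //= (bigD1 (i + 1)) ?I3E //= (bigD1 (i + 2)) ?I3E //=.
by rewrite big1 ?addr0 ?addrA // => j; case: (I3_cases i j) => ->; rewrite !I3E.
Qed.

(** * The Jordan superalgebra of hermitian matrices *)

Section JordanTheory.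
Variables (k : fieldType) (C : qsuperalg k) (one : C).
Hypotheses (two_neq0 : 2 != 0 :> k) (hC : hurwitz one).
Local Notation conj := (sconj one).
Local Notation J := (J one).
Local Notation S := (para one).
Implicit Types (c d : 'I_3 -> k) (a b : 'I_3 -> C) (p q r : bool) (i j : 'I_3).

Let conj_lin : linear conj := sconj_lin hC.

Lemma mstar_lin : linear (mstar one).
Proof. by move=> s x y; apply/ffunP=> ij; rewrite !ffunE conj_lin. Qed.

Lemma hermP (m : mat3 C) :
  reflect (forall i j, conj (m (j, i)) = m (i, j)) (m \in herm one).
Proof.
apply: (iffP fixedSpaceP); rewrite (lin_lfunE mstar_lin).
  by move=> mE i j; rewrite -[in RHS]mE ffunE.
by move=> mE; apply/ffunP=> -[i j]; rewrite ffunE mE.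
Qed.

Lemma vsval_herm (x : J) i j : conj (vsval x (j, i)) = vsval x (i, j).
Proof. exact/hermP/subvsP. Qed.

Definition jelm c a : mat3 C :=
  [ffun ij => if ij.1 == ij.2 then c ij.1 *: one
              else if ij.1 == ij.2 + 1 then 2 *: a (ij.2 + 2)
              else 2 *: conj (a (ij.1 + 2))].

(** The diagonal entries of a hermitian matrix are multiples of [one], and the
    entries above the diagonal are conjugate to those below, so [c] and [a]
    are coordinates of J: this is [\sum_i (c i *: e_i + iota_i (a i))]. *)
Definition jel c a : J := vsproj (herm one) (jelm c a).

Lemma jelm_herm c a : jelm c a \in herm one.
Proof.
apply/hermP=> i j; rewrite !ffunE /=.
case: (I3_cases i j) => ->.
- by rewrite eqxx (linZ conj_lin) (sconj_one hC).
- by rewrite !I3E /= (linZ conj_lin).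
by rewrite !I3E /= (linZ conj_lin) (sconjK hC).
Qed.

Lemma vsval_jel c a ij : vsval (jel c a) ij = jelm c a ij.
Proof. by rewrite vsprojK ?jelm_herm. Qed.

Lemma jel_diag c a i : vsval (jel c a) (i, i) = c i *: one.
Proof. by rewrite vsval_jel ffunE /= eqxx. Qed.

Lemma jel_low c a i : vsval (jel c a) (i + 1, i) = 2 *: a (i + 2).
Proof. by rewrite vsval_jel ffunE /= !I3E. Qed.

Lemma jel_low2 c a i : vsval (jel c a) (i + 2, i + 1) = 2 *: a i.
Proof. by have := jel_low c a (i + 1); rewrite !I3E. Qed.

Lemma jel_up c a i : vsval (jel c a) (i, i + 1) = 2 *: conj (a (i + 2)).
Proof. by rewrite vsval_jel ffunE /= !I3E. Qed.

Definition jelE c a i :=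
  (jel_diag c a, jel_low c a i, jel_up c a i, jel_low c a (i + 1),
   jel_up c a (i + 1)).

Lemma J_eqP (x y : J) :
    (forall i, vsval x (i, i) = vsval y (i, i)) ->
    (forall i, vsval x (i + 2, i + 1) = vsval y (i + 2, i + 1)) -> x = y.
Proof.
move=> eq_d eq_l; apply/val_inj/ffunP=> -[i j].
have low l : vsval x (l + 1, l) = vsval y (l + 1, l).
  by have := eq_l (l + 2); rewrite !I3E.
case: (I3_cases i j) => ->; first exact: eq_d.
  by rewrite -vsval_herm -[RHS]vsval_herm low.
by have := low (i + 2); rewrite I3E.
Qed.

Lemma jel_ext c d a b : c =1 d -> a =1 b -> jel c a = jel d b.
Proof.
by move=> cd ab; apply: J_eqP => i; rewrite !vsval_jel !ffunE /= !(cd, ab).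
Qed.

Lemma jel_inj c d a b : jel c a = jel d b -> c =1 d /\ a =1 b.
Proof.
move=> eqJ; split=> i.
  have := congr1 (fun x : J => vsval x (i, i)) eqJ; rewrite !jel_diag => /eqP.
  by rewrite -subr_eq0 -scalerBl scaler_eq0 (negPf (hurwitz_neq0 hC)) orbF
    subr_eq0 => /eqP.
have := congr1 (fun x : J => vsval x (i + 2, i + 1)) eqJ.
have := (jel_low c a (i + 1), jel_low d b (i + 1)); rewrite !I3E => -[-> ->].
exact: scalerI.
Qed.

Lemma jel_lin s c d a b :
  s *: jel c a + jel d b
  = jel (fun i => s * c i + d i) (fun i => s *: a i + b i).
Proof.
apply: J_eqP => i; rewrite linearP /= !ffunE !vsval_jel !ffunE /= !I3E.
  by rewrite scalerDl scalerA.
by rewrite scalerDr !scalerA mulrC.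
Qed.

Definition jdiag (x : J) i : k := 2^-1 * sform (vsval x (i, i)) one.
Definition joff (x : J) i : C := 2^-1 *: vsval x (i + 2, i + 1).

Lemma jel_coord x : jel (jdiag x) (joff x) = x.
Proof.
apply: J_eqP => i; first by rewrite jel_diag -sconj_fixed // vsval_herm.
have := jel_low (jdiag x) (joff x) (i + 1); rewrite !I3E => ->.
by rewrite scalerA mulfV ?scale1r.
Qed.

Lemma J_partP p (x : J) :
  reflect (forall ij, vsval x ij \in spart C p) (x \in spart J p).
Proof.
rewrite memvE; apply: (iffP subv_bigcapP) => [xP ij | xP ij _].
  have := xP ij isT; rewrite -memvE -memv_preim lin_lfunE //.
  by move=> s u v; rewrite linearP !ffunE.
rewrite -memvE -memv_preim lin_lfunE //.
by move=> s u v; rewrite linearP !ffunE.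
Qed.

Lemma jel_part p c a :
  (p -> forall i, c i = 0) -> (forall i, a i \in spart C p) ->
  jel c a \in spart J p.
Proof.
move=> c0 ap; apply/J_partP=> -[i j]; rewrite vsval_jel ffunE /=.
case: eqP => _; last by case: ifP => _; rewrite rpredZ ?sconj_part.
case: p c0 ap => c0 _; first by rewrite c0 // scale0r mem0v.
by rewrite rpredZ ?one_even.
Qed.

Lemma joff_part p x i : x \in spart J p -> joff x i \in spart C p.
Proof. by move/J_partP=> xp; rewrite rpredZ. Qed.

Lemma jdiag_odd x i : x \in spart J true -> jdiag x i = 0.
Proof. by move/J_partP=> xp; rewrite /jdiag (sform_odd_one hC) ?mulr0. Qed.

Lemma J_graded : graded J.
Proof.
have gC := hurwitz_graded hC; split.
  apply/vspaceP=> x; rewrite memvf -[x]jel_coord.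
  have -> : jel (jdiag x) (joff x) =
      jel (jdiag x) (fun i => sproj C false (joff x i))
      + jel (fun=> 0) (fun i => sproj C true (joff x i)).
    rewrite -[X in X + _]scale1r jel_lin; apply: jel_ext => i.
      by rewrite mul1r addr0.
    by rewrite scale1r -[LHS](sproj_sum gC) big_bool addrC.
  by apply: memv_add; apply: jel_part => // i; apply: sproj_mem.
apply/eqP; rewrite -subv0; apply/subvP=> x; rewrite memv_cap memv0.
case/andP=> /J_partP x0 /J_partP x1; apply/eqP/val_inj/ffunP=> ij.
by rewrite ffunE; apply: (spart_disjoint gC.2 (x0 ij)) (x1 ij).
Qed.

Lemma mmul_linl (y : mat3 C) : linear (@mmul k C ^~ y).
Proof.
move=> s u v; apply/ffunP=> ij; rewrite !ffunE scaler_sumr -big_split /=.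
by apply: eq_bigr => l _; rewrite !ffunE (hurwitz_smul_linl hC).
Qed.

Lemma mmul_linr (x : mat3 C) : linear (mmul x).
Proof.
move=> s u v; apply/ffunP=> ij; rewrite !ffunE scaler_sumr -big_split /=.
by apply: eq_bigr => l _; rewrite !ffunE (hurwitz_smul_linr hC).
Qed.

Lemma mproj_lin p : linear (@mproj k C p).
Proof. by move=> s u v; apply/ffunP=> ij; rewrite !ffunE linearP. Qed.

Lemma mproj_vsval_lin p : linear (fun x : J => mproj p (vsval x)).
Proof. by move=> s u v; rewrite linearP mproj_lin. Qed.

Lemma jmul_linl (y : J) : linear (@jmul k C one ^~ y).
Proof.
apply: (@linear_comp k _ _ _ (vsproj (herm one))); first exact: linearP.
apply: linear_scalef; apply: linear_sumf => p; apply: linear_sumf => q.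
apply: linear_addf; last apply: linear_scalef.
  exact: (linear_comp (@mmul_linl _) (mproj_vsval_lin p)).
exact: (linear_comp (@mmul_linr _) (mproj_vsval_lin p)).
Qed.

Lemma jmul_linr (x : J) : linear (@jmul k C one x).
Proof.
apply: (@linear_comp k _ _ _ (vsproj (herm one))); first exact: linearP.
apply: linear_scalef; apply: linear_sumf => p; apply: linear_sumf => q.
apply: linear_addf; last apply: linear_scalef.
  exact: (linear_comp (@mmul_linr _) (mproj_vsval_lin q)).
exact: (linear_comp (@mmul_linl _) (mproj_vsval_lin q)).
Qed.

Lemma jLE (x y : J) : jL x y = jmul x y.
Proof. exact: (lin_lfunE (jmul_linr x)). Qed.

Lemma jL_lin : linear (@jL k C one).
Proof. exact: linear_linfun jmul_linr jmul_linl. Qed.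

Lemma mproj_part p q (x : J) :
  x \in spart J q -> mproj p (vsval x) = if p == q then vsval x else 0.
Proof.
move/J_partP=> xq; apply/ffunP=> ij; rewrite ffunE.
rewrite (sprojE (hurwitz_graded hC).2 _ (xq ij)).
by case: eqP; rewrite ?ffunE.
Qed.

(** The projection onto hermitian matrices in the definition of [jmul] is
    harmless: transposed conjugation reverses products up to sign, because
    conjugation does, and so fixes the symmetrized product. *)
Lemma vsval_jmul p q (x y : J) i j : x \in spart J p -> y \in spart J q ->
  vsval (jmul x y) (i, j) =
  2^-1 *: \sum_l (smul (vsval x (i, l)) (vsval y (l, j))
                  + (-1) ^+ (p && q) *: smul (vsval y (i, l)) (vsval x (l, j))).
Proof.
move=> xp yq; rewrite /jmul (@sum_bool2 _ p q) => [|r s /orP rs]; last first.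
  rewrite (mproj_part _ xp) (mproj_part _ yq).
  by case: rs => /negPf->;
    rewrite (lin0 (@mmul_linl _)) (lin0 (@mmul_linr _)) scaler0 addr0.
rewrite (mproj_part _ xp) (mproj_part _ yq) !eqxx.
set m := _ + _; have mE i' j' : m (i', j') = \sum_l
    (smul (vsval x (i', l)) (vsval y (l, j'))
     + (-1) ^+ (p && q) *: smul (vsval y (i', l)) (vsval x (l, j'))).
  by rewrite !ffunE scaler_sumr -big_split.
clearbody m.
rewrite vsprojK; first by rewrite ffunE mE.
apply/hermP=> i' j'; rewrite !ffunE (linZ conj_lin); congr (_ *: _).
rewrite !mE (lin_sum conj_lin); apply: eq_bigr => l _.
move/J_partP: xp => xp; move/J_partP: yq => yq.
rewrite (linD conj_lin) (linZ conj_lin) (sconj_mul hC (xp _) (yq _)).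
rewrite (sconj_mul hC (yq _) (xp _)) !vsval_herm scalerA andbC.
by rewrite -signr_addb addbb scale1r addrC.
Qed.

Lemma jmul_part p q (x y : J) : x \in spart J p -> y \in spart J q ->
  jmul x y \in spart J (p (+) q).
Proof.
move=> xp yq; apply/J_partP=> -[i j]; rewrite (vsval_jmul _ _ xp yq).
move/J_partP: xp => xp; move/J_partP: yq => yq.
rewrite rpredZ // rpred_sum // => l _; rewrite rpredD ?rpredZ //.
  exact: (hurwitz_smul_part hC).
by rewrite addbC; apply: (hurwitz_smul_part hC).
Qed.

Lemma jL_part p (x : J) : x \in spart J p -> end_part p (jL x).
Proof. by move=> xp q y yq; rewrite jLE addbC; apply: jmul_part. Qed.

Lemma jmulC p q (x y : J) : x \in spart J p -> y \in spart J q ->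
  jmul x y = (-1) ^+ (p && q) *: jmul y x.
Proof.
move=> xp yq; apply/val_inj/ffunP=> -[i j]; rewrite linearZ /= ffunE.
rewrite (vsval_jmul _ _ xp yq) (vsval_jmul _ _ yq xp).
rewrite [RHS]scalerA [_ * 2^-1]mulrC -[RHS]scalerA; congr (_ *: _); rewrite scaler_sumr.
apply: eq_bigr => l _; rewrite andbC scalerDr scalerA.
by rewrite -signr_addb addbb scale1r addrC.
Qed.

(** The diagonal entries combine by the norm form since
    [a (conj b) + b (conj a) = sform a b *: one] up to signs. *)
Lemma jel_mul p q c d a b :
    (p -> forall i, c i = 0) -> (forall i, a i \in spart C p) ->
    (q -> forall i, d i = 0) -> (forall i, b i \in spart C q) ->
  jmul (jel c a) (jel d b) =
  jel (fun i => c i * d i + 2 * (sform (a (i + 1)) (b (i + 1))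
                                 + sform (a (i + 2)) (b (i + 2))))
      (fun i => (2^-1 * (c (i + 1) + c (i + 2))) *: b i
                + (2^-1 * (d (i + 1) + d (i + 2))) *: a i
                + (@smul k S (a (i + 1)) (b (i + 2))
                   + (-1) ^+ (p && q) *: @smul k S (b (i + 1)) (a (i + 2)))).
Proof.
move=> c0 ap d0 bq; have xp := jel_part c0 ap; have yq := jel_part d0 bq.
have linl y := hurwitz_smul_linl hC y; have linr x := hurwitz_smul_linr hC x.
have linlZ (s : k) (x y : C) : smul (s *: x) y = s *: smul x y := linZ (linl y) s x.
have linrZ (s : k) (x y : C) : smul x (s *: y) = s *: smul x y := linZ (linr x) s y.
have sgnc i : (-1) ^+ (p && q) * c i = c i.
  by case: p c0 {ap xp} => [c0|_]; rewrite ?c0 ?mulr0 // mul1r.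
have sgnd i : (-1) ^+ (p && q) * d i = d i.
  by case: q d0 {bq yq sgnc} => [d0|_]; rewrite ?d0 ?mulr0 // andbF mul1r.
apply: J_eqP => i; rewrite (vsval_jmul _ _ xp yq).
  rewrite (sum_I3 _ i) jel_diag.
  have := (jelE c a i, jelE d b i, jelE c a (i + 2), jelE d b (i + 2)).
  rewrite !I3E !jel_diag => eE; rewrite !eE !(linlZ, linrZ).
  rewrite !(hurwitz_mul1 hC) !scalerA mulrA sgnd.
  have hr := smul_sconjl_herm hC (ap (i + 2)) (bq (i + 2)).
  have hl := smul_sconjr_herm hC (ap (i + 1)) (bq (i + 1)).
  rewrite [RHS]scalerDl -[X in _ = _ + X]scalerA [(sform _ _ + _) *: _]scalerDl -hl -hr.
  set t1 := smul _ _; set t2 := smul _ _; set t3 := smul _ _; set t4 := smul _ _.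
  lincomb k (C : lmodType k) [:: one; t1; t2; t3; t4]; field; exact: two_neq0.
rewrite jel_low2 (sum_I3 _ i).
have := (jelE c a i, jelE d b i, jelE c a (i + 2), jelE d b (i + 2)).
rewrite !I3E !jel_diag => eE; rewrite !eE !(linlZ, linrZ).
rewrite !(hurwitz_mul1 hC) !(hurwitz_mulr1 hC) !scalerA !para_smulE.
rewrite !mulrA sgnc sgnd; set t1 := smul _ _; set t2 := smul _ _.
lincomb k (C : lmodType k) [:: a i; b i; t1; t2]; field; exact: two_neq0.
Qed.

End JordanTheory.

(** * Derivations and multiplications of J in coordinates *)

Section JordanDer.
Variables (k : fieldType) (C : qsuperalg k) (one : C).
Hypotheses (two_neq0 : 2 != 0 :> k) (hC : hurwitz one).
Local Notation conj := (sconj one).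
Local Notation J := (J one).
Local Notation S := (para one).
Implicit Types (c d : 'I_3 -> k) (a b : 'I_3 -> C) (x y : C) (u v : J).
Implicit Types (p q r : bool) (i j : 'I_3).

Let gJ : graded J := J_graded two_neq0 hC.
Let conj_lin : linear conj := sconj_lin hC.

Lemma jE_jel i : jE one i = jel one (fun j => (j == i)%:R) (fun=> 0).
Proof.
congr vsproj; apply/ffunP=> -[j l]; rewrite !ffunE xpair_eqE /=.
have [-> | jl] := eqVneq j l.
  by rewrite andbb; case: eqP; rewrite ?scale1r ?scale0r.
rewrite (lin0 conj_lin) scaler0 if_same ifN //.
by apply: contra jl => /andP[/eqP-> /eqP->].
Qed.

Definition jdelta i x : 'I_3 -> C := fun j => if j == i then x else 0.

Lemma jiota_jel i x : jiota one i x = jel one (fun=> 0) (jdelta i x).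
Proof.
congr vsproj; apply/ffunP=> -[j l]; rewrite !ffunE !xpair_eqE /= /jdelta.
have [c0 cD] := (scaler0 C 2, lin0 conj_lin).
case: (I3_cases j l) => ->; case: (I3_cases i j) => ->.
all: by rewrite ?I3E /= ?I3E /= ?cD ?c0 ?scale0r.
Qed.

Lemma jel0 : jel one (fun=> 0) (fun=> 0) = 0.
Proof.
have := jel_lin hC (-1) (fun=> 0) (fun=> 0) (fun=> 0) (fun=> 0).
rewrite scaleN1r addNr => ->; apply: (jel_ext hC) => i; first by rewrite mulr0 addr0.
by rewrite scaler0 addr0.
Qed.

Lemma jelD c d a b :
  jel one c a + jel one d b
  = jel one (fun i => c i + d i) (fun i => a i + b i).
Proof.
have := jel_lin hC 1 c d a b; rewrite scale1r => ->.
by apply: (jel_ext hC) => i; rewrite ?mul1r ?scale1r.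
Qed.

Lemma jelZ s c a :
  s *: jel one c a = jel one (fun i => s * c i) (fun i => s *: a i).
Proof.
have := jel_lin hC s c (fun=> 0) a (fun=> 0); rewrite jel0 addr0 => ->.
by apply: (jel_ext hC) => i; rewrite addr0.
Qed.

Lemma jelN c a : - jel one c a = jel one (fun i => - c i) (fun i => - a i).
Proof.
rewrite -scaleN1r jelZ.
by apply: (jel_ext hC) => i; rewrite ?mulN1r ?scaleN1r.
Qed.

Lemma jel_sum (I : Type) (s : seq I) (c : I -> 'I_3 -> k) (a : I -> 'I_3 -> C) :
  \sum_(l <- s) jel one (c l) (a l)
  = jel one (fun i => \sum_(l <- s) c l i) (fun i => \sum_(l <- s) a l i).
Proof.
elim: s => [|l s IHs].
  by rewrite big_nil -jel0; apply: (jel_ext hC) => i; rewrite big_nil.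
by rewrite big_cons IHs jelD; apply: (jel_ext hC) => i; rewrite big_cons.
Qed.

Lemma jiota_lin i : linear (jiota one i).
Proof.
move=> s x y; rewrite !jiota_jel jel_lin //; apply: (jel_ext hC) => j.
  by rewrite mulr0 addr0.
by rewrite /jdelta; case: eqP => // _; rewrite scaler0 addr0.
Qed.

Lemma jel_sumE c a :
  jel one c a = \sum_i (c i *: jE one i + jiota one i (a i)).
Proof.
under eq_bigr => i _ do rewrite jE_jel jiota_jel jelZ jelD.
rewrite jel_sum; apply: (jel_ext hC) => i.
  rewrite (bigD1 i) //= eqxx mulr1 addr0 big1 ?addr0 // => j /negPf ji.
  by rewrite eq_sym ji mulr0 addr0.
rewrite (bigD1 i) //= /jdelta eqxx scaler0 add0r big1 ?addr0 // => j /negPf ji.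
by rewrite eq_sym ji scaler0 addr0.
Qed.

Lemma jdelta_part p i x j : x \in spart C p -> jdelta i x j \in spart C p.
Proof. by rewrite /jdelta; case: eqP => // _ _; rewrite mem0v. Qed.

Lemma jiota_part p i x : x \in spart C p -> jiota one i x \in spart J p.
Proof.
move=> xp; rewrite jiota_jel; apply: jel_part => // j.
exact: jdelta_part.
Qed.

Lemma jdiag_part c : jel one c (fun=> 0) \in spart J false.
Proof. by apply: jel_part => // i; rewrite mem0v. Qed.

Lemma jE_part i : jE one i \in spart J false.
Proof. by rewrite jE_jel jdiag_part. Qed.

(** The coordinates of the elements of parity [p]: the diagonal part has
    coefficients in k, and hence is even. *)
Definition jpart p c a := (p -> forall i, c i = 0) /\ forall i, a i \in spart C p.

Lemma lfun_jel_eq (f g : 'End(J)) :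
  (forall p c a, jpart p c a -> f (jel one c a) = g (jel one c a)) -> f = g.
Proof.
move=> eq_fg; apply: (lfun_graded_eq gJ) => p u up.
rewrite -(jel_coord two_neq0 hC u); apply: (eq_fg p); split.
  by move=> pT i; rewrite pT in up; apply: jdiag_odd.
by move=> i; apply: joff_part.
Qed.

Lemma jel_mul_part p q c d a b : jpart p c a -> jpart q d b ->
  jmul (jel one c a) (jel one d b) =
  jel one (fun i => c i * d i + 2 * (sform (a (i + 1)) (b (i + 1))
                                 + sform (a (i + 2)) (b (i + 2))))
      (fun i => (2^-1 * (c (i + 1) + c (i + 2))) *: b i
                + (2^-1 * (d (i + 1) + d (i + 2))) *: a i
                + (@smul k S (a (i + 1)) (b (i + 2))
                   + (-1) ^+ (p && q) *: @smul k S (b (i + 1)) (a (i + 2)))).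
Proof. by case=> c0 ap [d0 bq]; apply: jel_mul. Qed.

Let form0l x : sform 0 x = 0 := scal0 (hurwitz_sform_linl hC x).
Let form0r x : sform x 0 = 0 := scal0 (hurwitz_sform_linr hC x).
Let mul0l x : @smul k S 0 x = 0 := lin0 (para_smul_linl hC x).
Let mul0r x : @smul k S x 0 = 0 := lin0 (para_smul_linr hC x).

Lemma jmul_diag c d b :
  jmul (jel one c (fun=> 0)) (jel one d b) =
  jel one (fun i => c i * d i) (fun i => (2^-1 * (c (i + 1) + c (i + 2))) *: b i).
Proof.
have homE q e f : jpart q e f -> jmul (jel one c (fun=> 0)) (jel one e f) =
    jel one (fun i => c i * e i)
            (fun i => (2^-1 * (c (i + 1) + c (i + 2))) *: f i).
  move=> ef; rewrite (@jel_mul_part false q _ _ _ _ _ ef); last first.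
    by split=> // i; rewrite mem0v.
  apply: (jel_ext hC) => i; first by rewrite !form0l addr0 mulr0 addr0.
  by rewrite mul0l mul0r !scaler0 !addr0.
have -> : jel one d b = jel one d (fun i => sproj C false (b i))
    + jel one (fun=> 0) (fun i => sproj C true (b i)).
  rewrite jelD; apply: (jel_ext hC) => i; first by rewrite addr0.
  by rewrite -[LHS](sproj_sum (hurwitz_graded hC)) big_bool addrC.
have h0 : jpart false d (fun i => sproj C false (b i)).
  by split=> // i; apply: sproj_mem.
have h1 : jpart true (fun=> 0) (fun i => sproj C true (b i)).
  by split=> // i; apply: sproj_mem.
rewrite (linD (jmul_linr hC _)) (homE _ _ _ h0) (homE _ _ _ h1) jelD.
apply: (jel_ext hC) => i; first by rewrite mulr0 addr0.
rewrite -scalerDr; congr (_ *: _).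
by rewrite -[RHS](sproj_sum (hurwitz_graded hC)) big_bool addrC.
Qed.

Definition jone : J := jel one (fun=> 1) (fun=> 0).

Lemma jone_part : jone \in spart J false. Proof. exact: jdiag_part. Qed.

Lemma jL_one : jL jone = \1%VF.
Proof.
apply: lfun_jel_eq => p c a ca; rewrite (jLE hC) id_lfunE jmul_diag.
apply: (jel_ext hC) => i; first by rewrite mul1r.
by rewrite -[1 + 1]/2 mulVf ?scale1r.
Qed.

Lemma scomm_jL_diag c d :
  scomm (jL (jel one c (fun=> 0))) (jL (jel one d (fun=> 0))) = 0.
Proof.
rewrite (scommE gJ (jL_part hC (jdiag_part c)) (jL_part hC (jdiag_part d))).
rewrite scale1r; apply: lfun_jel_eq => p f a fa.
rewrite !(add_lfunE, opp_lfunE, comp_lfunE, zero_lfunE) !(jLE hC).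
rewrite !jmul_diag jelN jelD -jel0.
apply: (jel_ext hC) => i; first by ring.
by rewrite !scalerA -scaleNr -scalerDl; apply/eqP; rewrite scaler_eq0;
  apply/orP; left; apply/eqP; ring.
Qed.

(** The commutator of L at iota_i(x) with L at a diagonal element e depends on e
    only through the difference of its entries of index i+1 and i+2, so that
    all these commutators are multiples of [jD one i x]. *)
Lemma scomm_jL_iota_diag p q i x c d b : x \in spart C p -> jpart q d b ->
  scomm (jL (jiota one i x)) (jL (jel one c (fun=> 0))) (jel one d b)
  = (2^-1 * (c (i + 1) - c (i + 2))) *:
    jel one (fun j => if j == i + 1 then - (2 * sform x (b i))
                      else if j == i + 2 then 2 * sform x (b i) else 0)
        (fun j => if j == i then (2^-1 * (d (i + 1) - d (i + 2))) *: x
                  else if j == i + 1 then (-1) ^+ (p && q) *: @smul k S (b (i + 2)) x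
                  else - @smul k S x (b (i + 1))).
Proof.
move=> xp db.
rewrite (scommE gJ (jL_part hC (jiota_part i xp)) (jL_part hC (jdiag_part c))).
rewrite andbF scale1r !(add_lfunE, opp_lfunE, comp_lfunE) !(jLE hC).
rewrite jmul_diag jiota_jel.
have xpart : jpart p (fun=> 0) (jdelta i x).
  by split=> // j; apply: jdelta_part.
have dpart : jpart q (fun i => c i * d i)
    (fun i => (2^-1 * (c (i + 1) + c (i + 2))) *: b i).
  case: db => d0 bq; split=> [qT j | j]; first by rewrite d0 // mulr0.
  by rewrite rpredZ.
rewrite (jel_mul_part xpart dpart) (jel_mul_part xpart db).
rewrite jmul_diag jelN jelD jelZ.
have linl y := para_smul_linl hC y; have linr y := para_smul_linr hC y.
have linlZ s (y z : S) : @smul k S (s *: y) z = s *: smul y z := linZ (linl z) s y.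
have linrZ s (y z : S) : @smul k S y (s *: z) = s *: smul y z := linZ (linr y) s z.
have fZ s (y z : C) : sform y (s *: z) = s * sform y z := scalZ (hurwitz_sform_linr hC y) s z.
apply: (jel_ext hC) => j; rewrite /jdelta; case: (I3_cases i j) => ->;
rewrite !I3E ?form0l ?mul0l ?mul0r ?fZ ?linlZ ?linrZ ?scaler0.
- by ring.
- by field; exact: two_neq0.
- by field; exact: two_neq0.
- set t := b i; lincomb k (C : lmodType k) [:: x; t]; field; exact: two_neq0.
- set t := smul _ _; set t' := b _.
  lincomb k (C : lmodType k) [:: t; t']; field; exact: two_neq0.
set t := smul _ _; set t' := b _.
lincomb k (C : lmodType k) [:: t; t']; field; exact: two_neq0.
Qed.

Lemma scomm_diag_jD p i x c : x \in spart C p ->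
  scomm (jL (jiota one i x)) (jL (jel one c (fun=> 0)))
  = (2^-1 * (c (i + 1) - c (i + 2))) *: jD one i x.
Proof.
move=> xp; apply: lfun_jel_eq => q d b db.
rewrite (scomm_jL_iota_diag _ _ xp db) /jD jE_jel !scale_lfunE.
rewrite (scomm_jL_iota_diag _ _ xp db) !I3E subr0 mulr1.
by rewrite [2 *: _]scalerA mulfV // scale1r.
Qed.

Lemma jD_jel p q i x d b : x \in spart C p -> jpart q d b ->
  jD one i x (jel one d b)
  = jel one (fun j => if j == i + 1 then - (2 * sform x (b i))
                      else if j == i + 2 then 2 * sform x (b i) else 0)
        (fun j => if j == i then (2^-1 * (d (i + 1) - d (i + 2))) *: x
                  else if j == i + 1 then (-1) ^+ (p && q) *: @smul k S (b (i + 2)) x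
                  else - @smul k S x (b (i + 1))).
Proof.
move=> xp db; rewrite /jD jE_jel scale_lfunE.
rewrite (scomm_jL_iota_diag _ _ xp db) !I3E subr0 mulr1.
by rewrite scalerA mulfV // scale1r.
Qed.

Lemma jD_lin i : linear (jD one i).
Proof.
apply: linear_scalef.
apply: (@linear_comp _ _ _ _ ((@scomm k J)^~ (jL (jE one (i + 1))))).
  exact: scomm_linl.
apply: (@linear_comp _ _ _ _ (@jL k C one)); first exact: jL_lin.
exact: jiota_lin.
Qed.

Lemma jD_part p i x : x \in spart C p -> end_part p (jD one i x).
Proof.
move=> xp; rewrite -[jD _ _ _]addr0; apply: end_partP; last exact: end_part0.
rewrite -[p]addbF; apply: (scomm_part gJ); apply: (jL_part hC).
  exact: jiota_part.
exact: jE_part.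
Qed.

Lemma jD_sum_jel p q d a b :
  (forall i, a i \in spart C p) -> jpart q d b ->
  (\sum_i jD one i (a i)) (jel one d b)
  = jel one (fun j => 2 * (sform (a (j + 1)) (b (j + 1))
                           - sform (a (j + 2)) (b (j + 2))))
        (fun j => (2^-1 * (d (j + 1) - d (j + 2))) *: a j
                  - @smul k S (a (j + 1)) (b (j + 2))
                  + (-1) ^+ (p && q) *: @smul k S (b (j + 1)) (a (j + 2))).
Proof.
move=> ap db; rewrite sum_lfunE.
under eq_bigr => i _ do rewrite (jD_jel _ (ap i) db).
rewrite jel_sum; apply: (jel_ext hC) => j; rewrite (sum_I3 _ j) !I3E.
  by rewrite add0r mulrBr.
by [].
Qed.

Lemma jDtri_jel (d : triple S) c a :
  jDtri d (jel one c a) = jel one (fun=> 0) (fun j => d j (a j)).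
Proof.
rewrite /jDtri lin_lfunE; last first.
  apply: linear_sumf => i; apply: (linear_comp (@jiota_lin i)).
  apply: (linear_comp (linear_of_lfun _)); apply: linear_scalef.
  by move=> s u v; rewrite linearP !ffunE.
rewrite [RHS]jel_sumE; apply: eq_bigr => i _.
by rewrite (jel_low2 hC) scalerA mulVf // scale1r scale0r add0r.
Qed.

Lemma jpart_iota p i x : x \in spart C p -> jpart p (fun=> 0) (jdelta i x).
Proof. by move=> xp; split=> // j; apply: jdelta_part. Qed.

Lemma jpart_E i : jpart false (fun j => (j == i)%:R) (fun=> 0 : C).
Proof. by split=> // j; rewrite mem0v. Qed.

Lemma jD_iota_same p q i x y : x \in spart C p -> y \in spart C q ->
  exists c, jD one i x (jiota one i y) = jel one c (fun=> 0).
Proof.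
move=> xp yq; rewrite jiota_jel (jD_jel _ xp (jpart_iota i yq)).
exists (fun j => if j == i + 1 then - (2 * sform x y)
                 else if j == i + 2 then 2 * sform x y else 0).
apply: (jel_ext hC) => j; first by rewrite /jdelta !I3E.
rewrite /jdelta !I3E subrr mulr0 scale0r mul0l mul0r scaler0 oppr0.
by rewrite !if_same.
Qed.

Lemma jD_iota_next p q i x y : x \in spart C p -> y \in spart C q ->
  jD one i x (jiota one (i + 1) y) = - jiota one (i + 2) (@smul k S x y).
Proof.
move=> xp yq; rewrite !jiota_jel (jD_jel _ xp (jpart_iota (i + 1) yq)) jelN.
apply: (jel_ext hC) => j.
  by rewrite /jdelta !I3E form0r mulr0 oppr0 !if_same.
rewrite /jdelta !I3E subrr mulr0 scale0r mul0l scaler0.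
by case: (I3_cases i j) => ->; rewrite !I3E ?oppr0.
Qed.

Lemma jD_E1 p i x : x \in spart C p ->
  jD one i x (jE one (i + 1)) = 2^-1 *: jiota one i x.
Proof.
move=> xp; rewrite jE_jel (jD_jel _ xp (jpart_E _)) jiota_jel jelZ.
apply: (jel_ext hC) => j.
  by rewrite form0r mulr0 oppr0 !if_same mulr0.
rewrite /jdelta !I3E mul0l mul0r scaler0 !oppr0 !if_same addr0 mulr1.
by case: eqP => // _; rewrite scaler0.
Qed.

Lemma jD_E2 p i x : x \in spart C p ->
  jD one i x (jE one (i + 2)) = - 2^-1 *: jiota one i x.
Proof.
move=> xp; rewrite jE_jel (jD_jel _ xp (jpart_E _)) jiota_jel jelZ.
apply: (jel_ext hC) => j.
  by rewrite form0r mulr0 oppr0 !if_same mulr0.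
rewrite /jdelta !I3E mul0l mul0r scaler0 !oppr0 !if_same sub0r mulrN1.
by case: eqP => // _; rewrite scaler0.
Qed.

(** The Leibniz rule for [D], read as an identity between operators. *)
Lemma der_jL p D u : der_part p D -> scomm D (jL u) = jL (D u).
Proof.
case=> Dp DM; elim/(graded_ind gJ): u => [q u uq | u v IHu IHv]; last first.
  by rewrite linearD /= !(linD (jL_lin hC)) -IHu -IHv (linD (scomm_linr _)).
rewrite (scommE gJ Dp (jL_part hC uq)).
apply: (lfun_graded_eq gJ) => r v vr.
rewrite !(add_lfunE, opp_lfunE, scale_lfunE, comp_lfunE) !(jLE hC).
by rewrite (DM _ _ _ _ uq vr) addrK.
Qed.

(** By the Leibniz rule [L_(D 1)] is the commutator of [D] with the identity. *)
Lemma der_one p D : der_part p D -> D jone = 0.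
Proof.
move=> Dder; have := der_jL jone Dder.
rewrite jL_one (scomm_idr gJ) => /(congr1 (fun f : 'End(J) => f jone)).
rewrite zero_lfunE => /esym; rewrite (jLE hC).
have Dp : D jone \in spart J p.
  by have [/(_ _ _ jone_part)] := Dder; rewrite addFb.
rewrite (jmulC hC Dp jone_part) andbF scale1r.
by rewrite -(jLE hC) jL_one id_lfunE.
Qed.

Section DerivationsD.
Hypothesis jD_der : forall p i x, x \in spart C p -> der_part p (jD one i x).

(** Since [D_i x] is a derivation, its commutator with [D_j y], which is twice
    the commutator of L at iota_j(y) and at e_(j+1), is computed by letting
    it act on iota_j(y) and on e_(j+1). *)
Lemma scomm_jD p q i j x y : x \in spart C p -> y \in spart C q ->
  scomm (jD one i x) (jD one j y)
  = 2 *: (scomm (jL (jD one i x (jiota one j y))) (jL (jE one (j + 1)))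
          + (-1) ^+ (p && q) *:
            scomm (jL (jiota one j y)) (jL (jD one i x (jE one (j + 1))))).
Proof.
move=> xp yq; rewrite {2}/jD (linZ (scomm_linr _)).
rewrite (scomm_jacobi gJ (jD_part i xp) (jL_part hC (jiota_part j yq))
           (jL_part hC (jE_part (j + 1)))).
by rewrite !(der_jL _ (jD_der i xp)).
Qed.

(** In [scomm_jD], [D_i x] sends iota_i(y) to a diagonal element, which drops
    out, and e_(i+1) to iota_i(x) / 2. No product of three elements of C is
    ever computed. *)
Lemma scomm_jL_same p q i x y : x \in spart C p -> y \in spart C q ->
  scomm (jL (jiota one i x)) (jL (jiota one i y))
  = - scomm (jD one i x) (jD one i y).
Proof.
move=> xp yq; rewrite (scomm_jD _ _ xp yq).
have [c ->] := jD_iota_same i xp yq; rewrite jE_jel scomm_jL_diag add0r -jE_jel.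
rewrite (jD_E1 _ xp) (linZ (jL_lin hC)) (linZ (scomm_linr _)).
rewrite scalerA mulrC -scalerA [2 *: (_ *: _)]scalerA mulfV // scale1r.
exact: (scomm_anti gJ (jL_part hC (jiota_part i xp)) (jL_part hC (jiota_part i yq))).
Qed.

(** In [scomm_jD], [D_i x] sends iota_(i+1)(y) into iota_(i+2)(S), which
    commutes with e_(i+2) as operators, and e_(i+2) to - iota_i(x) / 2. *)
Lemma scomm_jL_next p q i x y : x \in spart C p -> y \in spart C q ->
  scomm (jL (jiota one i x)) (jL (jiota one (i + 1) y))
  = scomm (jD one i x) (jD one (i + 1) y).
Proof.
move=> xp yq; rewrite (scomm_jD _ _ xp yq) (jD_iota_next _ xp yq) !I3E.
rewrite (linN (jL_lin hC)) (linN (scomm_linl _)) {1}jE_jel.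
have xyP := para_smul_part hC xp yq.
rewrite (scomm_diag_jD _ _ xyP) !I3E subrr mulr0 scale0r oppr0 add0r.
rewrite (jD_E2 _ xp) (linZ (jL_lin hC)) (linZ (scomm_linr _)).
rewrite (scomm_anti gJ (jL_part hC (jiota_part i xp))
          (jL_part hC (jiota_part (i + 1) yq))).
set t := scomm _ _.
lincomb k ('End(J) : lmodType k) [:: t]; field; exact: two_neq0.
Qed.

End DerivationsD.
End JordanDer.

(** * Tensor products *)

Section TensorTheory.
Variables (k : fieldType) (V W : vectType k).
Implicit Types (t : tensor V W) (x : V) (y : W).

Lemma tlift_lin (Z : lmodType k) (f : V -> W -> Z) :
  linear (tlift f : tensor V W -> Z).
Proof.
move=> a t s; rewrite /tlift scaler_sumr -big_split /=; apply: eq_bigr => i _.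
rewrite scaler_sumr -big_split /=; apply: eq_bigr => j _.
by rewrite !mxE scalerDl scalerA.
Qed.

Lemma tlift_linf (Z U : lmodType k) (F : U -> V -> W -> Z) t :
  (forall x y, linear (fun u => F u x y)) -> linear (fun u => tlift (F u) t).
Proof.
move=> F_lin; rewrite /tlift; apply: linear_sumf => i; apply: linear_sumf => j.
exact: linear_scalef.
Qed.

Lemma eq_tlift (Z : lmodType k) (f g : V -> W -> Z) :
  (forall x y, f x y = g x y) -> tlift f =1 tlift g.
Proof.
by move=> fg t; apply: eq_bigr => i _; apply: eq_bigr => j _; rewrite fg.
Qed.

Lemma r2v_expand (U : vectType k) (x : U) :
  x = \sum_i v2r x 0 i *: r2v (delta_mx 0 i).
Proof.
apply: (can_inj v2rK); rewrite linear_sum [LHS]row_sum_delta.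
by apply: eq_bigr => i _; rewrite linearZ /= r2vK.
Qed.

Lemma tlift_pure (Z : lmodType k) (f : V -> W -> Z) x y :
    (forall y', linear (f^~ y')) -> (forall x', linear (f x')) ->
  tlift f (tpure x y) = f x y.
Proof.
move=> fl fr; rewrite [in RHS](r2v_expand x) (lin_sum (fl _)).
apply: eq_bigr => i _; rewrite (linZ (fl _)) [in RHS](r2v_expand y).
rewrite (lin_sum (fr _)) scaler_sumr; apply: eq_bigr => j _.
by rewrite (linZ (fr _)) scalerA mxE big_ord1 mxE.
Qed.

Lemma tpure_linl y : linear (fun x => tpure x y : tensor V W).
Proof. by move=> a x x'; rewrite /tpure !linearP /= mulmxDl -scalemxAl. Qed.

Lemma tpure_linr x : linear (fun y => tpure x y : tensor V W).
Proof. by move=> a y y'; rewrite /tpure !linearP /=. Qed.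

Lemma tlift_tpure t : tlift (fun x y => tpure x y : tensor V W) t = t.
Proof.
rewrite [RHS]matrix_sum_delta; apply: eq_bigr => i _; apply: eq_bigr => j _.
by rewrite /tpure !r2vK trmx_delta mul_delta_mx.
Qed.

Lemma tensor_ext (Z : lmodType k) (f g : tensor V W -> Z) :
    linear f -> linear g ->
  (forall x y, f (tpure x y) = g (tpure x y)) -> f =1 g.
Proof.
move=> fl gl fg t; rewrite -[t]tlift_tpure /tlift (lin_sum fl) (lin_sum gl).
apply: eq_bigr => i _; rewrite (lin_sum fl) (lin_sum gl).
by apply: eq_bigr => j _; rewrite (linZ fl) (linZ gl) fg.
Qed.

Lemma tpure_tspan (U : {vspace V}) (U' : {vspace W}) x y :
  x \in U -> y \in U' -> tpure x y \in tspan U U'.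
Proof.
move=> xU yU'; rewrite [x](coord_vbasis xU) [y](coord_vbasis yU').
rewrite (lin_sum (tpure_linl _)) rpred_sum // => i _.
rewrite (linZ (tpure_linl _)) (lin_sum (tpure_linr _)) rpredZ ?rpred_sum //.
move=> j _; rewrite (linZ (tpure_linr _)) rpredZ // memv_span //.
by apply/allpairsP; exists ((vbasis U)`_i, (vbasis U')`_j);
  split=> //=; apply: mem_nth; rewrite size_tuple.
Qed.

Lemma tspanP (Z : vectType k) (f : tensor V W -> Z) (X : {vspace Z})
    (U : {vspace V}) (U' : {vspace W}) :
    linear f -> (forall x y, x \in U -> y \in U' -> f (tpure x y) \in X) ->
  forall t, t \in tspan U U' -> f t \in X.
Proof.
move=> fl fX t; rewrite -(lin_lfunE fl) memv_preim; apply/subvP/span_subvP.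
move=> _ /allpairsP[[x y] /= [xU yU' ->]]; rewrite -memv_preim lin_lfunE //.
by apply: fX; apply: vbasis_mem.
Qed.

End TensorTheory.

(** * Bilinearity of the bracket *)

Definition bilin (k : fieldType) (S : qsuperalg k) :=
  [/\ forall y, linear (@smul k S ^~ y), forall x, linear (@smul k S x),
      forall y, scalar (@sform k S ^~ y) & forall x, scalar (@sform k S x)].

Section TT.
Variables (k : fieldType) (S : qsuperalg k).
Hypothesis bS : bilin S.
Let ml := let: And4 h _ _ _ := bS in h.
Let mr := let: And4 _ h _ _ := bS in h.
Let fl := let: And4 _ _ h _ := bS in h.
Let fr := let: And4 _ _ _ h := bS in h.

(* In the context so that [done] finds the linearity of the parity projections. *)
Let Vl := @linear_of_lfun k S S.

Lemma lmult_lin : linear (@lmult k S).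
Proof. exact: linear_linfun. Qed.

Lemma rmult_fun_lin x : linear (fun y : S =>
  \sum_(p : bool) \sum_(q : bool)
    (-1) ^+ (p && q) *: smul (sproj S q y) (sproj S p x)).
Proof.
apply: linear_sumf => p; apply: linear_sumf => q; apply: linear_scalef.
exact: (linear_comp (@ml _)).
Qed.

Lemma rmult_lin : linear (@rmult k S).
Proof.
apply: linear_linfun; first exact: rmult_fun_lin.
move=> y; apply: linear_sumf => p; apply: linear_sumf => q.
by apply: linear_scalef; apply: (linear_comp (@mr _)).
Qed.

Lemma scalar_comp (U V : lmodType k) (f : V -> k) (g : U -> V) :
  scalar f -> linear g -> scalar (fun x => f (g x)).
Proof. by move=> f_lin g_lin a x y; rewrite g_lin f_lin. Qed.

Lemma scalar_scale (U : lmodType k) c (f : U -> k) :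
  scalar f -> scalar (fun x => c * f x).
Proof. by move=> f_lin a x y; rewrite f_lin; ring. Qed.

Lemma sigma_fun_lin x y : linear (fun z : S =>
  \sum_(p : bool) \sum_(q : bool) \sum_(r : bool)
    ((-1) ^+ (q && r) * sform (sproj S p x) (sproj S r z) *: sproj S q y
     - (-1) ^+ (p && (q (+) r)) * sform (sproj S q y) (sproj S r z) *: sproj S p x)).
Proof.
apply: linear_sumf => p; apply: linear_sumf => q; apply: linear_sumf => r.
by apply: linear_subf; apply: linear_scalev; apply: scalar_scale;
   apply: scalar_comp.
Qed.

Lemma sigma_linl y : linear ((@sigma k S)^~ y).
Proof.
apply: linear_linfun => [x|z]; first exact: sigma_fun_lin.
apply: linear_sumf => p; apply: linear_sumf => q; apply: linear_sumf => r.
apply: linear_subf; last by apply: linear_scalef.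
by apply: linear_scalev; apply: scalar_scale; apply: (scalar_comp (@fl _)).
Qed.

Lemma sigma_linr x : linear (@sigma k S x).
Proof.
apply: linear_linfun => [y|z]; first exact: sigma_fun_lin.
apply: linear_sumf => p; apply: linear_sumf => q; apply: linear_sumf => r.
apply: linear_subf; first by apply: linear_scalef.
by apply: linear_scalev; apply: scalar_scale; apply: (scalar_comp (@fl _)).
Qed.

Lemma mk_triple_lin (U : lmodType k) (f0 f1 f2 : U -> 'End(S)) :
  linear f0 -> linear f1 -> linear f2 ->
  linear (fun u => mk_triple (f0 u) (f1 u) (f2 u)).
Proof.
move=> l0 l1 l2 a u v; apply/ffunP=> i; rewrite !ffunE.
by case: ifP => _; [rewrite l0 | case: ifP => _; rewrite ?l1 ?l2].
Qed.

Lemma comp_linl (g : 'End(S)) : linear (fun f : 'End(S) => (f \o g)%VF).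
Proof. by move=> a f f'; rewrite comp_lfunDl comp_lfunZl. Qed.

Lemma comp_linr (f : 'End(S)) : linear (fun g : 'End(S) => (f \o g)%VF).
Proof. by move=> a g g'; rewrite comp_lfunDr comp_lfunZr. Qed.

Lemma tt_linl y : linear ((@tt k S)^~ y).
Proof.
apply: mk_triple_lin; first exact: sigma_linl.
  apply: linear_subf; first by apply/linear_scalev/scalar_scale.
  exact: (linear_comp (comp_linl _) rmult_lin).
apply: linear_subf; first by apply/linear_scalev/scalar_scale.
exact: (linear_comp (comp_linl _) lmult_lin).
Qed.

Lemma tt_linr x : linear (@tt k S x).
Proof.
apply: mk_triple_lin; first exact: sigma_linr.
  apply: linear_subf; first by apply/linear_scalev/scalar_scale.
  exact: (linear_comp (comp_linr _) lmult_lin).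
apply: linear_subf; first by apply/linear_scalev/scalar_scale.
exact: (linear_comp (comp_linr _) rmult_lin).
Qed.

Lemma theta_lin i : linear (@theta k S i).
Proof. by move=> a d e; apply/ffunP=> j; rewrite !ffunE. Qed.

End TT.

Lemma pair3_lin (k : fieldType) (A B D : lmodType k) a (x x' : A) (y y' : B)
    (z z' : D) :
  a *: (x, y, z) + (x', y', z') = (a *: x + x', a *: y + y', a *: z + z').
Proof. by []. Qed.

Section GBracket.
Variables (k : fieldType) (S S' : qsuperalg k).
Local Notation T := (stensor S S').
Local Notation G := (gcar S S').

Lemma tlift2_linl (Z : lmodType k) F (s : T) :
  linear (fun t : T => tlift2 F t s : Z).
Proof.
rewrite /tlift2; apply: linear_sumf => p; apply: linear_sumf => p'.
by apply: linear_sumf => q; apply: linear_sumf => q'; apply: tlift_lin.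
Qed.

Lemma tlift2_linr (Z : lmodType k) F (t : T) :
  linear (fun s : T => tlift2 F t s : Z).
Proof.
rewrite /tlift2; apply: linear_sumf => p; apply: linear_sumf => p'.
apply: linear_sumf => q; apply: linear_sumf => q'.
by apply: tlift_linf => x x'; apply: tlift_lin.
Qed.

Lemma gact_linl (t : T) : linear (fun d => gact d t).
Proof.
apply: tlift_linf => x y a d e.
by rewrite add_lfunE scale_lfunE tpure_linl.
Qed.

Lemma gact_linr d : linear (gact d : T -> T).
Proof. exact: tlift_lin. Qed.

Lemma gact'_linl (t : T) : linear (fun d => gact' d t).
Proof.
apply: linear_sumf => p; apply: linear_sumf => q.
apply: tlift_linf => x y; apply: linear_scalef => a d e.
by rewrite end_proj_lin add_lfunE scale_lfunE tpure_linr.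
Qed.

Lemma gact'_linr d : linear (gact' d : T -> T).
Proof.
by apply: linear_sumf => p; apply: linear_sumf => q; apply: tlift_lin.
Qed.

Lemma gnext_linl (s : T) : linear (fun t : T => gnext t s).
Proof. exact: tlift2_linl. Qed.
Lemma gnext_linr (t : T) : linear (gnext t).
Proof. exact: tlift2_linr. Qed.
Lemma gsame_linl i (s : T) : linear (fun t : T => gsame i t s).
Proof. exact: tlift2_linl. Qed.
Lemma gsame_linr i (t : T) : linear (gsame i t).
Proof. exact: tlift2_linr. Qed.
Lemma gsame'_linl i (s : T) : linear (fun t : T => gsame' i t s).
Proof. exact: tlift2_linl. Qed.
Lemma gsame'_linr i (t : T) : linear (gsame' i t).
Proof. exact: tlift2_linr. Qed.

Lemma gproj_lin p : linear (gproj p : G -> G).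
Proof.
move=> a [[x1 x2] x3] [[y1 y2] y3]; rewrite /gproj /=.
by congr (_, _, _); apply/ffunP=> i; rewrite !ffunE ?end_proj_lin ?linearP.
Qed.

Lemma ghalf_linl (y : G) : linear (fun x : G => ghalf x y).
Proof.
move=> a [[x1 x2] x3] [[z1 z2] z3]; rewrite /ghalf /=.
congr (_, _, _); apply/ffunP=> i; rewrite !ffunE /=.
- by rewrite comp_lfunDl comp_lfunZl.
- by rewrite comp_lfunDl comp_lfunZl.
rewrite gact_linl gact'_linl gnext_linl.
set t1 := gact _ _; set t2 := gact _ _; set t3 := gact' _ _; set t4 := gact' _ _.
set t5 := gnext _ _; set t6 := gnext _ _.
lincomb k (T : lmodType k) [:: t1; t2; t3; t4; t5; t6].
Qed.

Lemma ghalf_linr (x : G) : linear (fun y : G => ghalf x y).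
Proof.
move=> a [[y1 y2] y3] [[z1 z2] z3]; rewrite /ghalf /=.
congr (_, _, _); apply/ffunP=> i; rewrite !ffunE /=.
- by rewrite comp_lfunDr comp_lfunZr.
- by rewrite comp_lfunDr comp_lfunZr.
rewrite gact_linr gact'_linr gnext_linr.
set t1 := gact _ _; set t2 := gact _ _; set t3 := gact' _ _; set t4 := gact' _ _.
set t5 := gnext _ _; set t6 := gnext _ _.
lincomb k (T : lmodType k) [:: t1; t2; t3; t4; t5; t6].
Qed.

Lemma gbr_linl (y : G) : linear (fun x : G => gbr x y).
Proof.
apply: linear_addf.
  apply: linear_sumf => p; apply: linear_sumf => q; apply: linear_subf.
    exact: (linear_comp (ghalf_linl _) (gproj_lin p)).
  by apply: linear_scalef; apply: (linear_comp (ghalf_linr _) (gproj_lin p)).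
move=> a [[x1 x2] x3] [[z1 z2] z3]; rewrite [RHS]pair3_lin /=.
congr (_, _, _); last by rewrite scaler0 addr0.
  rewrite scaler_sumr -big_split; apply: eq_bigr => i _.
  by rewrite !ffunE gsame_linl.
rewrite scaler_sumr -big_split; apply: eq_bigr => i _.
by rewrite !ffunE gsame'_linl.
Qed.

Lemma gbr_linr (x : G) : linear (fun y : G => gbr x y).
Proof.
apply: linear_addf.
  apply: linear_sumf => p; apply: linear_sumf => q; apply: linear_subf.
    exact: (linear_comp (ghalf_linr _) (gproj_lin q)).
  by apply: linear_scalef; apply: (linear_comp (ghalf_linl _) (gproj_lin q)).
move=> a [[y1 y2] y3] [[z1 z2] z3]; rewrite [RHS]pair3_lin /=.
congr (_, _, _); last by rewrite scaler0 addr0.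
  rewrite scaler_sumr -big_split; apply: eq_bigr => i _.
  by rewrite !ffunE gsame_linr.
rewrite scaler_sumr -big_split; apply: eq_bigr => i _.
by rewrite !ffunE gsame'_linr.
Qed.

End GBracket.

(** * The bracket when the first factor is purely even *)

Section EvenFactor.
Variables (k : fieldType) (S : qsuperalg k).
Hypotheses (S0 : spart S false = fullv) (S1 : spart S true = 0%VS).

Lemma even_graded : graded S.
Proof. by rewrite /graded S0 S1 addv0 capv0. Qed.

Lemma sproj_even p (x : S) : sproj S p x = if p then 0 else x.
Proof.
have x0 : x \in spart S false by rewrite S0 memvf.
by rewrite (sprojE even_graded.2 _ x0); case: p.
Qed.

Lemma even_mem (x : S) : x \in spart S false. Proof. by rewrite S0 memvf. Qed.

Lemma odd_mem0 (x : S) : x \in spart S true -> x = 0.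
Proof. by rewrite S1 memv0 => /eqP. Qed.

Lemma even_end_odd (d : 'End(S)) : end_part true d -> d = 0.
Proof.
move=> hd; apply/lfunP=> x; rewrite zero_lfunE; apply: odd_mem0.
exact: hd (even_mem x).
Qed.

Lemma even_end_part (d : 'End(S)) : end_part false d.
Proof.
case=> x; first by move/odd_mem0->; rewrite linear0 mem0v.
by move=> _; apply: even_mem.
Qed.

Lemma even_tri_odd (d : triple S) : tri_part true d -> d = 0.
Proof.
case=> osp_d _; apply/ffunP=> i; rewrite ffunE.
exact: even_end_odd (osp_d i).1.
Qed.

Hypothesis bS : bilin S.

Lemma lmultE (x y : S) : lmult x y = smul x y.
Proof. by case: bS => _ h _ _; apply: (lin_lfunE (h x)). Qed.

Lemma rmult_even (x y : S) : rmult x y = smul y x.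
Proof.
rewrite (lin_lfunE (rmult_fun_lin bS x)) !big_bool /= !sproj_even.
case: bS => h h' _ _.
by rewrite !(lin0 (h _)) !(lin0 (h' _)) !scaler0 !add0r expr0 scale1r.
Qed.

Lemma sigma_even (x y z : S) : sigma x y z = sform x z *: y - sform y z *: x.
Proof.
rewrite (lin_lfunE (sigma_fun_lin bS x y)) !big_bool /= !sproj_even.
case: bS => _ _ h h'.
rewrite !(scal0 (h _)) !(scal0 (h' _)) !mulr0 !scaler0 !scale0r !oppr0.
by rewrite !add0r expr0 !mul1r.
Qed.

End EvenFactor.

Section EvenTensor.
Variables (k : fieldType) (S S' : qsuperalg k).
Hypotheses (S0 : spart S false = fullv) (S1 : spart S true = 0%VS).
Hypotheses (bS : bilin S) (bS' : bilin S') (gS' : graded S').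
Local Notation T := (stensor S S').
Local Notation G := (gcar S S').
Implicit Types (c : S) (a : S') (t : T).

Lemma gact_pure (d : 'End(S)) c a : gact d (tpure c a) = tpure (d c) a :> T.
Proof.
rewrite /gact tlift_pure // => [y s x x' | x].
  by rewrite linearP tpure_linl.
exact: tpure_linr.
Qed.

Lemma gact'_pure (d : 'End(S')) c a : gact' d (tpure c a) = tpure c (d a) :> T.
Proof.
rewrite /gact'.
have tE p q : tlift (fun x x' => (-1) ^+ (p && q) *:
      tpure (sproj S q x) (end_proj p d x') : T) (tpure c a : T)
    = (-1) ^+ (p && q) *: (tpure (sproj S q c) (end_proj p d a) : T).
  rewrite tlift_pure // => y; apply: linear_scalef.
    exact: (linear_comp (tpure_linl _) (linear_of_lfun _)).
  exact: (linear_comp (tpure_linr _) (linear_of_lfun _)).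
rewrite -[in RHS](end_proj_sum gS' d) sum_lfunE (lin_sum (tpure_linr _)).
apply: eq_bigr => p _; rewrite big_bool /= !tE !(sproj_even S0 S1) andbF.
by rewrite expr0 scale1r (lin0 (tpure_linl _)) scaler0 add0r.
Qed.

(** All signs and projections on the first factor disappear, so that the bracket
    of pure tensors needs no homogeneity assumption on the second factor. *)
Lemma tlift2_pure (Z : lmodType k)
    (F : bool -> bool -> bool -> bool -> S -> S' -> S -> S' -> Z) c a c' a' :
    (forall p p' q q' x' y y', linear (fun x => F p p' q q' x x' y y')) ->
    (forall p p' q q' x y y', linear (fun x' => F p p' q q' x x' y y')) ->
    (forall p p' q q' x x' y', linear (fun y => F p p' q q' x x' y y')) ->
    (forall p p' q q' x x' y, linear (fun y' => F p p' q q' x x' y y')) ->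
  tlift2 F (tpure c a : T) (tpure c' a') =
  \sum_(p' : bool) \sum_(q' : bool)
     F false p' false q' c (sproj S' p' a) c' (sproj S' q' a').
Proof.
move=> F1 F2 F3 F4; rewrite /tlift2.
have tl p p' q q' x x' : tlift (fun y y' =>
    F p p' q q' x x' (sproj S q y) (sproj S' q' y')) (tpure c' a' : T)
    = F p p' q q' x x' (sproj S q c') (sproj S' q' a').
  rewrite tlift_pure // => [y|y].
    exact: (linear_comp (F3 _ _ _ _ _ _ _) (linear_of_lfun _)).
  exact: (linear_comp (F4 _ _ _ _ _ _ _) (linear_of_lfun _)).
transitivity (\sum_(p : bool) \sum_(p' : bool) \sum_(q : bool) \sum_(q' : bool)
   F p p' q q' (sproj S p c) (sproj S' p' a) (sproj S q c') (sproj S' q' a')).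
  apply: eq_bigr => p _; apply: eq_bigr => p' _; apply: eq_bigr => q _.
  apply: eq_bigr => q' _; rewrite (eq_tlift (fun x x' => tl _ _ _ _ _ _)).
  rewrite tlift_pure // => [y|y].
    exact: (linear_comp (F1 _ _ _ _ _ _ _) (linear_of_lfun _)).
  exact: (linear_comp (F2 _ _ _ _ _ _ _) (linear_of_lfun _)).
rewrite big_bool /= big1 ?add0r => [|p' _]; last first.
  rewrite big1 // => q _; rewrite big1 // => q' _.
  by rewrite (sproj_even S0 S1) (lin0 (F1 _ _ _ _ _ _ _)).
apply: eq_bigr => p' _; rewrite big_bool /= big1 ?add0r => [|q' _]; last first.
  by rewrite !(sproj_even S0 S1) (lin0 (F3 _ _ _ _ _ _ _)).
by apply: eq_bigr => q' _; rewrite !(sproj_even S0 S1).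
Qed.

Lemma sum_sproj2 (Z : lmodType k) (f : S' -> S' -> Z) a a' :
    (forall y, linear (f^~ y)) -> (forall x, linear (f x)) ->
  \sum_(p : bool) \sum_(q : bool) f (sproj S' p a) (sproj S' q a') = f a a'.
Proof.
move=> fl fr; rewrite -[in RHS](sproj_sum gS' a) (lin_sum (fl _)).
apply: eq_bigr => p _; rewrite -[in RHS](sproj_sum gS' a') (lin_sum (fr _)).
by [].
Qed.

Lemma gnext_pure c a c' a' :
  gnext (tpure c a : T) (tpure c' a') = tpure (smul c c') (smul a a').
Proof.
have [[ml mr _ _] [ml' mr' _ _]] := (bS, bS').
rewrite /gnext tlift2_pure.
- transitivity (\sum_(p' : bool) \sum_(q' : bool)
      (tpure (smul c c') (smul (sproj S' p' a) (sproj S' q' a')) : T)).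
    by apply: eq_bigr => p' _; apply: eq_bigr => q' _; rewrite andbF scale1r.
  apply: (@sum_sproj2 T (fun x y => tpure (smul c c') (smul x y) : T)) => y.
    exact: (linear_comp (tpure_linr _) (@ml' _)).
  exact: (linear_comp (tpure_linr _) (@mr' _)).
- move=> *; apply: linear_scalef; exact: (linear_comp (tpure_linl _) (@ml _)).
- move=> *; apply: linear_scalef; exact: (linear_comp (tpure_linr _) (@ml' _)).
- move=> *; apply: linear_scalef; exact: (linear_comp (tpure_linl _) (@mr _)).
move=> *; apply: linear_scalef; exact: (linear_comp (tpure_linr _) (@mr' _)).
Qed.

Lemma gsame_pure i c a c' a' :
  gsame i (tpure c a : T) (tpure c' a') = sform a a' *: theta i (tt c c').
Proof.
have [_ _ fl' fr'] := bS'.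
have thl y := linear_comp (theta_lin i) (tt_linl bS y).
have thr x := linear_comp (theta_lin i) (tt_linr bS x).
rewrite /gsame tlift2_pure.
- transitivity (\sum_(p' : bool) \sum_(q' : bool)
      (sform (sproj S' p' a) (sproj S' q' a') *: theta i (tt c c'))).
    apply: eq_bigr => p' _; apply: eq_bigr => q' _.
    by rewrite /= expr0 mul1r.
  apply: (@sum_sproj2 _ (fun x y => sform x y *: theta i (tt c c'))) => y.
    exact: linear_scalev.
  exact: linear_scalev.
- by move=> *; apply: linear_scalef.
- by move=> *; apply: linear_scalev; apply: scalar_scale.
- by move=> *; apply: linear_scalef.
by move=> *; apply: linear_scalev; apply: scalar_scale.
Qed.

Lemma gsame'_pure i c a c' a' :
  gsame' i (tpure c a : T) (tpure c' a') = sform c c' *: theta i (tt a a').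
Proof.
have [_ _ fl fr] := bS.
have thl y := linear_comp (theta_lin i) (tt_linl bS' y).
have thr x := linear_comp (theta_lin i) (tt_linr bS' x).
rewrite /gsame' tlift2_pure.
- transitivity (\sum_(p' : bool) \sum_(q' : bool)
      (sform c c' *: theta i (tt (sproj S' p' a) (sproj S' q' a')))).
    apply: eq_bigr => p' _; apply: eq_bigr => q' _.
    by rewrite /= expr0 mul1r.
  apply: (@sum_sproj2 _ (fun x y => sform c c' *: theta i (tt x y))) => y.
    exact: linear_scalef.
  exact: linear_scalef.
- by move=> *; apply: linear_scalev; apply: scalar_scale.
- by move=> *; apply: linear_scalef.
- by move=> *; apply: linear_scalev; apply: scalar_scale.
by move=> *; apply: linear_scalef.
Qed.

(** A linear form on [S] contracts the first factor of a tensor. *)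
Definition tcoord (f : S -> k) (t : T) : S' := tlift (fun x y => f x *: y) t.

Lemma tcoord_lin f : linear (tcoord f). Proof. exact: tlift_lin. Qed.

Lemma tcoord_pure f c a : scalar f -> tcoord f (tpure c a) = f c *: a.
Proof.
move=> f_lin; rewrite /tcoord tlift_pure // => y; first exact: linear_scalev.
exact: linear_scalef.
Qed.

Lemma tcoord_part p f t :
  scalar f -> t \in spart T p -> tcoord f t \in spart S' p.
Proof.
move=> f_lin; rewrite /= big_bool => /memv_addP[t1 t1P [t0 t0P ->]].
rewrite (linD (tcoord_lin f)) rpredD //.
  apply: tspanP t1P; first exact: tcoord_lin.
  move=> x y /(odd_mem0 S1)-> _; rewrite (lin0 (tpure_linl _)).
  by rewrite (lin0 (tcoord_lin _)) mem0v.
apply: tspanP t0P; first exact: tcoord_lin.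
by move=> x y _; rewrite addbF tcoord_pure // => yp; rewrite rpredZ.
Qed.

Lemma tpure_part p c a : a \in spart S' p -> tpure c a \in spart T p.
Proof.
move=> ap; rewrite /= big_bool; apply: subvP (addvSr _ _) _ _.
by apply: tpure_tspan; rewrite ?addbF ?(even_mem S0).
Qed.

Section Homogeneous.
Hypothesis dT : (spart T false :&: spart T true = 0)%VS.

Lemma gproj_part p q (x : G) : gpart p x -> gproj q x = if q == p then x else 0.
Proof.
case: x => -[d d'] t [/= [hd _] [hd' _] ht]; rewrite /gproj /=.
case: ifPn => qp.
  congr (_, _, _); apply/ffunP=> i; rewrite ffunE.
  - by rewrite (end_projE (even_graded S0 S1) _ (hd i).1) qp.
  - by rewrite (end_projE gS' _ (hd' i).1) qp.
  by rewrite (sprojE dT _ (ht i)) qp.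
congr (_, _, _); apply/ffunP=> i; rewrite !ffunE.
- by rewrite (end_projE (even_graded S0 S1) _ (hd i).1) (negPf qp).
- by rewrite (end_projE gS' _ (hd' i).1) (negPf qp).
by rewrite (sprojE dT _ (ht i)) (negPf qp).
Qed.

Lemma gbr_hom p q (x y : G) : gpart p x -> gpart q y ->
  gbr x y = ghalf x y - (-1) ^+ (p && q) *: ghalf y x
            + (\sum_i gsame i (x.2 i) (y.2 i), \sum_i gsame' i (x.2 i) (y.2 i), 0).
Proof.
move=> xp yq; rewrite /gbr (@sum_bool2 _ p q) => [|r s /orP rs]; last first.
  rewrite (gproj_part _ xp) (gproj_part _ yq).
  by case: rs => /negPf->;
    rewrite ?(lin0 (ghalf_linl _)) ?(lin0 (ghalf_linr _)) scaler0 subr0.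
by rewrite (gproj_part _ xp) (gproj_part _ yq) !eqxx.
Qed.

End Homogeneous.

End EvenTensor.

(** * The superalgebras S1 and S2 *)

Section SmallPara.
Variables (k : fieldType).
Hypothesis two_neq0 : 2 != 0 :> k.
Local Notation A1 := (S1 k).
Local Notation A2 := (S2 k).
Local Notation u1 := (S1_one k).
Local Notation e1 := (S2_one k).
Local Notation u := (S2_u k).

Lemma S1_even : spart A1 false = fullv. Proof. by []. Qed.
Lemma S1_odd : spart A1 true = 0%VS. Proof. by []. Qed.
Lemma S2_even : spart A2 false = fullv. Proof. by []. Qed.
Lemma S2_odd : spart A2 true = 0%VS. Proof. by []. Qed.

Lemma S1_smulE (x y : A1) : smul x y = (x : k) * y.
Proof.
rewrite /smul /= /sconj /= mulr1.
have xE (z : k) : (2 * z) *: (1 : k^o) - z = z by rewrite /GRing.scale /=; ring.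
by rewrite !mulr1 !xE.
Qed.

Lemma S1_sformE (x y : A1) : sform x y = 2 * ((x : k) * y).
Proof. by []. Qed.

Lemma S2_eqP (x y : A2) : x.1 = y.1 -> x.2 = y.2 -> x = y.
Proof. by case: x y => [x1 x2] [y1 y2] /= -> ->. Qed.

Lemma S2_smulE (x y : A2) : smul x y = ((x.2 * y.2, x.1 * y.1) : k * k).
Proof.
apply: S2_eqP.
  rewrite -[LHS]/(((x.1 * 1 + x.2 * 1) * 1 - x.1) * ((y.1 * 1 + y.2 * 1) * 1 - y.1)).
  by rewrite -[RHS]/(x.2 * y.2); ring.
rewrite -[LHS]/(((x.1 * 1 + x.2 * 1) * 1 - x.2) * ((y.1 * 1 + y.2 * 1) * 1 - y.2)).
by rewrite -[RHS]/(x.1 * y.1); ring.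
Qed.

Lemma S2_sformE (x y : A2) : sform x y = x.1 * y.2 + x.2 * y.1.
Proof. by []. Qed.

Lemma S1_bilin : bilin A1.
Proof.
split=> [y a x z | x a y z | y a x z | x a y z]; rewrite ?S1_smulE ?S1_sformE.
- by rewrite /GRing.scale /=; ring.
- by rewrite /GRing.scale /=; ring.
- by rewrite /GRing.scale /=; ring.
by rewrite /GRing.scale /=; ring.
Qed.

Lemma S2_bilin : bilin A2.
Proof.
split=> [y a x z | x a y z | y a x z | x a y z]; rewrite ?S2_smulE ?S2_sformE.
- by congr (_, _);
    [rewrite -[LHS]/((a * x.2 + z.2) * y.2) -[RHS]/(a * (x.2 * y.2) + z.2 * y.2)
    |rewrite -[LHS]/((a * x.1 + z.1) * y.1) -[RHS]/(a * (x.1 * y.1) + z.1 * y.1)];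
    ring.
- by congr (_, _);
    [rewrite -[LHS]/(x.2 * (a * y.2 + z.2)) -[RHS]/(a * (x.2 * y.2) + x.2 * z.2)
    |rewrite -[LHS]/(x.1 * (a * y.1 + z.1)) -[RHS]/(a * (x.1 * y.1) + x.1 * z.1)];
    ring.
- by rewrite -[LHS]/((a * x.1 + z.1) * y.2 + (a * x.2 + z.2) * y.1); ring.
by rewrite -[LHS]/(x.1 * (a * y.2 + z.2) + x.2 * (a * y.1 + z.1)); ring.
Qed.

Lemma S2_sigmaE (x : A2) : S2_sigma k x = ((x.1, - x.2) : k * k).
Proof.
rewrite scale_lfunE (sigma_even S2_even S2_odd S2_bilin) !S2_sformE.
apply: S2_eqP.
  rewrite -[LHS]/(2^-1 * ((1 * x.2 + 1 * x.1) * 1 - (1 * x.2 + (-1) * x.1) * 1)).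
  by rewrite -[RHS]/x.1; field; exact: two_neq0.
rewrite -[LHS]/(2^-1 * ((1 * x.2 + 1 * x.1) * (-1) - (1 * x.2 + (-1) * x.1) * 1)).
by rewrite -[RHS]/(- x.2); field; exact: two_neq0.
Qed.

(** When the entries of [al] sum to 0 these are the elements of tri(S2): see
    [S2_tri_part] and [S2_triE]. *)
Definition S2_tri (al : 'I_3 -> k) : triple A2 := [ffun i => al i *: S2_sigma k].

Lemma S2_tri_app al i (x : A2) :
  S2_tri al i x = ((al i * x.1, - (al i * x.2)) : k * k).
Proof.
by rewrite ffunE scale_lfunE S2_sigmaE; apply: S2_eqP => //=; apply: mulrN.
Qed.

(** In particular t_(1,1) = t_(u,u) = 0 and t_(1,u) = (2, -1, -1) sigma. *)
Lemma S2_ttE (x y : A2) :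
  tt x y = S2_tri (fun i => 2^-1 * (x.2 * y.1 - x.1 * y.2)
                            * (if i == 0 then 2 else -1)).
Proof.
have lE := lmultE S2_bilin; have rE := rmult_even S2_even S2_odd S2_bilin.
apply/ffunP=> i; rewrite !ffunE; apply/lfunP=> z; rewrite scale_lfunE S2_sigmaE.
case: ifP => _.
  rewrite (sigma_even S2_even S2_odd S2_bilin) !S2_sformE; apply: S2_eqP.
    rewrite -[LHS]/((x.1 * z.2 + x.2 * z.1) * y.1 - (y.1 * z.2 + y.2 * z.1) * x.1).
    rewrite -[RHS]/(2^-1 * (x.2 * y.1 - x.1 * y.2) * 2 * z.1).
    by field; exact: two_neq0.
  rewrite -[LHS]/((x.1 * z.2 + x.2 * z.1) * y.2 - (y.1 * z.2 + y.2 * z.1) * x.2).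
  rewrite -[RHS]/(2^-1 * (x.2 * y.1 - x.1 * y.2) * 2 * - z.2).
  by field; exact: two_neq0.
case: ifP => _; rewrite add_lfunE opp_lfunE scale_lfunE id_lfunE comp_lfunE.
  rewrite rE lE !S2_smulE S2_sformE; apply: S2_eqP.
    rewrite -[LHS]/(2^-1 * (x.1 * y.2 + x.2 * y.1) * z.1 - y.1 * z.1 * x.2).
    rewrite -[RHS]/(2^-1 * (x.2 * y.1 - x.1 * y.2) * -1 * z.1).
    by field; exact: two_neq0.
  rewrite -[LHS]/(2^-1 * (x.1 * y.2 + x.2 * y.1) * z.2 - y.2 * z.2 * x.1).
  rewrite -[RHS]/(2^-1 * (x.2 * y.1 - x.1 * y.2) * -1 * - z.2).
  by field; exact: two_neq0.
rewrite lE rE !S2_smulE S2_sformE; apply: S2_eqP.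
  rewrite -[LHS]/(2^-1 * (x.1 * y.2 + x.2 * y.1) * z.1 - x.2 * (z.1 * y.1)).
  rewrite -[RHS]/(2^-1 * (x.2 * y.1 - x.1 * y.2) * -1 * z.1).
  by field; exact: two_neq0.
rewrite -[LHS]/(2^-1 * (x.1 * y.2 + x.2 * y.1) * z.2 - x.1 * (z.2 * y.2)).
rewrite -[RHS]/(2^-1 * (x.2 * y.1 - x.1 * y.2) * -1 * - z.2).
by field; exact: two_neq0.
Qed.

(** As sigma sends (1, 1) to (1, -1), the multiple [al *: sigma] is determined
    by the first component of its value at (1, 1). *)
Definition S2_al (d : triple A2) (i : 'I_3) : k := (d i e1).1.

Lemma S2_al_lin i : scalar (S2_al^~ i).
Proof. by move=> a d d'; rewrite /S2_al !ffunE add_lfunE scale_lfunE. Qed.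

Lemma S2_triK al i : S2_al (S2_tri al) i = al i.
Proof. by rewrite /S2_al ffunE scale_lfunE S2_sigmaE -[LHS]/(al i * 1) mulr1. Qed.

Lemma S2_tri_part al :
  tri_part false (S2_tri al) <-> al 0 + al 1 + al 2 = 0.
Proof.
split=> [[_ triS] | al0].
  have := triS false false (1, 0) (1, 0) (memvf _) (memvf _).
  rewrite andFb expr0 scale1r !S2_smulE !S2_tri_app => /(congr1 snd).
  rewrite -[LHS]/(- (al 0 * (1 * 1))).
  rewrite -[RHS]/(al 1 * 1 * 1 + 1 * (al 2 * 1)) => alE.
  by rewrite -addrA; apply/eqP; rewrite addr_eq0 -eqr_oppLR; apply/eqP; move: alE;
    rewrite !mulr1 mul1r.
split=> [i | q r x y _ _].
  split; first exact: (even_end_part S2_even S2_odd).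
  move=> q x y _; rewrite andFb expr0 mul1r !S2_tri_app !S2_sformE.
  rewrite -[LHS]/(al i * x.1 * y.2 + - (al i * x.2) * y.1
     + (x.1 * - (al i * y.2) + x.2 * (al i * y.1))).
  by ring.
have al0E : al 0 = - (al 1 + al 2).
  by apply/eqP; rewrite -addr_eq0 addrA al0.
rewrite andFb expr0 scale1r !S2_tri_app !S2_smulE; apply: S2_eqP.
  rewrite -[LHS]/(al 0 * (x.2 * y.2)) al0E.
  rewrite -[RHS]/(- (al 1 * x.2) * y.2 + x.2 * - (al 2 * y.2)).
  by ring.
rewrite -[LHS]/(- (al 0 * (x.1 * y.1))) al0E.
rewrite -[RHS]/(al 1 * x.1 * y.1 + x.1 * (al 2 * y.1)).
by ring.
Qed.

(** In the basis of idempotents of k x k, an endomorphism skew for the norm is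
    diagonal with opposite entries. *)
Lemma S2_triE d : tri_part false d -> d = S2_tri (S2_al d).
Proof.
case=> osp_d _; apply/ffunP=> i; rewrite ffunE.
have [_ skew] := osp_d i; set f := d i in skew *.
pose f1 : A2 := ((1, 0) : k * k); pose f2 : A2 := ((0, 1) : k * k).
have skewE x y : sform (f x) y + sform x (f y) = 0.
  by have := skew false x y (memvf _); rewrite andFb expr0 mul1r.
have E11 := skewE f1 f1; have E12 := skewE f1 f2; have E22 := skewE f2 f2.
have xE (x : A2) : x = x.1 *: f1 + x.2 *: f2.
  apply: S2_eqP; first by rewrite -[RHS]/(x.1 * 1 + x.2 * 0); ring.
  by rewrite -[RHS]/(x.1 * 0 + x.2 * 1); ring.
have z2 (x : k) : x + x = 0 -> x = 0.
  move/eqP; rewrite -mulr2n -mulr_natl mulf_eq0 (negPf two_neq0) /=.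
  by move/eqP.
have f12 : (f f1).2 = 0.
  apply: z2; rewrite -[RHS]E11 !S2_sformE.
  rewrite -[RHS]/((f f1).1 * 0 + (f f1).2 * 1 + (1 * (f f1).2 + 0 * (f f1).1)).
  by ring.
have f21 : (f f2).1 = 0.
  apply: z2; rewrite -[RHS]E22 !S2_sformE.
  rewrite -[RHS]/((f f2).1 * 1 + (f f2).2 * 0 + (0 * (f f2).2 + 1 * (f f2).1)).
  by ring.
have f22 : (f f2).2 = - (f f1).1.
  apply/eqP; rewrite -addr_eq0; apply/eqP; rewrite -[RHS]E12 !S2_sformE.
  rewrite -[RHS]/((f f1).1 * 1 + (f f1).2 * 0 + (1 * (f f2).2 + 0 * (f f2).1)).
  by ring.
have fE x : f x = ((x.1 * (f f1).1, - (x.2 * (f f1).1)) : k * k).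
  rewrite {1}[x]xE (linD (linear_of_lfun f)) !(linZ (linear_of_lfun f)).
  apply: S2_eqP.
    by rewrite -[LHS]/(x.1 * (f f1).1 + x.2 * (f f2).1) f21 mulr0 addr0.
  by rewrite -[LHS]/(x.1 * (f f1).2 + x.2 * (f f2).2) f12 f22 mulr0 add0r mulrN.
apply/lfunP=> x; rewrite scale_lfunE S2_sigmaE /S2_al -/f [f x]fE [f e1]fE.
apply: S2_eqP.
  by rewrite -[LHS]/(x.1 * (f f1).1) -[RHS]/(1 * (f f1).1 * x.1); ring.
by rewrite -[LHS]/(- (x.2 * (f f1).1)) -[RHS]/(1 * (f f1).1 * - x.2); ring.
Qed.

Lemma S1_tri0 p d : tri_part p (d : triple A1) -> d = 0.
Proof.
case: p => [|[osp_d _]]; first exact: (even_tri_odd S1_even S1_odd).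
apply/ffunP=> i; rewrite ffunE; have [_ skew] := osp_d i.
have : d i u1 = 0.
  have := skew false u1 u1 (memvf _); rewrite andFb expr0 mul1r !S1_sformE.
  rewrite -[u1]/(1 : k) mulr1 mul1r -mulrDr => /eqP.
  rewrite mulf_eq0 (negPf two_neq0) /= -mulr2n -mulr_natl mulf_eq0.
  by rewrite (negPf two_neq0) => /eqP.
move=> d1; apply/lfunP=> x; rewrite zero_lfunE.
have -> : x = (x : k) *: u1 by rewrite -[RHS]/((x : k) * 1) mulr1.
by rewrite linearZ /= d1 scaler0.
Qed.

Lemma S1_tt0 (x y : A1) : tt x y = 0.
Proof.
have lE := lmultE S1_bilin; have rE := rmult_even S1_even S1_odd S1_bilin.
apply/ffunP=> i; rewrite !ffunE; apply/lfunP=> z; rewrite zero_lfunE.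
case: ifP => _.
  rewrite (sigma_even S1_even S1_odd S1_bilin) !S1_sformE.
  by rewrite -[LHS]/(2 * ((x : k) * z) * (y : k) - 2 * ((y : k) * z) * (x : k)); ring.
case: ifP => _; rewrite add_lfunE opp_lfunE scale_lfunE id_lfunE comp_lfunE;
  rewrite !(rE, lE) !S1_smulE S1_sformE.
  rewrite -[LHS]/(2^-1 * (2 * ((x : k) * y)) * (z : k) - (y : k) * z * (x : k)).
  by field; exact: two_neq0.
rewrite -[LHS]/(2^-1 * (2 * ((x : k) * y)) * (z : k) - (x : k) * ((z : k) * y)).
by field; exact: two_neq0.
Qed.

End SmallPara.

(** * Tensors with S1 and S2 in coordinates *)

Section Coordinates.
Variables (k : fieldType) (S : qsuperalg k).
Hypotheses (two_neq0 : 2 != 0 :> k) (bS : bilin S) (gS : graded S).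
Local Notation A1 := (S1 k).
Local Notation A2 := (S2 k).
Local Notation u1 := (S1_one k).
Local Notation e1 := (S2_one k).
Local Notation u := (S2_u k).
Local Notation T1 := (stensor A1 S).
Local Notation T2 := (stensor A2 S).
Implicit Types (a b : S) (p q : bool) (al be : 'I_3 -> k).

Let b1 := S1_bilin k.
Let b2 := S2_bilin k.

(** The coefficient [a] in [1 (x) a]. *)
Definition c0 (t : T1) : S := tcoord (fun x : A1 => x : k) t.
(** The coefficient [a] in [1 (x) a + u (x) b]. *)
Definition c1 (t : T2) : S := tcoord (fun x : A2 => 2^-1 * (x.1 + x.2)) t.
(** The coefficient [b] in [1 (x) a + u (x) b]. *)
Definition cu (t : T2) : S := tcoord (fun x : A2 => 2^-1 * (x.1 - x.2)) t.

Let f0_lin : scalar (fun x : A1 => x : k). Proof. by []. Qed.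
Let f1_lin : scalar (fun x : A2 => 2^-1 * (x.1 + x.2)).
Proof.
move=> a x y; rewrite -[LHS]/(2^-1 * (a * x.1 + y.1 + (a * x.2 + y.2))) /=.
by ring.
Qed.
Let fu_lin : scalar (fun x : A2 => 2^-1 * (x.1 - x.2)).
Proof.
move=> a x y; rewrite -[LHS]/(2^-1 * (a * x.1 + y.1 - (a * x.2 + y.2))) /=.
by ring.
Qed.

Lemma c0_lin : linear c0. Proof. exact: tcoord_lin. Qed.
Lemma c1_lin : linear c1. Proof. exact: tcoord_lin. Qed.
Lemma cu_lin : linear cu. Proof. exact: tcoord_lin. Qed.

Lemma c0_one a : c0 (tpure u1 a) = a.
Proof. by rewrite /c0 (tcoord_pure _ _ f0_lin) scale1r. Qed.

Lemma c1_pure x a : c1 (tpure x a) = (2^-1 * (x.1 + x.2)) *: a.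
Proof. exact: (tcoord_pure _ _ f1_lin). Qed.

Lemma cu_pure x a : cu (tpure x a) = (2^-1 * (x.1 - x.2)) *: a.
Proof. exact: (tcoord_pure _ _ fu_lin). Qed.

Lemma c1_one a : c1 (tpure e1 a) = a.
Proof. by rewrite c1_pure -[1 + 1]/2 mulVf // scale1r. Qed.
Lemma c1_u a : c1 (tpure u a) = 0.
Proof. by rewrite c1_pure /= subrr mulr0 scale0r. Qed.
Lemma cu_one a : cu (tpure e1 a) = 0.
Proof. by rewrite cu_pure /= subrr mulr0 scale0r. Qed.
Lemma cu_u a : cu (tpure u a) = a.
Proof. by rewrite cu_pure /= opprK -[1 + 1]/2 mulVf // scale1r. Qed.

Lemma T1E (t : T1) : t = tpure u1 (c0 t).
Proof.
move: t; apply: tensor_ext; first exact: linear_idfun.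
  exact: (linear_comp (tpure_linr _) c0_lin).
move=> x a; rewrite /c0 (tcoord_pure _ _ f0_lin) (linZ (tpure_linr _)).
rewrite -(linZ (tpure_linl _)); congr tpure.
by rewrite -[RHS]/((x : k) * 1) mulr1.
Qed.

Lemma T2E (t : T2) : t = tpure e1 (c1 t) + tpure u (cu t).
Proof.
move: t; apply: tensor_ext; first exact: linear_idfun.
  apply: linear_addf; first exact: (linear_comp (tpure_linr _) c1_lin).
  exact: (linear_comp (tpure_linr _) cu_lin).
move=> x a; rewrite c1_pure cu_pure !(linZ (tpure_linr _)).
rewrite -!(linZ (tpure_linl _)) -(linD (tpure_linl _)); congr tpure.
apply: S2_eqP.
  rewrite -[RHS]/(2^-1 * (x.1 + x.2) * 1 + 2^-1 * (x.1 - x.2) * 1).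
  by field; exact: two_neq0.
rewrite -[RHS]/(2^-1 * (x.1 + x.2) * 1 + 2^-1 * (x.1 - x.2) * (-1)).
by field; exact: two_neq0.
Qed.

Lemma T1_partP p (t : T1) : (t \in spart T1 p) <-> (c0 t \in spart S p).
Proof.
split=> [|tp]; first exact: (tcoord_part (S1_odd k) f0_lin).
by rewrite (T1E t); apply: (tpure_part (S1_even k)).
Qed.

Lemma T2_partP p (t : T2) :
  (t \in spart T2 p) <-> (c1 t \in spart S p /\ cu t \in spart S p).
Proof.
split=> [tp | [t1 tu]].
  by split; [apply: (tcoord_part (S2_odd k) f1_lin)
            | apply: (tcoord_part (S2_odd k) fu_lin)].
by rewrite (T2E t) rpredD //; apply: (tpure_part (S2_even k)).
Qed.

Lemma T1_disjoint : (spart T1 false :&: spart T1 true = 0)%VS.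
Proof.
apply/eqP; rewrite -subv0; apply/subvP=> t; rewrite memv_cap memv0.
case/andP=> /T1_partP t0 /T1_partP t1.
by rewrite (T1E t) (spart_disjoint gS.2 t0 t1) (lin0 (tpure_linr _)).
Qed.

Lemma T2_disjoint : (spart T2 false :&: spart T2 true = 0)%VS.
Proof.
apply/eqP; rewrite -subv0; apply/subvP=> t; rewrite memv_cap memv0.
case/andP=> /T2_partP[t01 t0u] /T2_partP[t11 t1u].
rewrite (T2E t) (spart_disjoint gS.2 t01 t11) (spart_disjoint gS.2 t0u t1u).
by rewrite !(lin0 (tpure_linr _)) addr0.
Qed.

Lemma c0_inj (t s : T1) : c0 t = c0 s -> t = s.
Proof. by move=> ts; rewrite (T1E t) ts -T1E. Qed.

Lemma c0_gact' d t : c0 (gact' d t) = d (c0 t).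
Proof. by rewrite {1}(T1E t) (gact'_pure (S1_even k) (S1_odd k) gS) c0_one. Qed.

Lemma c0_gnext t s : c0 (gnext t s) = smul (c0 t) (c0 s).
Proof.
rewrite {1}(T1E t) {1}(T1E s) (gnext_pure (S1_even k) (S1_odd k) b1 bS gS).
by rewrite S1_smulE mulr1 c0_one.
Qed.

Lemma gsame_S1 i (t s : T1) : gsame i t s = 0.
Proof.
rewrite (T1E t) (T1E s) (gsame_pure (S1_even k) (S1_odd k) b1 bS gS).
by rewrite S1_tt0 // (lin0 (theta_lin _)) scaler0.
Qed.

Lemma gsame'_S1 i (t s : T1) : gsame' i t s = 2 *: theta i (tt (c0 t) (c0 s)).
Proof.
rewrite {1}(T1E t) {1}(T1E s) (gsame'_pure (S1_even k) (S1_odd k) b1 bS gS).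
by rewrite S1_sformE !mulr1.
Qed.

Lemma S2_tri_one al i : S2_tri al i e1 = al i *: u.
Proof.
rewrite S2_tri_app //; apply: S2_eqP; first by [].
by rewrite -[LHS]/(- (al i * 1)) -[RHS]/(al i * -1) mulrN.
Qed.

Lemma S2_tri_u al i : S2_tri al i u = al i *: e1.
Proof.
rewrite S2_tri_app //; apply: S2_eqP; first by [].
by rewrite -[LHS]/(- (al i * -1)) -[RHS]/(al i * 1) mulrN opprK.
Qed.

Lemma c1_gact al i (t : T2) : c1 (gact (S2_tri al i) t) = al i *: cu t.
Proof.
rewrite {1}(T2E t) (linD (gact_linr _)) !gact_pure S2_tri_one S2_tri_u.
rewrite (linD c1_lin) !(linZ (tpure_linl _)) !(linZ c1_lin) c1_one c1_u.
by rewrite scaler0 add0r.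
Qed.

Lemma cu_gact al i (t : T2) : cu (gact (S2_tri al i) t) = al i *: c1 t.
Proof.
rewrite {1}(T2E t) (linD (gact_linr _)) !gact_pure S2_tri_one S2_tri_u.
rewrite (linD cu_lin) !(linZ (tpure_linl _)) !(linZ cu_lin) cu_one cu_u.
by rewrite scaler0 addr0.
Qed.

Let gact'_pure2 := gact'_pure (S2_even k) (S2_odd k) gS.
Let gnext_pure2 := gnext_pure (S2_even k) (S2_odd k) b2 bS gS.

Lemma c1_gact' d (t : T2) : c1 (gact' d t) = d (c1 t).
Proof.
rewrite {1}(T2E t) (linD (gact'_linr _)) !gact'_pure2.
by rewrite (linD c1_lin) c1_one c1_u addr0.
Qed.

Lemma cu_gact' d (t : T2) : cu (gact' d t) = d (cu t).
Proof.
rewrite {1}(T2E t) (linD (gact'_linr _)) !gact'_pure2.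
by rewrite (linD cu_lin) cu_one cu_u add0r.
Qed.

Lemma S2_smul_table :
  [/\ smul e1 e1 = e1, smul e1 u = - u, smul u e1 = - u & smul u u = e1].
Proof.
rewrite !S2_smulE; split; apply: S2_eqP; rewrite /= ?mulr1 ?mul1r ?mulrN1 ?opprK //.
all: by rewrite -[RHS]/(- (-1 : k)) opprK.
Qed.

Lemma gnext_S2 (t s : T2) :
  gnext t s = tpure e1 (smul (c1 t) (c1 s) + smul (cu t) (cu s))
    - tpure u (smul (c1 t) (cu s) + smul (cu t) (c1 s)).
Proof.
rewrite {1}(T2E t) {1}(T2E s) (linD (gnext_linl _)) !(linD (gnext_linr _)).
have [e11 e1u ue1 uu] := S2_smul_table.
rewrite !gnext_pure2 e11 e1u ue1 uu !(linN (tpure_linl _)).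
rewrite !(linD (tpure_linr _)).
set t1 := tpure _ _; set t2 := tpure _ _; set t3 := tpure _ _; set t4 := tpure _ _.
by lincomb k (T2 : lmodType k) [:: t1; t2; t3; t4].
Qed.

Lemma c1_gnext (t s : T2) :
  c1 (gnext t s) = smul (c1 t) (c1 s) + smul (cu t) (cu s).
Proof.
by rewrite gnext_S2 (linB c1_lin) c1_one c1_u subr0.
Qed.

Lemma cu_gnext (t s : T2) :
  cu (gnext t s) = - (smul (c1 t) (cu s) + smul (cu t) (c1 s)).
Proof.
by rewrite gnext_S2 (linB cu_lin) cu_one cu_u sub0r.
Qed.

Lemma c1_half al i d (t r s : T2) :
  c1 (gact (S2_tri al i) t + gact' d t + gnext r s)
  = al i *: cu t + d (c1 t) + (smul (c1 r) (c1 s) + smul (cu r) (cu s)).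
Proof.
by rewrite !(linD c1_lin) (c1_gact al i t) (c1_gact' d t) (c1_gnext r s).
Qed.

Lemma cu_half al i d (t r s : T2) :
  cu (gact (S2_tri al i) t + gact' d t + gnext r s)
  = al i *: c1 t + d (cu t) - (smul (c1 r) (cu s) + smul (cu r) (c1 s)).
Proof.
by rewrite !(linD cu_lin) (cu_gact al i t) (cu_gact' d t) (cu_gnext r s).
Qed.

Lemma theta_S2_tri i al : theta i (S2_tri al) = S2_tri (fun j => al (j - i)).
Proof. by apply/ffunP=> j; rewrite !ffunE. Qed.

Lemma S2_triD al be :
  S2_tri al + S2_tri be = S2_tri (fun i => al i + be i) :> triple A2.
Proof. by apply/ffunP=> i; rewrite !ffunE scalerDl. Qed.

Lemma S2_triZ c al : c *: S2_tri al = S2_tri (fun i => c * al i) :> triple A2.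
Proof. by apply/ffunP=> i; rewrite !ffunE scalerA. Qed.

Lemma eq_S2_tri al be : al =1 be -> S2_tri al = S2_tri be :> triple A2.
Proof. by move=> ab; apply/ffunP=> i; rewrite !ffunE ab. Qed.

(** Only the pairs (1, u) and (u, 1) contribute, through t_(1,u) = - t_(u,1),
    rotated by theta. *)
Lemma gsame_S2 i (t s : T2) :
  gsame i t s = S2_tri (fun j => (sform (c1 t) (cu s) - sform (cu t) (c1 s))
                                 * (if j == i then 2 else -1)).
Proof.
rewrite {1}(T2E t) {1}(T2E s) (linD (gsame_linl _ _)) !(linD (gsame_linr _ _)).
rewrite !(gsame_pure (S2_even k) (S2_odd k) b2 bS gS) !S2_ttE //.
rewrite !theta_S2_tri !S2_triZ !S2_triD; apply: eq_S2_tri => j.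
rewrite subr_eq0 /=; case: eqP => _; field; exact: two_neq0.
Qed.

(** The norm form of S2 takes the values 2 at (1, 1), -2 at (u, u) and 0 at
    (1, u). *)
Lemma gsame'_S2 i (t s : T2) :
  gsame' i t s = 2 *: theta i (tt (c1 t) (c1 s)) - 2 *: theta i (tt (cu t) (cu s)).
Proof.
rewrite {1}(T2E t) {1}(T2E s) (linD (gsame'_linl _ _)) !(linD (gsame'_linr _ _)).
rewrite !(gsame'_pure (S2_even k) (S2_odd k) b2 bS gS) !S2_sformE /=.
set t1 := theta _ _; set t2 := theta _ _; set t3 := theta _ _; set t4 := theta _ _.
by lincomb k (triple S : lmodType k) [:: t1; t2; t3; t4].
Qed.

End Coordinates.

(** * Triality triples *)

Section TriPart.
Variables (k : fieldType) (S : qsuperalg k).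
Hypothesis bS : bilin S.

Lemma tri_part_lin p s (d e : triple S) :
  tri_part p d -> tri_part p e -> tri_part p (s *: d + e).
Proof.
have [ml mr fl fr] := bS.
case=> ospd trid [ospe trie]; split=> [i | q r x y xq yr].
  have [[dp dskew] [ep eskew]] := (ospd i, ospe i).
  rewrite !ffunE; split=> [|q x y xq]; first exact: end_partP.
  rewrite !add_lfunE !scale_lfunE fl fr.
  transitivity (s * (sform (d i x) y + (-1) ^+ (p && q) * sform x (d i y))
                + (sform (e i x) y + (-1) ^+ (p && q) * sform x (e i y))).
    by ring.
  by rewrite (dskew _ _ _ xq) (eskew _ _ _ xq) mulr0 addr0.
rewrite !ffunE !add_lfunE !scale_lfunE (trid _ _ _ _ xq yr) (trie _ _ _ _ xq yr).
rewrite ml mr; set t1 := smul _ _; set t2 := smul _ _; set t3 := smul _ _.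
set t4 := smul _ _.
lincomb k (S : lmodType k) [:: t1; t2; t3; t4].
Qed.

Lemma tri_part0 p : tri_part p (0 : triple S).
Proof.
have [ml mr fl fr] := bS; split=> [i | q r x y _ _]; rewrite !ffunE.
  split=> [|q x y _]; first exact: end_part0.
  by rewrite !zero_lfunE (scal0 (fl _)) (scal0 (fr _)) mulr0 addr0.
by rewrite !zero_lfunE (lin0 (ml _)) (lin0 (mr _)) scaler0 addr0.
Qed.

Lemma tri_partD p (d e : triple S) :
  tri_part p d -> tri_part p e -> tri_part p (d + e).
Proof. by rewrite -[d in d + e]scale1r; apply: tri_part_lin. Qed.

Lemma tri_partZ p s (d : triple S) : tri_part p d -> tri_part p (s *: d).
Proof. by rewrite -[s *: d]addr0 => /tri_part_lin; apply; apply: tri_part0. Qed.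

Lemma tri_part_sum p (I : Type) (r : seq I) (F : I -> triple S) :
  (forall i, tri_part p (F i)) -> tri_part p (\sum_(i <- r) F i).
Proof.
move=> Fp; elim: r => [|i r IHr]; first by rewrite big_nil; apply: tri_part0.
by rewrite big_cons; apply: tri_partD.
Qed.

Lemma tri_part_tri p (d : triple S) : tri_part p d -> tri d.
Proof.
case: p => dp; first by exists 0, d; rewrite add0r; split=> //; apply: tri_part0.
by exists d, 0; rewrite addr0; split=> //; apply: tri_part0.
Qed.

End TriPart.

(** * Brackets in coordinates *)

Section BracketCoordinates.
Variables (k : fieldType) (S : qsuperalg k).
Hypotheses (two_neq0 : 2 != 0 :> k) (bS : bilin S) (gS : graded S).
Local Notation A1 := (S1 k).
Local Notation A2 := (S2 k).
Local Notation u1 := (S1_one k).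
Local Notation e1 := (S2_one k).
Local Notation u := (S2_u k).
Local Notation T1 := (stensor A1 S).
Local Notation T2 := (stensor A2 S).
Implicit Types (d e : triple S) (a b : 'I_3 -> S) (p q : bool) (al be : 'I_3 -> k).

(** The element [d + \sum_i iota_i (1 (x) a i)]; these are all the homogeneous
    elements, as tri(S1) = 0. *)
Definition g1 d a : gcar A1 S := (0, d, [ffun j => tpure u1 (a j) : T1]).

(** The element [al sigma + d + \sum_i iota_i (1 (x) a i + u (x) b i)]. *)
Definition g2 al d a b : gcar A2 S :=
  (S2_tri al, d, [ffun j => tpure e1 (a j) + tpure u (b j) : T2]).

Lemma eq_g1 d e a b : d = e -> a =1 b -> g1 d a = g1 e b.
Proof.
by move=> -> ab; congr (_, _, _); apply/ffunP=> j; rewrite !ffunE ab.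
Qed.

Lemma g1_lin s d e a b :
  s *: g1 d a + g1 e b = g1 (s *: d + e) (fun j => s *: a j + b j).
Proof.
rewrite [LHS]pair3_lin; congr (_, _, _); first by rewrite scaler0 addr0.
by apply/ffunP=> j; rewrite !ffunE tpure_linr.
Qed.

Lemma g1_partP p d a :
  gpart p (g1 d a) <-> tri_part p d /\ (forall i, a i \in spart S p).
Proof.
split=> [[_ dp ap] | [dp ap]].
  split=> // i; have := ap i; rewrite ffunE => /(T1_partP _ _).
  by rewrite c0_one.
split=> // [|i]; first exact: tri_part0 (S1_bilin k) p.
by rewrite ffunE; apply/T1_partP; rewrite c0_one.
Qed.

Lemma g1_coord p (x : gcar A1 S) : gpart p x -> x = g1 x.1.2 (fun i => c0 (x.2 i)).
Proof.
case: x => [[s d] t] [/= sp dp tp]; rewrite (S1_tri0 two_neq0 sp).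
by congr (_, _, _); apply/ffunP=> j; rewrite ffunE -T1E.
Qed.

Lemma g2_partP p al d a b :
  gpart p (g2 al d a b) <->
  [/\ p -> forall i, al i = 0, al 0 + al 1 + al 2 = 0, tri_part p d,
      forall i, a i \in spart S p & forall i, b i \in spart S p].
Proof.
split=> [[/= alp dp tp] | [alp al0 dp ap bp]].
  have tpP i := (T2_partP two_neq0 p _).1 (tp i).
  have al_odd : tri_part true (S2_tri al) -> forall i, al i = 0.
    move=> /(even_tri_odd (S2_even k) (S2_odd k)) al0 i.
    by rewrite -(S2_triK two_neq0 al i) al0 /S2_al ffunE zero_lfunE.
  split=> // [pT i | |i|i].
  - by rewrite pT in alp; apply: al_odd.
  - case: p alp {dp tp tpP} => alp; last exact/(S2_tri_part two_neq0).
    by rewrite !al_odd // !addr0.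
  - by have [] := tpP i; rewrite ffunE (linD (@c1_lin _ _)) c1_one // c1_u addr0.
  by have [_] := tpP i; rewrite ffunE (linD (@cu_lin _ _)) cu_one cu_u // add0r.
split=> //= [|i].
  case: p alp {dp ap bp} => alp; last exact/(S2_tri_part two_neq0).
  suff -> : S2_tri al = 0 by apply: tri_part0 (S2_bilin k) _.
  by apply/ffunP=> i; rewrite !ffunE alp // scale0r.
rewrite ffunE; apply/(T2_partP two_neq0).
rewrite (linD (@c1_lin _ _)) (linD (@cu_lin _ _)) c1_one // c1_u cu_one cu_u //.
by rewrite addr0 add0r.
Qed.

Lemma g2_coord p (x : gcar A2 S) : gpart p x ->
  x = g2 (S2_al x.1.1) x.1.2 (fun i => c1 (x.2 i)) (fun i => cu (x.2 i)).
Proof.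
case: x => [[s d] t] [/= sp dp tp].
congr (_, _, _); last by apply/ffunP=> j; rewrite ffunE -T2E.
case: p sp {dp tp} => sp; last exact: S2_triE.
rewrite (even_tri_odd (S2_even k) (S2_odd k) sp).
by apply/ffunP=> i; rewrite !ffunE /S2_al ffunE zero_lfunE scale0r.
Qed.

#[local] Opaque gact gact' gnext gsame gsame' c0 c1 cu.

Definition tri_comm p q d e : triple S :=
  [ffun i => (d i \o e i)%VF - (-1) ^+ (p && q) *: (e i \o d i)%VF].

Lemma gbr_g1 p q d e a b : gpart p (g1 d a) -> gpart q (g1 e b) ->
  gbr (g1 d a) (g1 e b) =
  g1 (tri_comm p q d e + \sum_i 2 *: theta i (tt (a i) (b i)))
     (fun j => d j (b j) - (-1) ^+ (p && q) *: e j (a j)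
               + (smul (a (j + 1)) (b (j + 2))
                  - (-1) ^+ (p && q) *: smul (b (j + 1)) (a (j + 2)))).
Proof.
move=> xp yq.
rewrite (gbr_hom (S1_even k) (S1_odd k) gS (T1_disjoint gS) xp yq).
set ta := [ffun j => tpure u1 (a j) : T1]; set tb := [ffun j => tpure u1 (b j) : T1].
have aE i : c0 (ta i) = a i by rewrite ffunE c0_one.
have bE i : c0 (tb i) = b i by rewrite ffunE c0_one.
rewrite /g1 /= -/ta -/tb; clearbody ta tb; congr (_, _, _).
- rewrite /= big1 ?addr0 => [|i _]; last exact: gsame_S1.
  by apply/ffunP=> i; rewrite !ffunE comp_lfun0l scaler0 subr0.
- rewrite /=; congr (_ + _); first by apply/ffunP=> i; rewrite !ffunE.
  by apply: eq_bigr => i _; rewrite gsame'_S1 // aE bE.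
apply/ffunP=> j; apply: (@c0_inj _ _); rewrite [in RHS]ffunE c0_one.
rewrite /= addr0 !ffunE /= !(lin0 (gact_linl _)) !add0r.
rewrite (linB (@c0_lin _ _)) (linZ (@c0_lin _ _)) !(linD (@c0_lin _ _)).
rewrite !c0_gact' // !c0_gnext // !aE !bE.
set t1 := smul _ _; set t2 := smul _ _; set t3 := d _ _; set t4 := e _ _.
lincomb k (S : lmodType k) [:: t1; t2; t3; t4].
Qed.

Lemma gbr_g2 p q al d a b al' d' a' b' :
    gpart p (g2 al d a b) -> gpart q (g2 al' d' a' b') ->
  gbr (g2 al d a b) (g2 al' d' a' b') =
  g2 (fun j => \sum_i (sform (a i) (b' i) - sform (b i) (a' i))
                      * (if j == i then 2 else -1))
     (tri_comm p q d d' + \sum_i (2 *: theta i (tt (a i) (a' i))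
                                  - 2 *: theta i (tt (b i) (b' i))))
     (fun j => al j *: b' j - al' j *: b j
               + (d j (a' j) - (-1) ^+ (p && q) *: d' j (a j))
               + (smul (a (j + 1)) (a' (j + 2))
                  - (-1) ^+ (p && q) *: smul (a' (j + 1)) (a (j + 2)))
               + (smul (b (j + 1)) (b' (j + 2))
                  - (-1) ^+ (p && q) *: smul (b' (j + 1)) (b (j + 2))))
     (fun j => al j *: a' j - al' j *: a j
               + (d j (b' j) - (-1) ^+ (p && q) *: d' j (b j))
               - (smul (a (j + 1)) (b' (j + 2))
                  - (-1) ^+ (p && q) *: smul (b' (j + 1)) (a (j + 2)))
               - (smul (b (j + 1)) (a' (j + 2))
                  - (-1) ^+ (p && q) *: smul (a' (j + 1)) (b (j + 2)))).
Proof.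
move=> xp yq; have [alp _ _ _ _] := (g2_partP p al d a b).1 xp.
have [alq _ _ _ _] := (g2_partP q al' d' a' b').1 yq.
have sal i : (-1) ^+ (p && q) * al i = al i.
  by case: p alp {xp} => [alp|_]; rewrite ?alp ?mulr0 // mul1r.
have sal' i : (-1) ^+ (p && q) * al' i = al' i.
  by case: q alq {yq sal} => [alq|_]; rewrite ?alq ?mulr0 // andbF mul1r.
rewrite (gbr_hom (S2_even k) (S2_odd k) gS (T2_disjoint two_neq0 gS) xp yq).
set ta := [ffun j => tpure e1 (a j) + tpure u (b j) : T2].
set tb := [ffun j => tpure e1 (a' j) + tpure u (b' j) : T2].
have a1E i : c1 (ta i) = a i.
  by rewrite ffunE (linD (@c1_lin _ _)) c1_one // c1_u addr0.
have auE i : cu (ta i) = b i.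
  by rewrite ffunE (linD (@cu_lin _ _)) cu_one cu_u // add0r.
have b1E i : c1 (tb i) = a' i.
  by rewrite ffunE (linD (@c1_lin _ _)) c1_one // c1_u addr0.
have buE i : cu (tb i) = b' i.
  by rewrite ffunE (linD (@cu_lin _ _)) cu_one cu_u // add0r.
rewrite /g2 /= -/ta -/tb; clearbody ta tb; congr (_, _, _).
- rewrite /=.
  have -> : [ffun i => (S2_tri al i \o S2_tri al' i)%VF]
      - (-1) ^+ (p && q) *: [ffun i => (S2_tri al' i \o S2_tri al i)%VF] = 0.
    apply/ffunP=> i; rewrite [LHS]ffunE [X in X + _]ffunE [X in _ + X]ffunE.
    rewrite [X in - X]ffunE [X in _ *: X]ffunE [RHS]ffunE.
    apply/lfunP=> x; rewrite add_lfunE opp_lfunE scale_lfunE !comp_lfunE zero_lfunE.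
    have swap t : (-1) ^+ (p && q) * (al' i * (al i * t)) = al i * (al' i * t).
      by rewrite -[in RHS]sal; ring.
    rewrite !(S2_tri_app two_neq0); apply: S2_eqP.
      rewrite -[LHS]/(al i * (al' i * x.1)
                      - (-1) ^+ (p && q) * (al' i * (al i * x.1))).
      by rewrite swap subrr.
    rewrite -[LHS]/(- (al i * - (al' i * x.2))
                    - (-1) ^+ (p && q) * - (al' i * - (al i * x.2))).
    by rewrite !mulrN !opprK swap subrr.
  rewrite add0r (eq_bigr _ (fun i _ => gsame_S2 two_neq0 bS gS i (ta i) (tb i))).
  transitivity (S2_tri (fun j => \sum_i (sform (c1 (ta i)) (cu (tb i))
      - sform (cu (ta i)) (c1 (tb i))) * (if j == i then 2 else -1))).
    by apply/ffunP=> j; rewrite sum_ffunE ffunE scaler_suml;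
      apply: eq_bigr => i _; rewrite ffunE.
  by apply: eq_S2_tri => j; apply: eq_bigr => i _; rewrite a1E buE auE b1E.
- rewrite /=; congr (_ + _); first by apply/ffunP=> i; rewrite !ffunE.
  by apply: eq_bigr => i _; rewrite (gsame'_S2 two_neq0 bS gS) a1E b1E auE buE.
apply/ffunP=> j; rewrite [RHS]ffunE /= addr0 [LHS]ffunE.
rewrite [X in _ + X]ffunE [X in - X]ffunE [X in _ *: X]ffunE [X in X - _]ffunE.
rewrite [LHS](T2E two_neq0).
rewrite (linB (@c1_lin _ _)) (linZ (@c1_lin _ _)).
rewrite (linB (@cu_lin _ _)) (linZ (@cu_lin _ _)).
rewrite !(c1_half two_neq0 bS gS) !(cu_half two_neq0 bS gS).
rewrite !(a1E, auE, b1E, buE) -[in RHS](sal' j).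
set t1 := smul _ _; set t2 := smul _ _; set t3 := smul _ _; set t4 := smul _ _.
set t5 := smul _ _; set t6 := smul _ _; set t7 := smul _ _; set t8 := smul _ _.
set t9 := d _ _; set t10 := d' _ _; set t11 := d _ _; set t12 := d' _ _.
set v1 := b' j; set v2 := b j; set w1 := a' j; set w2 := a j.
congr (tpure _ _ + tpure _ _);
lincomb k (S : lmodType k)
  [:: t1; t2; t3; t4; t5; t6; t7; t8; t9; t10; t11; t12; v1; v2; w1; w2].
Qed.


End BracketCoordinates.

Lemma sum_I3_shift1 (V : nmodType) (F : 'I_3 -> V) : \sum_i F i = \sum_i F (i + 1).
Proof. by rewrite (reindex_inj (@addIr _ 1)). Qed.

Lemma sum_I3_shift2 (V : nmodType) (F : 'I_3 -> V) : \sum_i F i = \sum_i F (i + 2).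
Proof. by rewrite (reindex_inj (@addIr _ 2)). Qed.

(** * The isomorphism from g(S1, S) to der J *)

Section Isomorphism.
Variables (k : fieldType) (C : qsuperalg k) (one : C).
Hypotheses (two_neq0 : 2 != 0 :> k) (hC : hurwitz one).
Local Notation S := (para one).
Local Notation A1 := (S1 k).
Local Notation A2 := (S2 k).
Local Notation u1 := (S1_one k).
Local Notation J := (J one).
Local Notation g1 := (@g1 k S).
Variable Phi : {linear lcar (gSS A1 S) -> lcar (derJ one)}.
Hypothesis Phi_iso : lie_iso Phi.
Hypothesis Phi_tri : forall d : triple S, tri d -> Phi (gtri' A1 d) = jDtri d.
Hypothesis Phi_iota : forall (i : 'I_3) (a : C),
  Phi (giota i (tpure u1 a : stensor A1 S)) = jD one i a.
Implicit Types (d e : triple S) (a b : 'I_3 -> C) (c : 'I_3 -> k).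
Implicit Types (p q : bool) (i j : 'I_3) (x y : C) (u v : J).

Lemma para_bilin : bilin S.
Proof.
split; [exact: (para_smul_linl hC) | exact: (para_smul_linr hC)
       | exact: (hurwitz_sform_linl hC) | exact: (hurwitz_sform_linr hC)].
Qed.

Let bS := para_bilin.
Let gS : graded S := hurwitz_graded hC.
Let gJ : graded J := J_graded two_neq0 hC.

Lemma gtri'_lin : linear (fun d : triple S => gtri' A1 d : gcar A1 S).
Proof. by move=> s d e; rewrite [RHS]pair3_lin !scaler0 !addr0. Qed.

Lemma g1_sumE d a :
  g1 d a = gtri' A1 d + \sum_i giota i (tpure u1 (a i) : stensor A1 S).
Proof.
pose tens (z : {ffun 'I_3 -> stensor A1 S}) : gcar A1 S := (0, 0, z).
have tens_lin : linear tens by move=> s z z'; rewrite [RHS]pair3_lin !scaler0 !addr0.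
rewrite -[\sum_i _]/(\sum_i tens
   [ffun j => if j == i then tpure u1 (a i) : stensor A1 S else 0]).
rewrite -(lin_sum tens_lin) -[gtri' _ _]scale1r [RHS]pair3_lin.
rewrite !scaler0 !addr0 scale1r add0r.
congr (_, _, _); apply/ffunP=> j; rewrite sum_ffunE ffunE (bigD1 j) //=.
by rewrite ffunE eqxx big1 ?addr0 // => i /negPf; rewrite ffunE eq_sym => ->.
Qed.

Lemma Phi_g1 p d a : tri_part p d ->
  Phi (g1 d a) = jDtri d + \sum_i jD one i (a i).
Proof.
move=> dp; rewrite g1_sumE linearD linear_sum (Phi_tri (tri_part_tri bS dp)).
by congr (_ + _); apply: eq_bigr => i _.
Qed.

Let part1 p d a : tri_part p d -> (forall i, a i \in spart C p) -> gpart p (g1 d a).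
Proof. by move=> dp ap; apply/g1_partP. Qed.

Lemma gpart_lmem p (x : gcar A1 S) : gpart p x -> lmem (x : lcar (gSS A1 S)).
Proof.
have part0 q : gpart q (0 : gcar A1 S).
  by split=> [||i]; [exact: tri_part0 (S1_bilin k) q | exact: tri_part0
                    | rewrite ffunE mem0v].
case: p => xp; first by exists 0, x; rewrite add0r; split=> //; apply: (part0 false).
by exists x, 0; rewrite addr0; split=> //; apply: (part0 true).
Qed.

Lemma Phi_part p (x : gcar A1 S) : gpart p x -> der_part p (Phi x).
Proof. by have [_ [H _ _ _]] := Phi_iso; apply: H. Qed.

Lemma Phi_gbr p q (x y : gcar A1 S) : gpart p x -> gpart q y ->
  Phi (gbr x y) = scomm (Phi x) (Phi y).
Proof.
move=> xp yq; have [_ [_ _ _ H]] := Phi_iso.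
exact: H (gpart_lmem xp) (gpart_lmem yq).
Qed.

Lemma gbr1_part p q (x y : gcar A1 S) :
  gpart p x -> gpart q y -> gpart (p (+) q) (gbr x y).
Proof. by have [[[_ [[H _ _] _]] _] _] := Phi_iso; apply: H. Qed.

Lemma iota_part p i x : x \in spart C p -> gpart p (g1 0 (jdelta i x)).
Proof.
move=> xp; apply: part1; first exact: tri_part0.
by move=> l; apply: jdelta_part.
Qed.

Lemma jD_g1 i x : jD one i x = Phi (g1 0 (jdelta i x)).
Proof.
rewrite (@Phi_g1 false); last exact: tri_part0.
rewrite -(Phi_tri (d := 0)); last exact: (tri_part_tri bS (tri_part0 bS false)).
rewrite (lin0 gtri'_lin) linear0 add0r (bigD1 i) //= /jdelta eqxx big1 ?addr0 //.
by move=> j /negPf->; rewrite (lin0 (jD_lin hC j)).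
Qed.

(** The operators [D_i x] are values of the isomorphism onto der J. *)
Lemma jD_der p i x : x \in spart C p -> der_part p (jD one i x).
Proof.
by move=> xp; rewrite jD_g1; apply/Phi_part/iota_part.
Qed.

Lemma tri_comm0 p q : tri_comm p q (0 : triple S) 0 = 0.
Proof. by apply/ffunP=> i; rewrite !ffunE comp_lfun0l scaler0 subr0. Qed.

Let mul0l (x : S) : smul 0 x = 0 := lin0 (para_smul_linl hC x).
Let mul0r (x : S) : smul x 0 = 0 := lin0 (para_smul_linr hC x).

Lemma tt0l i (x : S) : theta i (tt 0 x) = 0.
Proof. by rewrite (lin0 (tt_linl bS x)) (lin0 (theta_lin i)). Qed.

Lemma gbr_iota p q i j x y : x \in spart C p -> y \in spart C q ->
  gbr (g1 0 (jdelta i x) : gcar A1 S) (g1 0 (jdelta j y)) =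
  g1 (if i == j then 2 *: theta i (tt (x : S) y) else 0)
     (fun l => (smul (jdelta i x (l + 1) : S) (jdelta j y (l + 2))
                - (-1) ^+ (p && q) *:
                  smul (jdelta j y (l + 1) : S) (jdelta i x (l + 2)))).
Proof.
move=> xp yq; rewrite (@gbr_g1 _ _ two_neq0 bS gS p q).
- rewrite tri_comm0 add0r; apply: eq_g1 => [|l].
    rewrite (bigD1 i) //= /jdelta eqxx big1 ?addr0 => [|l /negPf li].
      case: eqP => // _; rewrite (lin0 (tt_linr bS x)) (lin0 (theta_lin i)).
      by rewrite scaler0.
    by rewrite li tt0l scaler0.
  by rewrite !ffunE !zero_lfunE scaler0 subr0 add0r.
- exact: iota_part.
exact: iota_part.
Qed.

(** The bracket of iota_i(1 (x) x) and iota_i(1 (x) y) is 2 theta^i(t_(x,y)),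
    and g(S1, S) is closed under brackets. *)
Lemma tt_part p q i (x y : S) : x \in spart C p -> y \in spart C q ->
  tri_part (p (+) q) (theta i (tt x y)).
Proof.
move=> xp yq; have := gbr1_part (iota_part i xp) (iota_part i yq).
rewrite (gbr_iota _ _ xp yq) eqxx => /g1_partP[tp _].
have := tri_partZ bS 2^-1 tp.
by rewrite scalerA mulVf // scale1r.
Qed.

Lemma g1_tri d : g1 d (fun=> 0) = gtri' A1 d :> gcar A1 S.
Proof.
rewrite g1_sumE big1 ?addr0 // => i _; rewrite (lin0 (tpure_linr _)).
by congr (_, _, _); apply/ffunP=> j; rewrite !ffunE if_same.
Qed.

Lemma scomm_iota_same p q i x y : x \in spart C p -> y \in spart C q ->
  scomm (jL (jiota one i x)) (jL (jiota one i y))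
  = - Phi (gtri' A1 (2 *: theta i (tt (x : S) y))).
Proof.
move=> xp yq; rewrite (scomm_jL_same two_neq0 hC jD_der _ xp yq).
rewrite !jD_g1 -(Phi_gbr (iota_part i xp) (iota_part i yq)) (gbr_iota _ _ xp yq).
rewrite eqxx; congr (- Phi _); rewrite -[RHS]g1_tri; apply: eq_g1 => // j.
rewrite /jdelta; case: (I3_cases i j) => ->.
all: by rewrite !I3E ?mul0l ?mul0r scaler0 subr0.
Qed.

Lemma scomm_iota_next p q i x y : x \in spart C p -> y \in spart C q ->
  scomm (jL (jiota one i x)) (jL (jiota one (i + 1) y))
  = jD one (i + 2) (smul (x : S) y).
Proof.
move=> xp yq; rewrite (scomm_jL_next two_neq0 hC jD_der _ xp yq).
rewrite !jD_g1 -(Phi_gbr (iota_part i xp) (iota_part (i + 1) yq)).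
rewrite (gbr_iota _ _ xp yq) I3E; congr (Phi _); apply: eq_g1 => // j.
rewrite /jdelta; case: (I3_cases i j) => ->.
all: by rewrite !I3E ?mul0l ?mul0r ?scaler0 ?subr0.
Qed.

(** The preimage under [Phi] of the commutator of the multiplications by
    [jel c a] and [jel c' b]; [s] is the sign of that commutator. It is the
    part of a bracket of g(S2, S) to which both elements contribute through
    tri(S2) or through tensors u (x) b. *)
Definition psi (s : k) c a c' b : gcar A1 S :=
  g1 (- \sum_i 2 *: theta i (tt (a i : S) (b i)))
     (fun j => (2^-1 * (c' (j + 1) - c' (j + 2))) *: a j
               - (2^-1 * (c (j + 1) - c (j + 2))) *: b j
               + (smul (a (j + 1) : S) (b (j + 2))
                  - s *: smul (b (j + 1) : S) (a (j + 2)))).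

Lemma psi_part p q c a c' b : jpart p c a -> jpart q c' b ->
  gpart (p (+) q) (psi ((-1) ^+ (p && q)) c a c' b).
Proof.
move=> [c0 ap] [d0 bq]; apply: part1.
  rewrite -scaleN1r; apply: (tri_partZ bS); apply: (tri_part_sum bS) => i.
  by apply: (tri_partZ bS); apply: tt_part.
move=> j; rewrite rpredD //; last first.
  rewrite rpredB ?rpredZ //; first exact: (para_smul_part hC (ap _) (bq _)).
  by rewrite addbC; apply: (para_smul_part hC (bq _) (ap _)).
rewrite rpredB //.
  case: q d0 bq => d0 _; first by rewrite !d0 // subrr mulr0 scale0r mem0v.
  by rewrite addbF; apply: memvZ.
case: p c0 ap => c0 _; first by rewrite !c0 // subrr mulr0 scale0r mem0v.
by rewrite addFb; apply: memvZ.
Qed.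

Lemma jel_diag_iota c a :
  jel one c a = jel one c (fun=> 0) + \sum_i jiota one i (a i).
Proof.
have -> : \sum_i jiota one i (a i) = jel one (fun=> 0) a.
  by rewrite (jel_sumE hC); apply: eq_bigr => i _; rewrite scale0r add0r.
by rewrite (jelD hC); apply: (jel_ext hC) => i; rewrite ?addr0 ?add0r.
Qed.

(** Expanding both elements into diagonal and off-diagonal parts leaves the
    commutators of [scomm_diag_jD], [scomm_iota_same] and [scomm_iota_next]. *)
Lemma psi_Phi p q c a c' b : jpart p c a -> jpart q c' b ->
  Phi (psi ((-1) ^+ (p && q)) c a c' b)
  = scomm (jL (jel one c a)) (jL (jel one c' b)).
Proof.
move=> [c0 ap] [d0 bq]; set s := (-1) ^+ _.
pose L : J -> 'End(J) := @jL k C one.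
have Ll : linear L := jL_lin hC.
pose br : 'End(J) -> 'End(J) -> 'End(J) := @scomm k J.
have brl (f : 'End(J)) : linear (br^~ f) by exact: scomm_linl.
have brr (f : 'End(J)) : linear (br f) by exact: scomm_linr.
have EX j : br (L (jel one c (fun=> 0))) (L (jiota one j (b j)))
    = - ((2^-1 * (c (j + 1) - c (j + 2))) *: jD one j (b j)).
  rewrite /br (scomm_anti gJ (jL_part hC (jdiag_part hC c))
             (jL_part hC (jiota_part hC j (bq j)))).
  by rewrite expr0 scale1r (scomm_diag_jD two_neq0 hC _ _ (bq j)).
have EY i : br (L (jiota one i (a i))) (L (jel one c' (fun=> 0)))
    = (2^-1 * (c' (i + 1) - c' (i + 2))) *: jD one i (a i).
  exact: (scomm_diag_jD two_neq0 hC _ _ (ap i)).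
have EAB i : br (L (jiota one i (a i))) (\sum_j L (jiota one j (b j)))
    = - Phi (gtri' A1 (2 *: theta i (tt (a i : S) (b i))))
      + jD one (i + 2) (smul (a i : S) (b (i + 1)))
      - s *: jD one (i + 1) (smul (b (i + 2) : S) (a i)).
  rewrite (sum_I3 _ i) !(linD (brr _)); congr (_ + _ + _).
  - exact: scomm_iota_same (ap i) (bq i).
  - exact: scomm_iota_next (ap i) (bq (i + 1)).
  rewrite /br (scomm_anti gJ (jL_part hC (jiota_part hC i (ap i)))
             (jL_part hC (jiota_part hC (i + 2) (bq (i + 2))))).
  have := scomm_iota_next (i + 2) (bq (i + 2)) (ap i).
  by rewrite !I3E => ->.
have brE : br (L (jel one c a)) (L (jel one c' b)) =
  \sum_j br (L (jel one c (fun=> 0))) (L (jiota one j (b j)))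
  + \sum_i br (L (jiota one i (a i))) (L (jel one c' (fun=> 0)))
  + \sum_i br (L (jiota one i (a i))) (\sum_j L (jiota one j (b j))).
  rewrite {1}(jel_diag_iota c a) {1}(jel_diag_iota c' b).
  rewrite !(linD Ll) !(lin_sum Ll) (linD (brl _)) !(linD (brr _)).
  rewrite [br (L (jel _ _ _)) (L (jel _ _ _))](scomm_jL_diag two_neq0 hC) add0r.
  by rewrite (lin_sum (brr _)) !(lin_sum (brl _)) addrA.
rewrite -[RHS]/(br (L (jel one c a)) (L (jel one c' b))) {}brE.
pose G i := Phi (gtri' A1 (2 *: theta i (tt (a i : S) (b i)))).
have SAB : \sum_i br (L (jiota one i (a i))) (\sum_j L (jiota one j (b j)))
  = \sum_i - G i + \sum_i jD one i (smul (a (i + 1) : S) (b (i + 2)))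
    + \sum_i - (s *: jD one i (smul (b (i + 1) : S) (a (i + 2)))).
  transitivity (\sum_i - G i + \sum_i jD one (i + 2) (smul (a i : S) (b (i + 1)))
     + \sum_i - (s *: jD one (i + 1) (smul (b (i + 2) : S) (a i)))).
    by rewrite -!big_split /=; apply: eq_bigr => i _; rewrite EAB.
  have h1 : \sum_i jD one (i + 2) (smul (a i : S) (b (i + 1)))
      = \sum_i jD one i (smul (a (i + 1) : S) (b (i + 2))).
    by rewrite [LHS]sum_I3_shift1; apply: eq_bigr => i _; rewrite !I3E.
  have h2 : \sum_i - (s *: jD one (i + 1) (smul (b (i + 2) : S) (a i)))
      = \sum_i - (s *: jD one i (smul (b (i + 1) : S) (a (i + 2)))).
    by rewrite [LHS]sum_I3_shift2; apply: eq_bigr => i _; rewrite !I3E.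
  exact: (congr2 (fun x y : 'End(J) => \sum_i - G i + x + y) h1 h2).
transitivity (\sum_j - ((2^-1 * (c (j + 1) - c (j + 2))) *: jD one j (b j))
  + \sum_i (2^-1 * (c' (i + 1) - c' (i + 2))) *: jD one i (a i)
  + (\sum_i - G i + \sum_i jD one i (smul (a (i + 1) : S) (b (i + 2)))
    + \sum_i - (s *: jD one i (smul (b (i + 1) : S) (a (i + 2)))))); last first.
  have h1 : \sum_j br (L (jel one c (fun=> 0))) (L (jiota one j (b j)))
      = \sum_j - ((2^-1 * (c (j + 1) - c (j + 2))) *: jD one j (b j)).
    by apply: eq_bigr => j _; apply: EX.
  have h2 : \sum_i br (L (jiota one i (a i))) (L (jel one c' (fun=> 0)))
      = \sum_i (2^-1 * (c' (i + 1) - c' (i + 2))) *: jD one i (a i).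
    by apply: eq_bigr => i _; apply: EY.
  exact: esym (f_equal3 (fun x y z : 'End(J) => x + y + z) h1 h2 SAB).
have Pl : linear Phi by exact: linearP.
rewrite /psi g1_sumE (linD Pl) (linN gtri'_lin) (lin_sum gtri'_lin).
rewrite (linN Pl) !(lin_sum Pl) -sumrN.
have h : \sum_i Phi (giota i (tpure u1
    ((2^-1 * (c' (i + 1) - c' (i + 2))) *: a i
     - (2^-1 * (c (i + 1) - c (i + 2))) *: b i
     + (smul (a (i + 1) : S) (b (i + 2)) - s *: smul (b (i + 1) : S) (a (i + 2))))
       : stensor A1 S))
  = \sum_i - ((2^-1 * (c (i + 1) - c (i + 2))) *: jD one i (b i))
    + \sum_i (2^-1 * (c' (i + 1) - c' (i + 2))) *: jD one i (a i)
    + (\sum_i jD one i (smul (a (i + 1) : S) (b (i + 2)))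
       + \sum_i - (s *: jD one i (smul (b (i + 1) : S) (a (i + 2))))).
  rewrite -[X in _ = X + _]big_split -[X in _ = _ + X]big_split -big_split.
  apply: eq_bigr => j _ /=; rewrite Phi_iota.
  have Dl := jD_lin hC j; rewrite (linD Dl) !(linB Dl) !(linZ Dl).
  set t1 := jD _ _ _; set t2 := jD _ _ _; set t3 := jD _ _ _; set t4 := jD _ _ _.
  by lincomb k ('End(J) : lmodType k) [:: t1; t2; t3; t4].
apply: etrans (f_equal2 +%R (erefl _) h) _.
have shuffle (V : zmodType) (g s1 s2 t1 t2 : V) :
  g + (s1 + s2 + (t1 + t2)) = s1 + s2 + (g + t1 + t2).
  by rewrite addrCA -!addrA.
exact: shuffle.
Qed.

End Isomorphism.

(** * The projective general linear bracket *)

Section PGL.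
Variables (k : fieldType) (C : qsuperalg k) (one : C).
Hypothesis gJ : graded (J one).
Local Notation J := (J one).
Implicit Types X Y Z : 'End(J).

Lemma coset_eq X Y : (coset (kI one) X = coset (kI one) Y) <->
  exists c, X = Y + c *: \1%VF.
Proof.
split=> [/cosetP/vlineP[c XY] | [c ->]].
  by exists c; rewrite -XY addrC subrK.
by apply/cosetP; rewrite addrC addrA addNr add0r; apply/vlineP; exists c.
Qed.

Lemma pgl_br_coset X Y :
  pgl_br (coset (kI one) X) (coset (kI one) Y) = coset (kI one) (scomm X Y).
Proof.
have creprE Z : exists c, crepr (coset (kI one) Z) = Z + c *: \1%VF.
  by apply/coset_eq; rewrite creprK.
have [[c cX] [d dY]] := (creprE X, creprE Y).
rewrite /pgl_br cX dY (linD (scomm_linl _)) !(linD (scomm_linr _)).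
rewrite !(linZ (scomm_linl _)) !(linZ (scomm_linr _)).
by rewrite !(scomm_idl gJ) !(scomm_idr gJ) !scaler0 !addr0.
Qed.

Lemma pgl_br_linl (Z : pgl one) : linear (fun U : pgl one => pgl_br U Z).
Proof.
move=> a X Y; rewrite -[X]creprK -[Y]creprK -[Z]creprK -linearP !pgl_br_coset.
by rewrite scomm_linl linearP.
Qed.

Lemma pgl_br_linr (Z : pgl one) : linear (pgl_br Z).
Proof.
move=> a X Y; rewrite -[X]creprK -[Y]creprK -[Z]creprK -linearP !pgl_br_coset.
by rewrite scomm_linr linearP.
Qed.

End PGL.

(** * The extension to g(S2, S) *)

Section Extension.
Variables (k : fieldType) (C : qsuperalg k) (one : C).
Hypotheses (two_neq0 : 2 != 0 :> k) (hC : hurwitz one).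
Local Notation S := (para one).
Local Notation A1 := (S1 k).
Local Notation A2 := (S2 k).
Local Notation u1 := (S1_one k).
Local Notation J := (J one).
Local Notation g1 := (@g1 k S).
Local Notation g2 := (@g2 k S).
Variable Phi : {linear lcar (gSS A1 S) -> lcar (derJ one)}.
Hypothesis Phi_iso : lie_iso Phi.
Hypothesis Phi_tri : forall d : triple S, tri d -> Phi (gtri' A1 d) = jDtri d.
Hypothesis Phi_iota : forall (i : 'I_3) (a : C),
  Phi (giota i (tpure u1 a : stensor A1 S)) = jD one i a.
Implicit Types (d : triple S) (a b : 'I_3 -> C) (c al : 'I_3 -> k).
Implicit Types (p q : bool) (i j : 'I_3).

Let bS : bilin S := para_bilin hC.
Let gS : graded S := hurwitz_graded hC.
Let gJ : graded J := J_graded two_neq0 hC.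

(** The diagonal of the element of J attached to an element of tri(S2). Adding a
    constant does not change the operator modulo the identity; here the entry
    of index 0 is made 0. *)
Definition wdiag al j : k :=
  if j == 1 then 2 * al 2 else if j == 2 then - (2 * al 1) else 0.

(** Through this difference alone does the diagonal enter the commutators with
    off-diagonal elements. *)
Lemma wdiagE al j : al 0 + al 1 + al 2 = 0 ->
  2^-1 * (wdiag al (j + 1) - wdiag al (j + 2)) = - al j.
Proof.
move=> al0; have alE : al 0 = - (al 1 + al 2).
  by apply/eqP; rewrite -addr_eq0 addrA al0.
case: (I3_cases 0 j) => ->; rewrite ?add0r ?I3D /wdiag /=.
- by rewrite alE; field; exact: two_neq0.
- by field; exact: two_neq0.
by field; exact: two_neq0.
Qed.

(** The projection onto g(S1, S) that kills tri(S2) and the tensors u (x) b. *)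
Definition pr (x : gcar A2 S) : gcar A1 S := g1 x.1.2 (fun i => c1 (x.2 i)).

(** The remaining part of an element of g(S2, S), as an element of J. *)
Definition wJ (x : gcar A2 S) : J :=
  jel one (wdiag (S2_al x.1.1)) (fun i => cu (x.2 i)).

Lemma pr_lin : linear pr.
Proof.
move=> s x y; rewrite /pr g1_lin; apply: eq_g1 => // i.
by rewrite /= !ffunE c1_lin.
Qed.

Lemma wJ_lin : linear wJ.
Proof.
move=> s x y; rewrite /wJ (jel_lin hC); apply: (jel_ext hC) => i; last first.
  by rewrite /= !ffunE cu_lin.
rewrite /wdiag !S2_al_lin /=; case: ifP => _; first by ring.
by case: ifP => _; ring.
Qed.

Definition Phi2_fun (x : lcar (gSS A2 S)) : lcar (pstrJ one) :=
  coset (kI one) (Phi (pr x) + jL (wJ x)).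

Lemma Phi2_lin : linear Phi2_fun.
Proof.
move=> s x y; rewrite /Phi2_fun pr_lin wJ_lin (jL_lin hC) linearP -[RHS]linearP.
congr (coset _ _); rewrite scalerDr.
by rewrite -!addrA; congr (_ + _); rewrite addrCA.
Qed.

Lemma pr_g2 al d a b : pr (g2 al d a b) = g1 d a.
Proof.
apply: eq_g1 => // i; rewrite ffunE (linD (@c1_lin _ _)) (c1_one two_neq0).
by rewrite c1_u addr0.
Qed.

Lemma wJ_g2 al d a b : wJ (g2 al d a b) = jel one (wdiag al) b.
Proof.
apply: (jel_ext hC) => i; last first.
  rewrite ffunE (linD (@cu_lin _ _)) (cu_u two_neq0).
  by rewrite cu_one add0r.
by rewrite /wdiag !(S2_triK two_neq0).
Qed.

Lemma Phi_g1_jel p q d a c b : tri_part p d -> (forall i, a i \in spart C p) ->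
    jpart q c b ->
  Phi (g1 d a) (jel one c b) =
  jel one (fun j => 2 * (sform (a (j + 1)) (b (j + 1))
                         - sform (a (j + 2)) (b (j + 2))))
      (fun j => d j (b j) + ((2^-1 * (c (j + 1) - c (j + 2))) *: a j
                  - smul (a (j + 1) : S) (b (j + 2))
                  + (-1) ^+ (p && q) *: smul (b (j + 1) : S) (a (j + 2)))).
Proof.
move=> dp ap cb; rewrite (Phi_g1 hC Phi_tri Phi_iota _ dp) add_lfunE.
rewrite (jD_sum_jel two_neq0 hC ap cb) (jDtri_jel two_neq0 hC) (jelD hC).
by apply: (jel_ext hC) => j; rewrite ?add0r.
Qed.

Lemma wdiag_part p al b : (p -> forall i, al i = 0) ->
  (forall i, b i \in spart C p) -> jpart p (wdiag al) b.
Proof.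
move=> al0 bp; split=> // pT i; rewrite /wdiag !al0 // mulr0 oppr0.
by rewrite !if_same.
Qed.

Section Homogeneous.
Variables (p q : bool) (al al' : 'I_3 -> k) (d d' : triple S).
Variables (a b a' b' : 'I_3 -> C).
Hypotheses (xp : gpart p (g2 al d a b)) (yq : gpart q (g2 al' d' a' b')).
Let s : k := (-1) ^+ (p && q).
Let xP := (g2_partP two_neq0 p al d a b).1 xp.
Let yP := (g2_partP two_neq0 q al' d' a' b').1 yq.

Lemma g1_part_l : gpart p (g1 d a).
Proof. by case: xP => _ _ dp ap _; apply/g1_partP. Qed.

Lemma g1_part_r : gpart q (g1 d' a').
Proof. by case: yP => _ _ dp ap _; apply/g1_partP. Qed.

Lemma wdiag_part_l : jpart p (wdiag al) b.
Proof. by case: xP => alp _ _ _ bp; apply: wdiag_part. Qed.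

Lemma wdiag_part_r : jpart q (wdiag al') b'.
Proof. by case: yP => alp _ _ _ bp; apply: wdiag_part. Qed.

Let xp1 := g1_part_l.
Let yq1 := g1_part_r.
Let xw := wdiag_part_l.
Let yw := wdiag_part_r.

(** Brackets of elements of g(S1, S) stay there. Those of two elements of
    tri(S2) + u (x) S return to g(S1, S), because sigma sends u to 1 and the
    product of u by itself is 1; they are given by [psi]. *)
Lemma pr_gbr :
  pr (gbr (g2 al d a b) (g2 al' d' a' b'))
  = gbr (g1 d a) (g1 d' a') + psi one s (wdiag al) b (wdiag al') b'.
Proof.
have [_ al0 _ _ _] := xP; have [_ al0' _ _ _] := yP; apply/esym.
rewrite (gbr_g1 two_neq0 bS gS xp1 yq1) (gbr_g2 two_neq0 bS gS xp yq) pr_g2.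
rewrite /psi -[X in X + _]scale1r g1_lin; apply: eq_g1 => [|j].
  by rewrite scale1r -addrA -sumrB.
rewrite !wdiagE // scale1r -/s.
set t1 := d j _; set t2 := d' j _; set t3 := smul _ _; set t4 := smul _ _.
set t5 := smul _ _; set t6 := smul _ _; set v := b j; set v' := b' j.
by lincomb k (S : lmodType k) [:: t1; t2; t3; t4; t5; t6; v; v'].
Qed.

Let m i := sform (a i) (b' i) - sform (b i) (a' i).

(** The remaining brackets are the action of derivations on J. The multiple of
    the unit comes from the normalization in [wdiag]: the action yields the
    diagonal entries 2 (m_(j+1) - m_(j+2)), which do not vanish at j = 0. *)
Lemma wJ_gbr :
  Phi (g1 d a) (jel one (wdiag al') b')
    - s *: Phi (g1 d' a') (jel one (wdiag al) b)
  = wJ (gbr (g2 al d a b) (g2 al' d' a' b')) + (2 * (m 1 - m 2)) *: jone one.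
Proof.
have [alp al0 dp ap bp] := xP; have [alp' al0' dp' ap' bp'] := yP.
have ss : s * s = 1 by rewrite /s -signr_addb addbb.
have sal j : s * al j = al j.
  by rewrite /s; case: (boolP p) => [pT|_] /=; [rewrite alp ?mulr0 | rewrite mul1r].
have sT (X Y Z T : C) j :
    s *: (X + (- al j *: Y - Z + s *: T)) = s *: X - al j *: Y - s *: Z + T.
  rewrite -[in RHS](sal j) -[T in RHS]scale1r -ss.
  by lincomb k (C : lmodType k) [:: X; Y; Z; T].
have sy i : s * sform (a' i) (b i) = sform (b i) (a' i).
  by rewrite (hurwitz_sform_sym hC (bp i) (ap' i)).
rewrite (Phi_g1_jel dp ap yw) (Phi_g1_jel dp' ap' xw).
rewrite (gbr_g2 two_neq0 bS gS xp yq) wJ_g2 /jone !(jelZ hC) (jelN hC) !(jelD hC).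
apply: (jel_ext hC) => j; last first.
  rewrite !wdiagE // [q && p]andbC -/s sT scaler0 addr0.
  set t1 := d j _; set t2 := d' j _; set t3 := smul _ _; set t4 := smul _ _.
  set t5 := smul _ _; set t6 := smul _ _; set v := a j; set v' := a' j.
  by lincomb k (S : lmodType k) [:: t1; t2; t3; t4; t5; t6; v; v'].
have AL j0 : \sum_i (sform (a i) (b' i) - sform (b i) (a' i))
                * (if j0 == i then 2 else -1)
    = 2 * m j0 - m (j0 + 1) - m (j0 + 2).
  by rewrite (sum_I3 _ j0) !I3E /m; ring.
have -> : 2 * (sform (a (j + 1)) (b' (j + 1)) - sform (a (j + 2)) (b' (j + 2)))
    - s * (2 * (sform (a' (j + 1)) (b (j + 1)) - sform (a' (j + 2)) (b (j + 2))))
    = 2 * (m (j + 1) - m (j + 2)).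
  by rewrite /m -!sy; ring.
rewrite /wdiag !AL ?I3D.
case: (I3_cases 0 j) => ->; rewrite ?add0r ?I3D /=; ring.
Qed.

(** The lift [Phi (pr x) + jL (wJ x)] respects brackets up to a multiple of the
    identity. *)
Lemma lift_gbr :
  scomm (Phi (g1 d a) + jL (jel one (wdiag al) b))
        (Phi (g1 d' a') + jL (jel one (wdiag al') b'))
  = Phi (pr (gbr (g2 al d a b) (g2 al' d' a' b')))
    + jL (wJ (gbr (g2 al d a b) (g2 al' d' a' b'))) + (2 * (m 1 - m 2)) *: \1%VF.
Proof.
rewrite (linD (scomm_linl _)) !(linD (scomm_linr _)).
rewrite -(psi_Phi two_neq0 hC Phi_iso Phi_tri Phi_iota xw yw) -/s.
rewrite -(Phi_gbr hC Phi_iso xp1 yq1) pr_gbr.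
have Dx := Phi_part Phi_iso xp1; have Dy := Phi_part Phi_iso yq1.
have wxp : jel one (wdiag al) b \in spart J p by apply: (jel_part hC) xw.1 xw.2.
rewrite (der_jL two_neq0 hC _ Dx) (scomm_anti gJ (jL_part hC wxp) Dy.1).
rewrite (der_jL two_neq0 hC _ Dy) -/s -(linZ (jL_lin hC)).
rewrite -(jL_one two_neq0 hC) -(linZ (jL_lin hC)).
rewrite -[RHS]addrA -(linD (jL_lin hC)) -wJ_gbr (linB (jL_lin hC)).
have Pl : linear Phi by exact: linearP.
rewrite [Phi (_ + psi _ _ _ _ _ _)](linD Pl).
set t2 := Phi (psi _ _ _ _ _ _); set t1 := Phi _; set t3 := jL _; set t4 := jL _.
by lincomb k ('End(J) : lmodType k) [:: t1; t2; t3; t4].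
Qed.

End Homogeneous.

End Extension.

(** * The projective structure Lie superalgebra *)

Lemma bilinear_eq_sum (k : fieldType) (U W : lmodType k) (f g : U -> U -> W)
    x0 x1 y0 y1 :
    (forall y, linear (f^~ y)) -> (forall x, linear (f x)) ->
    (forall y, linear (g^~ y)) -> (forall x, linear (g x)) ->
    f x0 y0 = g x0 y0 -> f x0 y1 = g x0 y1 -> f x1 y0 = g x1 y0 ->
    f x1 y1 = g x1 y1 ->
  f (x0 + x1) (y0 + y1) = g (x0 + x1) (y0 + y1).
Proof.
move=> fl fr gl gr e00 e01 e10 e11; rewrite (linD (fl _)) !(linD (fr _)).
by rewrite (linD (gl _)) !(linD (gr _)) e00 e01 e10 e11.
Qed.

Section ProjectiveStructure.
Variables (k : fieldType) (C : qsuperalg k) (one : C).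
Hypotheses (two_neq0 : 2 != 0 :> k) (hC : hurwitz one).
Local Notation S := (para one).
Local Notation A1 := (S1 k).
Local Notation A2 := (S2 k).
Local Notation u1 := (S1_one k).
Local Notation J := (J one).
Local Notation g1 := (@g1 k S).
Local Notation g2 := (@g2 k S).
Variable Phi : {linear lcar (gSS A1 S) -> lcar (derJ one)}.
Hypothesis Phi_iso : lie_iso Phi.
Hypothesis Phi_tri : forall d : triple S, tri d -> Phi (gtri' A1 d) = jDtri d.
Hypothesis Phi_iota : forall (i : 'I_3) (a : C),
  Phi (giota i (tpure u1 a : stensor A1 S)) = jD one i a.
Implicit Types (d : triple S) (a b : 'I_3 -> C) (c al : 'I_3 -> k).
Implicit Types (p q : bool) (i j : 'I_3).

Let bS : bilin S := para_bilin hC.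
Let gS : graded S := hurwitz_graded hC.
Let gJ : graded J := J_graded two_neq0 hC.


Lemma str_part_end p X : @str_part k C one p X -> end_part p X.
Proof.
case=> D [x [Dp xp ->]]; rewrite -[D]scale1r.
by apply: end_partP Dp.1 _; apply: (jL_part hC).
Qed.

Lemma der_part_lin p t (D E : 'End(J)) :
  der_part p D -> der_part p E -> der_part p (t *: D + E).
Proof. by have [[_ [[_ H _] _]] _] := Phi_iso; apply: H. Qed.

Lemma der_part0 p : der_part p (0 : 'End(J)).
Proof. by have [[_ [[H _ _] _]] _] := Phi_iso; apply: H. Qed.

Lemma der_part_comm p q (D E : 'End(J)) :
  der_part p D -> der_part q E -> der_part (p (+) q) (scomm D E).
Proof. by have [[_ [_ [[H _ _] _]]] _] := Phi_iso; apply: H. Qed.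

Lemma str_part_lin p t (X Y : 'End(J)) :
  str_part p X -> str_part p Y -> str_part p (t *: X + Y).
Proof.
move=> [D [x [Dp xp ->]]] [E [y [Ep yp ->]]]; exists (t *: D + E), (t *: x + y).
split; [exact: der_part_lin | by rewrite rpredD ?rpredZ |].
by rewrite (jL_lin hC) scalerDr addrACA.
Qed.

Lemma J_jpart p (v : J) : v \in spart J p -> jpart p (jdiag v) (joff v).
Proof.
move=> vp; split=> [pT i | i]; last exact: joff_part.
by rewrite pT in vp; apply: (jdiag_odd hC).
Qed.

(** This is where J is seen to be a Jordan superalgebra: the commutator is the
    image under [Phi] of an element of g(S1, S). *)
Lemma jL_comm_der p q (v w : J) : v \in spart J p -> w \in spart J q ->
  der_part (p (+) q) (scomm (jL v) (jL w)).
Proof.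
move=> vp wq; rewrite -(jel_coord two_neq0 hC v) -(jel_coord two_neq0 hC w).
rewrite -(psi_Phi two_neq0 hC Phi_iso Phi_tri Phi_iota (J_jpart vp) (J_jpart wq)).
apply: (Phi_part Phi_iso).
exact: (psi_part two_neq0 hC Phi_iso (J_jpart vp) (J_jpart wq)).
Qed.

Lemma str_part_comm p q (X Y : 'End(J)) :
  str_part p X -> str_part q Y -> str_part (p (+) q) (scomm X Y).
Proof.
move=> [D [x [Dp xp ->]]] [E [y [Ep yp ->]]].
exists (scomm D E + scomm (jL x) (jL y)), (D y - (-1) ^+ (p && q) *: E x); split.
- rewrite -[scomm D E]scale1r; apply: der_part_lin; first exact: der_part_comm.
  exact: jL_comm_der.
- have [[DP _] [EP _]] := (Dp, Ep).
  rewrite rpredB ?rpredZ //; first by rewrite addbC; apply: DP.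
  by apply: EP.
rewrite (linD (scomm_linl _)) !(linD (scomm_linr _)).
rewrite (der_jL two_neq0 hC _ Dp) (scomm_anti gJ (jL_part hC xp) Ep.1).
rewrite (der_jL two_neq0 hC _ Ep) (linB (jL_lin hC)) (linZ (jL_lin hC)).
set t1 := scomm D E; set t2 := scomm _ _; set t3 := jL _; set t4 := jL _.
by lincomb k ('End(J) : lmodType k) [:: t1; t2; t3; t4].
Qed.

Lemma pstr_lie : lie_superalgebra (pstrJ one).
Proof.
have str0 p : str_part p (0 : 'End(J)).
  exists 0, 0; split; [exact: der_part0 | exact: mem0v |].
  by rewrite (lin0 (jL_lin hC)) addr0.
have cl : linear (coset (kI one)) by exact: linearP.
split; [split | split; split].
- by move=> p; exists 0; rewrite ?(lin0 cl).
- move=> p t _ _ [X Xp ->] [Y Yp ->]; exists (t *: X + Y); last by rewrite linearP.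
  exact: str_part_lin.
- move=> _ [X Xp ->] [Y Yp] /(@coset_eq k C one X Y)[c XY].
  suff -> : X = c *: \1%VF.
    by rewrite -[RHS](lin0 cl); apply/(@coset_eq k C one); exists c; rewrite add0r.
  have Y0 : Y = 0.
    apply: (end_part_disjoint gJ); last exact: str_part_end.
    have -> : Y = - c *: \1%VF + X by rewrite XY scaleNr addrC addrK.
    by apply: end_partP; [exact: end_part_id | exact: str_part_end].
  by rewrite XY Y0 add0r.
- move=> p q _ _ [X Xp ->] [Y Yq ->]; exists (scomm X Y); last exact: pgl_br_coset.
  exact: str_part_comm.
- by move=> t X Y Z _ _ _; apply: (pgl_br_linl gJ).
- by move=> t X Y Z _ _ _; apply: (pgl_br_linr gJ).
- move=> p q _ _ [X Xp ->] [Y Yq ->].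
  rewrite /= !(pgl_br_coset gJ) (scomm_anti gJ (str_part_end Xp) (str_part_end Yq)).
  by rewrite linearN linearZ.
- move=> p q r _ _ _ [X Xp ->] [Y Yq ->] [Z Zr ->].
  rewrite /= (pgl_br_coset gJ Y Z) (pgl_br_coset gJ X Y) (pgl_br_coset gJ X Z).
  rewrite !(pgl_br_coset gJ).
  rewrite (scomm_jacobi gJ (str_part_end Xp) (str_part_end Yq) (str_part_end Zr)).
  by rewrite linearD linearZ.
move=> _ [X Xp ->]; rewrite /= (pgl_br_coset gJ X X) (pgl_br_coset gJ).
by rewrite (scomm_cube gJ (str_part_end Xp)) (lin0 cl).
Qed.

(** * The isomorphism property of the extension *)

Local Notation Phi2 := (@Phi2_fun k C one Phi).
Local Notation G2 := (gcar A2 S).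

Lemma gpart2_0 p : gpart p (0 : G2).
Proof.
split=> [||i]; [exact: (tri_part0 (S2_bilin k)) | exact: tri_part0 |].
by rewrite ffunE mem0v.
Qed.

Lemma gpart2_lin p t (x y : G2) : gpart p x -> gpart p y -> gpart p (t *: x + y).
Proof.
move=> [x1 x2 x3] [y1 y2 y3]; split=> [||i].
- exact: (tri_part_lin (S2_bilin k)).
- exact: tri_part_lin.
by rewrite !ffunE rpredD ?rpredZ.
Qed.

Lemma gpart2_lmem p (x : G2) : gpart p x -> lmem (x : lcar (gSS A2 S)).
Proof.
case: p => xp; first by exists 0, x; rewrite add0r; split=> //; apply: (gpart2_0 false).
by exists x, 0; rewrite addr0; split=> //; apply: (gpart2_0 true).
Qed.

Lemma lmem2_lin t (x y : lcar (gSS A2 S)) : lmem x -> lmem y -> lmem (t *: x + y).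
Proof.
move=> [x0 [x1 [x0p x1p ->]]] [y0 [y1 [y0p y1p ->]]].
exists (t *: x0 + y0), (t *: x1 + y1).
split; [exact: (gpart2_lin t x0p) | exact: (gpart2_lin t x1p) |].
by rewrite scalerDr addrACA.
Qed.

Lemma pr_part p (x : G2) : gpart p x -> gpart p (pr x).
Proof.
move=> xp; have xE := g2_coord two_neq0 xp; rewrite xE in xp.
rewrite xE pr_g2 //; apply/g1_partP.
by have [] := (g2_partP two_neq0 _ _ _ _ _).1 xp.
Qed.

Lemma wJ_part p (x : G2) : gpart p x -> wJ x \in spart J p.
Proof.
move=> xp; have xE := g2_coord two_neq0 xp; rewrite xE in xp.
have [alp _ _ _ bp] := (g2_partP two_neq0 _ _ _ _ _).1 xp.
by rewrite xE wJ_g2 //; have [] := wdiag_part alp bp; apply: (jel_part hC).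
Qed.

Lemma Phi2_part p (x : G2) : gpart p x -> pstr_part p (Phi2 x).
Proof.
move=> xp; exists (Phi (pr x) + jL (wJ x)) => //; exists (Phi (pr x)), (wJ x).
by split=> //; [apply/(Phi_part Phi_iso)/pr_part | apply: wJ_part].
Qed.

Lemma Phi2_gbr_hom p q (x y : G2) : gpart p x -> gpart q y ->
  Phi2 (gbr x y) = pgl_br (Phi2 x) (Phi2 y).
Proof.
move=> xp yq; have xE := g2_coord two_neq0 xp; have yE := g2_coord two_neq0 yq.
rewrite xE in xp *; rewrite yE in yq *.
rewrite {2 3}/Phi2_fun (pgl_br_coset gJ) !pr_g2 // !wJ_g2 //.
rewrite (lift_gbr two_neq0 hC Phi_iso Phi_tri Phi_iota xp yq).
by apply/esym/(@coset_eq k C one); eexists.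
Qed.

Lemma Phi2_gbr (x y : G2) : lmem (x : lcar (gSS A2 S)) ->
  lmem (y : lcar (gSS A2 S)) -> Phi2 (gbr x y) = pgl_br (Phi2 x) (Phi2 y).
Proof.
move=> [x0 [x1 [x0p x1p ->]]] [y0 [y1 [y0p y1p ->]]].
have Pl : linear Phi2 by apply: Phi2_lin.
apply: (@bilinear_eq_sum _ _ _ (fun x y => Phi2 (gbr x y))
          (fun x y => pgl_br (Phi2 x) (Phi2 y))).
- by move=> z; apply: (linear_comp Pl (gbr_linl z)).
- by move=> z; apply: (linear_comp Pl (gbr_linr z)).
- by move=> z; apply: (linear_comp (pgl_br_linl gJ (Phi2 z)) Pl).
- by move=> z; apply: (linear_comp (pgl_br_linr gJ (Phi2 z)) Pl).
- exact: Phi2_gbr_hom x0p y0p.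
- exact: Phi2_gbr_hom x0p y1p.
- exact: Phi2_gbr_hom x1p y0p.
exact: Phi2_gbr_hom x1p y1p.
Qed.


Lemma joff_jel c a i : joff (jel one c a) i = a i.
Proof. by rewrite /joff (jel_low2 hC) scalerA mulVf // scale1r. Qed.

Lemma joff_lin i : linear (fun v : J => joff v i).
Proof.
by move=> t u v; rewrite /joff linearP !ffunE scalerDr !scalerA mulrC.
Qed.

Lemma sum_theta_coef (m : 'I_3 -> k) :
  let al j := \sum_i m i * (if j == i then 2 else -1) in al 0 + al 1 + al 2 = 0.
Proof.
move=> al; rewrite /al -!big_split big1 // => i _ /=; rewrite -!mulrDr.
by case: (I3_cases 0 i) => ->; rewrite ?add0r /=; ring.
Qed.

Lemma gpart1_add p (x y : gcar A1 S) : gpart p x -> gpart p y -> gpart p (x + y).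
Proof.
have [[[[_ H _] _] _] _] := Phi_iso.
by rewrite -[x in x + y]scale1r; apply: H.
Qed.

(** The parity of the components is read off from [pr_gbr] and [wJ_gbr]; only the
    component in tri(S2) is computed. *)
Lemma gbr2_part p q (x y : G2) :
  gpart p x -> gpart q y -> gpart (p (+) q) (gbr x y).
Proof.
move=> xp yq; have xE := g2_coord two_neq0 xp; have yE := g2_coord two_neq0 yq.
rewrite xE in xp *; rewrite yE in yq *.
have prE := pr_gbr two_neq0 hC xp yq.
have wE := wJ_gbr two_neq0 hC Phi_tri Phi_iota xp yq.
have xp1 := g1_part_l two_neq0 xp; have yq1 := g1_part_r two_neq0 yq.
have xw := wdiag_part_l two_neq0 xp; have yw := wdiag_part_r two_neq0 yq.
have prP : gpart (p (+) q) (pr (gbr (g2 (S2_al x.1.1) x.1.2 (fun i => c1 (x.2 i))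
      (fun i => cu (x.2 i))) (g2 (S2_al y.1.1) y.1.2 (fun i => c1 (y.2 i))
      (fun i => cu (y.2 i))))).
  rewrite prE; apply: gpart1_add; first exact: (gbr1_part Phi_iso xp1 yq1).
  exact: (psi_part two_neq0 hC Phi_iso xw yw).
have wP : Phi (g1 x.1.2 (fun i => c1 (x.2 i)))
      (jel one (wdiag (S2_al y.1.1)) (fun i => cu (y.2 i)))
    - (-1) ^+ (p && q) *: Phi (g1 y.1.2 (fun i => c1 (y.2 i)))
      (jel one (wdiag (S2_al x.1.1)) (fun i => cu (x.2 i))) \in spart J (p (+) q).
  have [[DP _] [EP _]] := (Phi_part Phi_iso xp1, Phi_part Phi_iso yq1).
  rewrite rpredB ?rpredZ //; first by rewrite addbC; apply: DP; apply: (jel_part hC) yw.1 yw.2.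
  by apply: EP; apply: (jel_part hC) xw.1 xw.2.
move: prP wP; rewrite wE.
have gE := gbr_g2 two_neq0 bS gS xp yq; rewrite gE pr_g2 // wJ_g2 //.
move=> /g1_partP[dP aP] wP; apply/(g2_partP two_neq0); split=> //.
- move=> pq i; rewrite big1 // => l _.
  have [_ _ _ ap bp] := (g2_partP two_neq0 _ _ _ _ _).1 xp.
  have [_ _ _ ap' bp'] := (g2_partP two_neq0 _ _ _ _ _).1 yq.
  have pq' : p != q by case: p q pq {xp yq prE wE xp1 yq1 xw yw gE dP aP wP ap bp ap' bp'} => [] [].
  rewrite (hurwitz_sform_part hC (ap l) (bp' l) pq').
  by rewrite (hurwitz_sform_part hC (bp l) (ap' l) pq') subrr mul0r.
- exact: sum_theta_coef.
move=> i; have := joff_part i wP; rewrite (linD (joff_lin i)) (linZ (joff_lin i)).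
by rewrite !joff_jel scaler0 addr0.
Qed.

Lemma gpart2_disjoint (x : G2) : gpart false x -> gpart true x -> x = 0.
Proof.
case: x => [[s d] t] [s0 d0 t0] [s1 d1 t1]; congr (_, _, _).
- exact: (even_tri_odd (S2_even k) (S2_odd k) s1).
- apply/ffunP=> i; rewrite ffunE.
  exact: (end_part_disjoint gS (d0.1 i).1 (d1.1 i).1).
apply/ffunP=> i; rewrite ffunE.
exact: (spart_disjoint (T2_disjoint two_neq0 gS) (t0 i) (t1 i)).
Qed.

Lemma jmul_jone (v : J) : jmul v (jone one) = v.
Proof.
elim/(graded_ind gJ): v => [p v vp | v w IHv IHw].
  rewrite (jmulC hC vp (jone_part hC)) andbF scale1r -(jLE hC).
  by rewrite (jL_one two_neq0 hC) id_lfunE.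
by rewrite (linD (jmul_linl hC _)) IHv IHw.
Qed.

(** If [Phi (pr x) + jL (wJ x)] is [t] times the identity, evaluate at the unit of
    J, which derivations kill: [wJ x] is [t] times the unit. Its diagonal
    entry of index 0 is 0, hence [t = 0], [wJ x = 0] and [Phi (pr x) = 0]. *)
Lemma Phi2_inj (x : lcar (gSS A2 S)) : lmem x -> Phi2 x = 0 -> x = 0.
Proof.
move=> xm; have [x0 [x1 [x0p x1p xE]]] := xm.
have prl := @pr_lin k C one; have wl := wJ_lin hC.
have cl : linear (coset (kI one)) by exact: linearP.
rewrite -(lin0 cl) => /(@coset_eq k C one)[t XE].
have Phi1 : Phi (pr x) (jone one) = 0.
  rewrite xE (linD prl) linearD add_lfunE.
  rewrite (der_one two_neq0 hC (Phi_part Phi_iso (pr_part x0p))).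
  by rewrite (der_one two_neq0 hC (Phi_part Phi_iso (pr_part x1p))) addr0.
have wE : wJ x = t *: jone one.
  have := congr1 (fun f : 'End(J) => f (jone one)) XE.
  rewrite !add_lfunE Phi1 (jLE hC) jmul_jone zero_lfunE !add0r.
  by rewrite scale_lfunE id_lfunE.
have [cE bE] := jel_inj two_neq0 hC (etrans wE (jelZ hC t _ _)).
have s1 : x.1.1 = x0.1.1.
  rewrite xE -[LHS]/(x0.1.1 + x1.1.1); case: x1p => s1 _ _.
  by rewrite (even_tri_odd (S2_even k) (S2_odd k) s1) addr0.
have sp : tri_part false x.1.1 by rewrite s1; case: x0p.
have al0 : S2_al x.1.1 0 + S2_al x.1.1 1 + S2_al x.1.1 2 = 0.
  by apply/(S2_tri_part two_neq0); rewrite -S2_triE.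
have t0 : t = 0 by have := cE 0; rewrite /wdiag /= mulr1.
have halve (z : k) : 2 * z = 0 -> z = 0.
  by move/eqP; rewrite mulf_eq0 (negPf two_neq0) => /eqP.
have al2 : S2_al x.1.1 2 = 0.
  by apply: halve; have := cE 1; rewrite /wdiag /= t0 mul0r.
have al1 : S2_al x.1.1 1 = 0.
  apply: halve; have := cE 2; rewrite /wdiag /= t0 mul0r => /eqP.
  by rewrite oppr_eq0 => /eqP.
have s0 : x.1.1 = 0.
  rewrite (S2_triE two_neq0 sp); apply/ffunP=> i; rewrite [LHS]ffunE [RHS]ffunE.
  suff -> : S2_al x.1.1 i = 0 by rewrite scale0r.
  move: al0; rewrite al1 al2 !addr0 => al0.
  by case: (I3_cases 0 i) => ->; rewrite ?add0r.
have pr0 : pr x = 0.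
  have [_ [_ Phi_inj _ _]] := Phi_iso; apply: Phi_inj.
    exists (pr x0), (pr x1).
    by split; [exact: (pr_part x0p) | exact: (pr_part x1p) | rewrite xE (linD prl)].
  move: XE; rewrite wE t0 !scale0r (lin0 (jL_lin hC)) !addr0.
  by [].
have d0 : x.1.2 = 0 by have := congr1 (fun z : gcar A1 S => z.1.2) pr0.
have c1E i : c1 (x.2 i) = 0.
  have := congr1 (fun z : gcar A1 S => c0 (z.2 i)) pr0.
  by rewrite /= !ffunE c0_one (lin0 (@c0_lin _ _)).
have t2 : x.2 = 0.
  apply/ffunP=> i; rewrite (T2E two_neq0 (x.2 i)) c1E (bE i) ffunE scaler0.
  by rewrite !(lin0 (tpure_linr _)) addr0.
by move: s0 d0 t2; clear; case: x => [[s d] t] /= -> -> ->.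
Qed.

Lemma gincl_lin : linear (fun x : gcar A1 S => gincl x : G2).
Proof.
move=> t [[s d] z] [[s' d'] z']; rewrite [RHS]pair3_lin.
congr (_, _, _); first by rewrite scaler0 addr0.
by apply/ffunP=> i; rewrite !ffunE tlift_lin.
Qed.

Lemma gincl_g1 d a : gincl (g1 d a) = g2 (fun=> 0) d a (fun=> 0).
Proof.
congr (_, _, _); first by apply/ffunP=> i; rewrite !ffunE scale0r.
apply/ffunP=> i; rewrite !ffunE (lin0 (tpure_linr _)) addr0 tlift_pure.
- by rewrite scale1r.
- move=> y; apply: (linear_comp (tpure_linl y)).
  by move=> t x x'; rewrite scalerDl scalerA.
by move=> x; apply: tpure_linr.
Qed.

Lemma gincl_part p (x : gcar A1 S) : gpart p x -> gpart p (gincl x : G2).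
Proof.
move=> xp; have xE := g1_coord two_neq0 xp; rewrite xE in xp *.
rewrite gincl_g1; have [dp ap] := (g1_partP _ _ _).1 xp.
by apply/(g2_partP two_neq0); split=> // [|i]; rewrite ?addr0 // mem0v.
Qed.

Lemma wdiag0 i : wdiag (fun=> 0 : k) i = 0.
Proof. by rewrite /wdiag mulr0 oppr0 !if_same. Qed.

Lemma Phi2_g2 al d a b :
  Phi2 (g2 al d a b) = coset (kI one) (Phi (g1 d a) + jL (jel one (wdiag al) b)).
Proof. by rewrite /Phi2_fun (pr_g2 two_neq0) (wJ_g2 two_neq0 hC). Qed.

Lemma Phi2_gincl (x : gcar A1 S) : lmem (x : lcar (gSS A1 S)) ->
  Phi2 (gincl x) = coset (kI one) (Phi x).
Proof.
have hom p (y : gcar A1 S) : gpart p y -> Phi2 (gincl y) = coset (kI one) (Phi y).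
  move=> yp; rewrite [in LHS](g1_coord two_neq0 yp) gincl_g1 Phi2_g2.
  rewrite -(g1_coord two_neq0 yp) (jel_ext hC wdiag0 (frefl _)) (jel0 hC).
  by rewrite (lin0 (jL_lin hC)) addr0.
move=> [x0 [x1 [x0p x1p ->]]].
have Pl : linear Phi2 by apply: Phi2_lin.
rewrite (linD gincl_lin) (linD Pl) (hom _ _ x0p) (hom _ _ x1p).
have Ql : linear Phi by exact: linearP.
by rewrite -cosetD -(linD Ql).
Qed.

Lemma lmem_gincl (x : gcar A1 S) : lmem (x : lcar (gSS A1 S)) ->
  lmem (gincl x : lcar (gSS A2 S)).
Proof.
move=> [x0 [x1 [x0p x1p ->]]]; exists (gincl x0), (gincl x1).
split; [exact: gincl_part x0p | exact: gincl_part x1p | exact: (linD gincl_lin)].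
Qed.

(** Modulo the identity, every element of J has its e_0-coordinate equal to 0,
    and is then of the form [wJ x]. *)
Lemma Phi2_jL p (v : J) : v \in spart J p ->
  exists2 x : G2, gpart p x & Phi2 x = coset (kI one) (jL v).
Proof.
move=> vp; have [c0 bp] := J_jpart vp; set c := jdiag v in c0; set b := joff v in bp.
pose al1 := - (2^-1 * (c 2 - c 0)); pose al2 := 2^-1 * (c 1 - c 0).
pose al i := if i == 0 then - al1 - al2 else if i == 1 then al1 else al2.
exists (g2 al 0 (fun=> 0) b).
  apply/(g2_partP two_neq0); split=> // [pT i | | | i].
  - rewrite /al /al1 /al2 !c0 // subrr mulr0 !oppr0 addr0.
    by rewrite !if_same.
  - by rewrite /al /=; ring.
  - exact: tri_part0.
  exact: mem0v.
rewrite Phi2_g2 -[g1 _ _]/(g1 0 (fun=> 0)).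
have -> : Phi (g1 0 (fun=> 0)) = 0.
  rewrite -[RHS](linear0 Phi); congr (Phi _); rewrite /Submission.g1.
  by congr (_, _, _); apply/ffunP=> i; rewrite !ffunE (lin0 (tpure_linr _)).
rewrite add0r; apply/(@coset_eq k C one); exists (- c 0).
rewrite -(jL_one two_neq0 hC) -(linZ (jL_lin hC)) -(linD (jL_lin hC)).
congr (jL _); rewrite -[v](jel_coord two_neq0 hC) -/c -/b (jelZ hC) (jelD hC).
apply: (jel_ext hC) => i; last by rewrite scaler0 addr0.
rewrite /wdiag; case: (I3_cases 0 i) => ->; rewrite ?add0r /al /al1 /al2 /=.
- by ring.
- by field; exact: two_neq0.
by field; exact: two_neq0.
Qed.

Lemma Phi2_surj (y : lcar (pstrJ one)) : lmem y ->
  exists2 x : lcar (gSS A2 S), lmem x & Phi2 x = y.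
Proof.
have Pl : linear Phi2 by apply: Phi2_lin.
have hom p X : str_part p X ->
    exists2 x : lcar (gSS A2 S), lmem x & Phi2 x = coset (kI one) X.
  move=> [D [v [Dp vp ->]]].
  have [z zm zE] : exists2 z, lmem z & Phi z = D.
    have [_ [_ _ Phi_surj _]] := Phi_iso; apply: Phi_surj.
    case: (p) Dp => Dp; first by exists 0, D; rewrite add0r; split=> //; apply: (der_part0 false).
    by exists D, 0; rewrite addr0; split=> //; apply: (der_part0 true).
  have [x xp xE] := Phi2_jL vp.
  exists (gincl z + x).
    rewrite -[gincl z]scale1r; apply: lmem2_lin; first exact: lmem_gincl.
    exact: gpart2_lmem xp.
  by rewrite (linD Pl) Phi2_gincl // zE xE -cosetD.
move=> [_ [_ [[X0 X0p ->] [X1 X1p ->] ->]]].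
have [[x0 x0m <-] [x1 x1m <-]] := (hom _ _ X0p, hom _ _ X1p).
exists (x0 + x1); last by rewrite (linD Pl).
by rewrite -[x0]scale1r; apply: lmem2_lin.
Qed.

Lemma Phi2_eq (x y : lcar (gSS A2 S)) : lmem x -> lmem y -> Phi2 x = Phi2 y -> x = y.
Proof.
move=> xm ym xy; apply/eqP; rewrite -subr_eq0; apply/eqP/Phi2_inj.
  by rewrite addrC -scaleN1r; apply: lmem2_lin.
have Pl : linear Phi2 by apply: Phi2_lin.
by rewrite (linB Pl) xy subrr.
Qed.

(** Closure and bilinearity are checked on the bracket itself; the identities
    are transported from pstr J along the injective bracket-preserving map. *)
Lemma gSS2_lie : lie_superalgebra (gSS A2 S).
Proof.
have Pl : linear Phi2 by apply: Phi2_lin.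
have [_ [_ [anti jac cube]]] := pstr_lie.
have lm p (x : lcar (gSS A2 S)) : lpart p x -> lmem x by apply: gpart2_lmem.
have lmb p q (x y : lcar (gSS A2 S)) : lpart p x -> lpart q y ->
    lpart (p (+) q) (lbr x y) by apply: gbr2_part.
have lmZ t (x : lcar (gSS A2 S)) : lmem x -> lmem (t *: x).
  by move=> xm; rewrite -[t *: x]addr0; apply: lmem2_lin (lm _ _ (gpart2_0 false)).
have lmD (x y : lcar (gSS A2 S)) : lmem x -> lmem y -> lmem (x + y).
  by move=> xm ym; rewrite -[x]scale1r; apply: lmem2_lin.
have hom (x y : lcar (gSS A2 S)) : lmem x -> lmem y ->
  Phi2 (lbr x y) = lbr (Phi2 x) (Phi2 y) by apply: Phi2_gbr.
have NZ t (z : lcar (gSS A2 S)) : Phi2 (- (t *: z)) = - (t *: Phi2 z).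
  by rewrite (linN Pl) (linZ Pl).
have DZ t (v w : lcar (gSS A2 S)) : Phi2 (v + t *: w) = Phi2 v + t *: Phi2 w.
  by rewrite (linD Pl) (linZ Pl).
split; [split | split; split].
- exact: gpart2_0.
- exact: gpart2_lin.
- exact: gpart2_disjoint.
- exact: lmb.
- by move=> t x y z _ _ _; apply: gbr_linl.
- by move=> t x y z _ _ _; apply: gbr_linr.
- move=> p q x y xp yq; have [xm ym] := (lm _ _ xp, lm _ _ yq).
  have bm := lm _ _ (lmb _ _ _ _ yq xp).
  apply: Phi2_eq; first exact: lm _ _ (lmb _ _ _ _ xp yq).
    by rewrite -scaleN1r; apply/lmZ/lmZ.
  apply: etrans (hom _ _ xm ym) _.
  apply: etrans (anti _ _ _ _ (Phi2_part xp) (Phi2_part yq)) _.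
  exact: esym (etrans (NZ _ _) (congr1 (fun w => - (_ *: w)) (hom _ _ ym xm))).
- move=> p q r x y z xp yq zr.
  have [xm [ym zm]] := (lm _ _ xp, (lm _ _ yq, lm _ _ zr)).
  have xyp := lmb _ _ _ _ xp yq; have yzp := lmb _ _ _ _ yq zr.
  have xzp := lmb _ _ _ _ xp zr.
  apply: Phi2_eq; first exact: lm _ _ (lmb _ _ _ _ xp yzp).
    apply: lmD; first exact: lm _ _ (lmb _ _ _ _ xyp zr).
    by apply: lmZ; exact: lm _ _ (lmb _ _ _ _ yq xzp).
  apply: etrans (hom _ _ xm (lm _ _ yzp)) _.
  apply: etrans (congr1 _ (hom _ _ ym zm)) _.
  apply: etrans (jac _ _ _ _ _ _ (Phi2_part xp) (Phi2_part yq) (Phi2_part zr)) _.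
  apply/esym; apply: etrans (DZ _ _ _) _.
  apply: (f_equal2 (fun v w => v + _ *: w)).
    exact: etrans (hom _ _ (lm _ _ xyp) zm) (congr1 (fun w => lbr w _) (hom _ _ xm ym)).
  exact: etrans (hom _ _ ym (lm _ _ xzp)) (congr1 _ (hom _ _ xm zm)).
move=> x xp; have xm := lm _ _ xp; have xxp := lmb _ _ _ _ xp xp.
apply: Phi2_eq; [exact: lm _ _ (lmb _ _ _ _ xp xxp) | exact: lm _ _ (gpart2_0 false) |].
apply: etrans (hom _ _ xm (lm _ _ xxp)) _.
apply: etrans (congr1 _ (hom _ _ xm xm)) _.
exact: etrans (cube _ (Phi2_part xp)) (esym (lin0 Pl)).
Qed.

End ProjectiveStructure.

(** * The values of the extension *)

Section Values.
Variables (k : fieldType) (C : qsuperalg k) (one : C).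
Hypotheses (two_neq0 : 2 != 0 :> k) (hC : hurwitz one).
Local Notation S := (para one).
Local Notation A1 := (S1 k).
Local Notation A2 := (S2 k).
Local Notation u1 := (S1_one k).
Local Notation J := (J one).
Local Notation g1 := (@g1 k S).
Local Notation g2 := (@g2 k S).
Variable Phi : {linear lcar (gSS A1 S) -> lcar (derJ one)}.
Hypothesis Phi_tri : forall d : triple S, tri d -> Phi (gtri' A1 d) = jDtri d.
Hypothesis Phi_iota : forall (i : 'I_3) (a : C),
  Phi (giota i (tpure u1 a : stensor A1 S)) = jD one i a.
Implicit Types (d : triple S) (a b : 'I_3 -> C) (c al : 'I_3 -> k).
Implicit Types (p q : bool) (i j : 'I_3).



Local Notation Phi2 := (@Phi2_fun k C one Phi).

Lemma g1_00 : g1 0 (fun=> 0) = 0.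
Proof.
by congr (_, _, _); apply/ffunP=> i; rewrite !ffunE (lin0 (tpure_linr _)).
Qed.

Lemma Phi2_tri d : tri d -> Phi2 (gtri' A2 d) = coset (kI one) (jDtri d).
Proof.
move=> td; rewrite /Phi2_fun; have -> : pr (gtri' A2 d) = gtri' A1 d.
  rewrite -g1_tri; apply: eq_g1 => // i.
  by rewrite ffunE (lin0 (@c1_lin _ _)).
have -> : wJ (gtri' A2 d) = 0.
  rewrite /wJ -(jel0 hC); apply: (jel_ext hC) => i; last first.
    by rewrite ffunE (lin0 (@cu_lin _ _)).
  have al0 j : S2_al (gtri' A2 d).1.1 j = 0 by rewrite /S2_al ffunE zero_lfunE.
  by rewrite /wdiag !al0 mulr0 oppr0 !if_same.
by rewrite (lin0 (jL_lin hC)) addr0 Phi_tri.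
Qed.

(** The images of the elements of tri(S2), which only matter up to adding a
    multiple of the unit to the diagonal [c]. *)
Lemma Phi2_tri2 al c t : (forall i, wdiag al i = c i + t) ->
  Phi2 (gtri S (S2_tri al)) = coset (kI one) (jL (jel one c (fun=> 0))).
Proof.
move=> cE; have -> : gtri S (S2_tri al) = g2 al 0 (fun=> 0) (fun=> 0).
  congr (_, _, _); apply/ffunP=> i.
  by rewrite !ffunE !(lin0 (tpure_linr _)) addr0.
rewrite (Phi2_g2 two_neq0 hC) g1_00 linear0 add0r.
apply/(@coset_eq k C one); exists t.
rewrite -(jL_one two_neq0 hC) -(linZ (jL_lin hC)) -(linD (jL_lin hC)).
congr (jL _); rewrite (jelZ hC) (jelD hC); apply: (jel_ext hC) => i.
  by rewrite cE mulr1.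
by rewrite scaler0 addr0.
Qed.

Lemma Phi2_iota i (a : C) (al be : k) :
  Phi2 (giota i (tpure (al *: S2_one k + be *: S2_u k) a : stensor A2 S))
  = coset (kI one) (al *: jD one i a + be *: jL (jiota one i a)).
Proof.
have -> : giota i (tpure (al *: S2_one k + be *: S2_u k) a : stensor A2 S)
    = g2 (fun=> 0) 0 (jdelta i (al *: a)) (jdelta i (be *: a)).
  congr (_, _, _); first by apply/ffunP=> j; rewrite !ffunE scale0r.
  apply/ffunP=> j; rewrite !ffunE /jdelta; case: eqP => _; last first.
    by rewrite !(lin0 (tpure_linr _)) addr0.
  rewrite (linD (tpure_linl _)) !(linZ (tpure_linl _)).
  by rewrite !(linZ (tpure_linr _)).
rewrite (Phi2_g2 two_neq0 hC) -(jD_g1 hC Phi_tri Phi_iota).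
rewrite (jel_ext hC (@wdiag0 k) (frefl _)) -(jiota_jel hC).
by rewrite (linZ (jD_lin hC i)) (linZ (jiota_lin hC i)) (linZ (jL_lin hC)).
Qed.

End Values.

(* In the image of (al0 sigma, al1 sigma, al2 sigma) the factor 2 is forced    *)
(* by the bracket with iota_i(1 (x) a): [L_{e_{i+2}} - L_{e_{i+1}}, D_i(a)]   *)
(* is L_{iota_i(a)}, while D_i(a) maps e_{i+1} to iota_i(a) / 2.              *)
Theorem theorem3p3 (k : fieldType) (char_k : 2%N \notin [pchar k])
    (C : qsuperalg k) (one : C) (hC : hurwitz one)
    (Phi : {linear lcar (gSS (S1 k) (para one)) -> lcar (derJ one)})
    (Phi_iso : lie_iso Phi)
    (Phi_tri : forall d : triple (para one), tri d -> Phi (gtri' (S1 k) d) = jDtri d)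
    (Phi_iota : forall (i : 'I_3) (a : C),
       Phi (giota i (tpure (S1_one k) a : stensor (S1 k) (para one))) = jD one i a) :
  exists Phi2 : {linear lcar (gSS (S2 k) (para one)) -> lcar (pstrJ one)},
    [/\ lie_iso Phi2,
        forall x : lcar (gSS (S1 k) (para one)), lmem x ->
          Phi2 (gincl x) = coset (kI one) (Phi x),
        forall d : triple (para one), tri d ->
          Phi2 (gtri' (S2 k) d) = coset (kI one) (jDtri d),
        forall al0 al1 al2 : k, al0 + al1 + al2 = 0 ->
          let s : triple (S2 k) := mk_triple (al0 *: S2_sigma k)
            (al1 *: S2_sigma k) (al2 *: S2_sigma k) in
          let e := jE one in
          let L := @jL k C one in
          [/\ Phi2 (gtri (para one) s) = coset (kI one) (2 *: L (al2 *: e 1 - al1 *: e 2)),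
              Phi2 (gtri (para one) s) = coset (kI one) (2 *: L (al1 *: e 0 - al0 *: e 1))
            & Phi2 (gtri (para one) s) = coset (kI one) (2 *: L (al0 *: e 2 - al2 *: e 0))]
      & forall (i : 'I_3) (a : C) (al be : k),
          Phi2 (giota i (tpure (al *: S2_one k + be *: S2_u k) a
                         : stensor (S2 k) (para one)))
          = coset (kI one) (al *: jD one i a + be *: jL (jiota one i a))].
Proof.
have two_neq0 : 2 != 0 :> k by move: char_k; rewrite inE.
pose Phi2 : {linear lcar (gSS (S2 k) (para one)) -> lcar (pstrJ one)} :=
  HB.pack (Phi2_fun Phi) (GRing.isLinear.Build k _ _ _ (Phi2_fun Phi) (Phi2_lin hC Phi)).
exists Phi2; split.
- split; first split.
  + exact: (gSS2_lie two_neq0 hC Phi_iso Phi_tri Phi_iota).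
  + exact: (pstr_lie two_neq0 hC Phi_iso Phi_tri Phi_iota).
  split.
  + exact: (Phi2_part two_neq0 hC Phi_iso).
  + exact: (Phi2_inj two_neq0 hC Phi_iso).
  + exact: (Phi2_surj two_neq0 hC Phi_iso).
  exact: (Phi2_gbr two_neq0 hC Phi_iso Phi_tri Phi_iota).
- exact: (Phi2_gincl two_neq0 hC).
- exact: (Phi2_tri hC Phi_tri).
- move=> al0 al1 al2 al_sum s e L.
  pose al (i : 'I_3) := if i == 0 then al0 else if i == 1 then al1 else al2.
  have -> : s = S2_tri al.
    apply/ffunP=> i; rewrite !ffunE /al.
    by case: ifP => // _; case: ifP.
  have LE c1 c2 i1 i2 : 2 *: L (c1 *: e i1 - c2 *: e i2)
      = jL (jel one (fun i => 2 * (c1 * (i == i1)%:R - c2 * (i == i2)%:R))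
                (fun=> 0)).
    rewrite /L -(linZ (jL_lin hC)) /e !(jE_jel hC) !(jelZ hC) (jelN hC) (jelD hC).
    rewrite (jelZ hC); congr (jL _); apply: (jel_ext hC) => i //.
    by rewrite !scaler0 subr0 scaler0.
  have al0E : al0 = - (al1 + al2) by apply/eqP; rewrite -addr_eq0 addrA al_sum.
  split; rewrite LE.
  + apply: (Phi2_tri2 two_neq0 hC Phi (t := 0)) => i.
    by case: (I3_cases 0 i) => ->; rewrite /wdiag /al /= ?add0r; ring.
  + apply: (Phi2_tri2 two_neq0 hC Phi (t := - (2 * al1))) => i.
    by case: (I3_cases 0 i) => ->; rewrite /wdiag /al /= ?add0r al0E; ring.
  apply: (Phi2_tri2 two_neq0 hC Phi (t := 2 * al2)) => i.
  by case: (I3_cases 0 i) => ->; rewrite /wdiag /al /= ?add0r al0E; ring.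
exact: (Phi2_iota two_neq0 hC Phi_tri Phi_iota).
Qed.
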